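(* The following are provable in $\mathrm{PZFC}$ (in BS4). Below, each right-hand side ''$\Sigma\models\varphi\leftrightarrow\Sigma\vdash_L\varphi$'' is asserted for all sets of formulas $\Sigma$ and all formulas $\varphi$, and $\models$ is Tarski semantic consequence. (1) $\mathrm{ACLA}\ \leftrightarrow\ (\Sigma\models\varphi\leftrightarrow\Sigma\vdash_{BS4}\varphi)$. (2) $\mathrm{ACLA}_{\mathrm{cons}}\ \leftrightarrow\ (\Sigma\models\varphi\leftrightarrow\Sigma\vdash_{K3^\to}\varphi)$. (3) $\mathrm{ACLA}_{\mathrm{comp}}\ \leftrightarrow\ (\Sigma\models\varphi\leftrightarrow\Sigma\vdash_{LFI1}\varphi)$. (4) $\forall x(x^!=x^?)\ \leftrightarrow\ (\Sigma\models\varphi\leftrightarrow\Sigma\vdash_{FOL}\varphi)$. (5) Exactly one of the four situations in (1)–(4) holds, i.e. exactly one of $\mathrm{ACLA}$, $\mathrm{ACLA}_{\mathrm{cons}}$, $\mathrm{ACLA}_{\mathrm{comp}}$, $\forall x(x^!=x^?)$ holds.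
   Context: LOGIC BS4. BS4 is a four-valued first-order logic with primitive symbols $\sim$ (native negation), $\wedge,\vee,\to,\bot,\forall,\exists,=$; $\varphi\leftrightarrow\psi$ is $(\varphi\to\psi)\wedge(\psi\to\varphi)$. Vocabularies contain only constant and relation symbols. A T/F-model $\mathcal M$ has a (nonempty) domain $M$, an element $c^{\mathcal M}\in M$ for each constant, for each $n$-ary relation symbol $R$ two sets $(R^{\mathcal M})^+,(R^{\mathcal M})^-\subseteq M^n$ (with no relation assumed between them), the relation $=^+$ which is true identity on $M$, and a symmetric binary relation $=^-$ on $M$. Truth $\models^T$ and falsity $\models^F$ are defined recursively: an atomic formula is true iff its $+$ interpretation holds and false iff its $-$ interpretation holds; $\sim\varphi$ is true iff $\varphi$ is false, and false iff $\varphi$ is true; $\varphi\wedge\psi$ is true iff both are true, false iff at least one is false; $\varphi\vee\psi$ is true iff at least one is true, false iff both are false; $\varphi\to\psi$ is true iff ($\varphi$ true implies $\psi$ true), false iff $\varphi$ is true and $\psi$ is false; $\exists x\varphi$ is true iff some instance is true, false iff all instances are false; $\forall x\varphi$ is true iff all instances are true, false iff some instance is false; $\bot$ is never true and always false. $\Sigma\vdash_{BS4}\varphi$ means: for every T/F-model $\mathcal M$, if $\mathcal M\models^T\Sigma$ then $\mathcal M\models^T\varphi$ (there is a sound and complete Hilbert calculus for this relation). ABBREVIATIONS. $\varphi\Rightarrow\psi$ is $(\varphi\to\psi)\wedge(\sim\psi\to\sim\varphi)$; $\varphi\Leftrightarrow\psi$ is $(\varphi\leftrightarrow\psi)\wedge(\sim\varphi\leftrightarrow\sim\psi)$;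 $\neg\varphi$ is $\varphi\to\bot$; $!\varphi$ is $\sim\neg\varphi$; $?\varphi$ is $\neg\sim\varphi$; $\circ\varphi$ is $!\varphi\leftrightarrow{?}\varphi$ (''$\varphi$ is classical''). $x\neq y$, $x\notin y$, $x\not\subseteq y$ are $\sim(x=y)$, $\sim(x\in y)$, $\sim(x\subseteq y)$. SETS. The language of set theory is $\{\in\}$. $x=\{y:\varphi(y)\}$ abbreviates $\forall y(y\in x\Leftrightarrow\varphi(y))$. $x\subseteq y$ is $\forall z(z\in x\Rightarrow z\in y)$. $x^!=\{y:{!}(y\in x)\}$, $x^?=\{y:{?}(y\in x)\}$. A set $x$ is classical if $\forall y(y\in x^!\leftrightarrow y\in x^?)$. $\{u_0,\dots,u_n\}=\{y:{!}(y=u_0)\vee\dots\vee{!}(y=u_n)\}$. $\langle u,v\rangle=\{\{u\},\{u,v\}\}$; the ordered pair $(a,b)$ is the set with $(a,b)^!=\{\langle x,\varnothing\rangle:x\in a^!\}\cup\{\langle y,\{\varnothing\}\rangle:y\in b^!\}$ and $(a,b)^?$ given likewise from $a^?,b^?$. $A\times B=\{(a,b):a\in A\wedge b\in B\}$; $\mathrm{dom}(R)=\{x:\exists y\,(x,y)\in R\}$. For a classical set $A$, a classical function from $A$ to $B$ is a classical set $f\subseteq A\times B$ with $\mathrm{dom}(f)=A$ and $\forall x\forall y\forall z(((x,y)\in f\wedge(x,z)\in f)\to{!}(y=z))$. AXIOMS OF PZFC (in BS4; schemas for all formulas $\varphi$, with parameters). Extensionality: $\forall x\forall y(x=y\Leftrightarrow\forall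 z(z\in x\Leftrightarrow z\in y))$. Comprehension: $\forall u\exists x\forall y(y\in x\Leftrightarrow(y\in u\wedge\varphi(y)))$. Classical Superset: $\forall x\exists C(x\subseteq C\wedge\forall y\,{\circ}(y\in C))$. Replacement: $[\forall x\forall y\,{\circ}\varphi(x,y)\wedge\forall x\exists y(\varphi(x,y)\wedge\forall z(\varphi(x,z)\to{!}(y=z)))]\to\forall x\exists y\forall z(z\in y\Leftrightarrow\exists w(w\in x\wedge\varphi(w,z)))$. Pairing: $\forall u\forall v\exists x\forall y(y\in x\Leftrightarrow({!}(y=u)\vee{!}(y=v)))$. Power Set: $\forall u\exists v\forall x(x\in v\Leftrightarrow{!}(x\subseteq u))$. Union: $\forall u\exists x\forall y(y\in x\Leftrightarrow\exists z(y\in z\wedge z\in u))$. Infinity: $\exists x(\varnothing\in x\wedge\forall y(y\in x\to y\cup\{y\}\in x))$. Foundation: $\forall x(\forall y(y\in x^!\cup x^?\to\varphi(y))\to\varphi(x))\to\forall u\,\varphi(u)$. Choice: for every classical $u$, if $\forall x(x\in u\to\exists y(y\in x))$ then there is a classical function $f$ with $\mathrm{dom}(f)=u$ and $f(x)\in x$ for all $x\in u$. ANTI-CLASSICALITY AXIOMS. ACLA: $\exists x(x^!\not\subseteq x^?)\wedge\exists x(x^?\not\subseteq x^!)$. $\mathrm{ACLA}_{\mathrm{cons}}$: $\forall x(x^!\subseteq x^?)\wedge\exists x(x^?\not\subseteq x^!)$. $\mathrm{ACLA}_{\mathrm{comp}}$: $\forall x(x^?\subseteq x^!)\wedge\exists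 x(x^!\not\subseteq x^?)$. SEMANTICS INSIDE PZFC. First-order syntax (with $\sim,\wedge,\vee,\to,\bot,\forall,\exists,=$; no function symbols) is coded by classical sets. A Tarski model $\mathcal M$ consists of a classical set $M$ as domain and (not necessarily classical) interpretations for all constant and relation symbols ($R^{\mathcal M}\subseteq M^n$). Satisfaction is defined recursively, all equivalences being strong ($\Leftrightarrow$), with the logical words on the right being those of the BS4 meta-theory: $\mathcal M\models(t=s)[a,b]\Leftrightarrow a=b$; $\mathcal M\models R(t_1,\dots,t_n)[a_1,\dots,a_n]\Leftrightarrow R^{\mathcal M}(a_1,\dots,a_n)$; $\mathcal M\models{\sim}\varphi\Leftrightarrow{\sim}(\mathcal M\models\varphi)$; $\mathcal M\models\varphi\wedge\psi\Leftrightarrow(\mathcal M\models\varphi\wedge\mathcal M\models\psi)$, and similarly for $\vee,\to,\leftrightarrow$; $\mathcal M\models\exists x\varphi(x)\Leftrightarrow\mathcal M\models\varphi[a]$ for some $a\in M$; $\mathcal M\models\forall x\varphi(x)\Leftrightarrow\mathcal M\models\varphi[a]$ for all $a\in M$; $\mathcal M\models\bot\Leftrightarrow\bot$. Tarski consequence: $\Sigma\models\varphi$ iff for every Tarski model $\mathcal M$, $\mathcal M\models\Sigma\to\mathcal M\models\varphi$. Inside PZFC, a T/F-model $\mathcal M$ has a (nonempty) classical set $M$ as domain, an element $c^{\mathcal M}\in M$ for each constant, for each $n$-ary relation symbol $R$ two classical subsets $(R^{\mathcal M})^+,(R^{\mathcal M})^-$ of $M^n$ (with no relation assumed between them), and classical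 subsets $=^+$ and $=^-$ of $M\times M$, where $=^-$ is symmetric and $a=^+b\leftrightarrow{!}(a=b)$ for $a,b\in M$. The classical relations $\mathcal M\models^T\varphi$ and $\mathcal M\models^F\varphi$ are defined recursively: for atomic $\varphi$, $\mathcal M\models^T\varphi$ iff its $+$ interpretation holds, and $\mathcal M\models^F\varphi$ iff its $-$ interpretation holds; $\mathcal M\models^T{\sim}\varphi$ iff $\mathcal M\models^F\varphi$, and $\mathcal M\models^F{\sim}\varphi$ iff $\mathcal M\models^T\varphi$; $\mathcal M\models^T\varphi\wedge\psi$ iff $\mathcal M\models^T\varphi$ and $\mathcal M\models^T\psi$, and $\mathcal M\models^F\varphi\wedge\psi$ iff $\mathcal M\models^F\varphi$ or $\mathcal M\models^F\psi$; $\mathcal M\models^T\varphi\vee\psi$ iff $\mathcal M\models^T\varphi$ or $\mathcal M\models^T\psi$, and $\mathcal M\models^F\varphi\vee\psi$ iff $\mathcal M\models^F\varphi$ and $\mathcal M\models^F\psi$; $\mathcal M\models^T\varphi\to\psi$ iff ($\mathcal M\models^T\varphi$ implies $\mathcal M\models^T\psi$), and $\mathcal M\models^F\varphi\to\psi$ iff $\mathcal M\models^T\varphi$ and $\mathcal M\models^F\psi$; $\mathcal M\models^T\exists x\varphi(x)$ iff $\mathcal M\models^T\varphi[a]$ for some $a\in M$, and $\mathcal M\models^F\exists x\varphi(x)$ iff $\mathcal M\models^F\varphi[a]$ for all $a\in M$; $\mathcal M\models^T\forall x\varphi(x)$ iff $\mathcal M\models^T\varphi[a]$ for all $a\in M$,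 and $\mathcal M\models^F\forall x\varphi(x)$ iff $\mathcal M\models^F\varphi[a]$ for some $a\in M$; $\mathcal M\models^T\bot$ never holds and $\mathcal M\models^F\bot$ always holds. The relation $\Sigma\vdash_{BS4}\varphi$ inside PZFC is the T/F-semantic consequence relation: for every such T/F-model $\mathcal M$, if $\mathcal M\models^T\Sigma$ then $\mathcal M\models^T\varphi$. FRAGMENTS. $K3^\to$ is the logic obtained from BS4 by restricting to T/F-models with $(R^{\mathcal M})^+\cap(R^{\mathcal M})^-=\varnothing$ for all relation symbols $R$, including equality. $LFI1$ is obtained by restricting to T/F-models with $(R^{\mathcal M})^+\cup(R^{\mathcal M})^-=M^n$ for all $n$-ary relation symbols $R$, including equality. $FOL$ is classical first-order logic with equality ($\sim$ being classical negation). $\vdash_L$ is the corresponding consequence relation. *)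

(* Defs.v *)
(** The natural numbers in [Mem] and [Eq] are de Bruijn indices. *)
Inductive form : Type :=
| Bot
| Mem (i j : nat)
| Eq (i j : nat)
| Neg (p : form)
| And (p q : form)
| Or (p q : form)
| Imp (p q : form)
| All (p : form)
| Ex (p : form).

(** The truth interpretation of equality is identity of the Rocq type [dom];
    nothing relates [mem_pos] to [mem_neg] or [eq_neg] to identity. *)
Record tfmodel : Type := TFModel {
  dom : Type;
  dom_inh : inhabited dom;
  mem_pos : dom -> dom -> Prop;
  mem_neg : dom -> dom -> Prop;
  eq_neg : dom -> dom -> Prop;
  eq_neg_sym : forall a b, eq_neg a b -> eq_neg b a
}.

Definition scons {T : Type} (a : T) (rho : nat -> T) : nat -> T :=
  fun i => match i with O => a | S j => rho j end.

Fixpoint truth (M : tfmodel) (rho : nat -> dom M) (p : form) {struct p} : Prop :=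
  match p with
  | Bot => False
  | Mem i j => mem_pos M (rho i) (rho j)
  | Eq i j => rho i = rho j
  | Neg q => falsity M rho q
  | And q r => truth M rho q /\ truth M rho r
  | Or q r => truth M rho q \/ truth M rho r
  | Imp q r => truth M rho q -> truth M rho r
  | All q => forall a : dom M, truth M (scons a rho) q
  | Ex q => exists a : dom M, truth M (scons a rho) q
  end
with falsity (M : tfmodel) (rho : nat -> dom M) (p : form) {struct p} : Prop :=
  match p with
  | Bot => True
  | Mem i j => mem_neg M (rho i) (rho j)
  | Eq i j => eq_neg M (rho i) (rho j)
  | Neg q => truth M rho q
  | And q r => falsity M rho q \/ falsity M rho r
  | Or q r => falsity M rho q /\ falsity M rho r
  | Imp q r => truth M rho q /\ falsity M rho r
  | All q => exists a : dom M, falsity M (scons a rho) q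
  | Ex q => forall a : dom M, falsity M (scons a rho) q
  end.

(** A formula with free variables holds in [M] when all its instances do, so
    the parameters of an axiom schema are universally quantified. *)
Definition models (M : tfmodel) (p : form) : Prop :=
  forall rho : nat -> dom M, truth M rho p.

Definition bs4_proves (Sigma : form -> Prop) (p : form) : Prop :=
  forall M : tfmodel, (forall q, Sigma q -> models M q) -> models M p.

(** A [bform] is a formula awaiting the number [d] of binders it is placed
    under. A [var] names a binder by its level, counted from the outside, so
    that it denotes the index [d - S x] under [d] binders. Bodies of
    quantifiers are ordinary Rocq functions of the bound variable, and
    [closed b] is the de Bruijn sentence denoted by [b]. *)
Definition var : Type := nat.
Definition bform : Type := nat -> form.
Definition closed (b : bform) : form := b 0.

Definition ix (d : nat) (x : var) : nat := d - S x.

Definition bbot : bform := fun _ => Bot.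
Definition bmem (x y : var) : bform := fun d => Mem (ix d x) (ix d y).
Definition beq (x y : var) : bform := fun d => Eq (ix d x) (ix d y).
Definition bneg (p : bform) : bform := fun d => Neg (p d).
Definition band (p q : bform) : bform := fun d => And (p d) (q d).
Definition bor (p q : bform) : bform := fun d => Or (p d) (q d).
Definition bimp (p q : bform) : bform := fun d => Imp (p d) (q d).
Definition ball (f : var -> bform) : bform := fun d => All (f d (S d)).
Definition bex (f : var -> bform) : bform := fun d => Ex (f d (S d)).

Fixpoint ren (xi : nat -> nat) (p : form) : form :=
  let up := scons 0 (fun i => S (xi i)) in
  match p with
  | Bot => Bot
  | Mem i j => Mem (xi i) (xi j)
  | Eq i j => Eq (xi i) (xi j)
  | Neg q => Neg (ren xi q)
  | And q r => And (ren xi q) (ren xi r)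
  | Or q r => Or (ren xi q) (ren xi r)
  | Imp q r => Imp (ren xi q) (ren xi r)
  | All q => All (ren up q)
  | Ex q => Ex (ren up q)
  end.

(** φ(x) and φ(x,y) for an arbitrary formula φ: the first free indices of φ
    are its arguments, and the remaining ones are parameters, which stay free
    in the resulting formula. *)
Definition app1 (phi : form) (x : var) : bform :=
  fun d => ren (scons (ix d x) (fun j => d + j)) phi.
Definition app2 (phi : form) (x y : var) : bform :=
  fun d => ren (scons (ix d x) (scons (ix d y) (fun j => d + j))) phi.

(** Class terms {y : φ(y)}; every variable is also a class. *)
Definition cls : Type := var -> bform.
Definition elem (x : var) : cls := fun y => bmem y x.
Coercion elem : var >-> cls.
Definition inc (y : var) (A : cls) : bform := A y.

Declare Scope bs4_scope.
Delimit Scope bs4_scope with bs4.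
Local Open Scope bs4_scope.

Notation "∀ x .. y , p" := (ball (fun x => .. (ball (fun y => p)) ..))
  (at level 10, x binder, y binder, p at level 200,
   format "'[  ' '[  ' ∀  x  ..  y ']' ,  '/' p ']'") : bs4_scope.
Notation "∃ x .. y , p" := (bex (fun x => .. (bex (fun y => p)) ..))
  (at level 10, x binder, y binder, p at level 200,
   format "'[  ' '[  ' ∃  x  ..  y ']' ,  '/' p ']'") : bs4_scope.
Notation "⊥" := bbot : bs4_scope.
Notation "x ∈ A" := (inc x A) (at level 70) : bs4_scope.
Notation "x ≐ y" := (beq x y) (at level 70) : bs4_scope.
Notation "∼ p" := (bneg p) (at level 75, right associativity) : bs4_scope.
Notation "p ∧ q" := (band p q) (at level 80, right associativity) : bs4_scope.
Notation "p ∨ q" := (bor p q) (at level 85, right associativity) : bs4_scope.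
Notation "p → q" := (bimp p q)
  (at level 99, q at level 200, right associativity) : bs4_scope.

Notation "p ↔ q" := (band (bimp p q) (bimp q p))
  (at level 95, no associativity) : bs4_scope.
Notation "¬ p" := (bimp p bbot) (at level 75, right associativity) : bs4_scope.

Definition simp (p q : bform) : bform := (p → q) ∧ (∼ q → ∼ p).
Notation "p ⇒ q" := (simp p q)
  (at level 99, q at level 200, right associativity) : bs4_scope.
Definition siff (p q : bform) : bform := (p ↔ q) ∧ (∼ p ↔ ∼ q).
Notation "p ⇔ q" := (siff p q) (at level 95, no associativity) : bs4_scope.

(** [bang], [quest] and [circ] are !φ, ?φ and ∘φ. *)
Definition bang (p : bform) : bform := ∼ ¬ p.
Definition quest (p : bform) : bform := ¬ ∼ p.
Definition circ (p : bform) : bform := bang p ↔ quest p.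

(** For a variable [x], [x ≡ A] is the abbreviation x = {y : φ(y)}. *)
Definition ceq (A B : cls) : bform := ∀ y, y ∈ A ⇔ y ∈ B.
Notation "A ≡ B" := (ceq A B) (at level 70) : bs4_scope.
Definition csub (A B : cls) : bform := ∀ z, z ∈ A ⇒ z ∈ B.
Notation "A ⊆ B" := (csub A B) (at level 70) : bs4_scope.

(** x^! and x^? *)
Definition cbang (A : cls) : cls := fun y => bang (y ∈ A).
Definition cquest (A : cls) : cls := fun y => quest (y ∈ A).

Definition classical (A : cls) : bform := ∀ y, y ∈ cbang A ↔ y ∈ cquest A.

Definition cempty : cls := fun _ => ⊥.
Definition cup (A B : cls) : cls := fun z => z ∈ A ∨ z ∈ B.
Definition cap (A B : cls) : cls := fun z => z ∈ A ∧ z ∈ B.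
Definition upair (u v : var) : cls := fun y => bang (y ≐ u) ∨ bang (y ≐ v).
Definition sing (u : var) : cls := fun y => bang (y ≐ u).
Definition csucc (y : var) : cls := cup y (sing y).

(** φ({y : A(y)}). Sets need not be equal to themselves in a classical way,
    so a set is always introduced by the classical condition !(x = {y : A(y)});
    the truth value of [the A phi] is then that of φ at this set. *)
Definition the (A : cls) (phi : var -> bform) : bform :=
  ∃ x, bang (x ≡ A) ∧ phi x.

(** !(z = ⟨u,v⟩) *)
Definition is_kpair (z u v : var) : bform :=
  the (sing u) (fun a => the (upair u v) (fun b => bang (z ≡ upair a b))).

(** {⟨x,∅⟩ : x ∈ A} ∪ {⟨y,{∅}⟩ : y ∈ B} *)
Definition tagged (A B : cls) : cls := fun z =>
  (∃ x, x ∈ A ∧ the cempty (fun e => is_kpair z x e)) ∨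
  (∃ y, y ∈ B ∧ the cempty (fun e => the (sing e) (fun f => is_kpair z y f))).

(** !(p = (a,b)) for the ordered pair determined by (a,b)^! and (a,b)^? *)
Definition is_opair (p a b : var) : bform :=
  bang (cbang p ≡ tagged (cbang a) (cbang b) ∧
        cquest p ≡ tagged (cquest a) (cquest b)).

(** (a,b) ∈ A *)
Definition pmem (a b : var) (A : cls) : bform := ∃ p, is_opair p a b ∧ p ∈ A.

Definition cprod (A B : cls) : cls := fun z =>
  ∃ a b, is_opair z a b ∧ (a ∈ A ∧ b ∈ B).
Definition cdom (R : cls) : cls := fun x => ∃ y, pmem x y R.

(** f is a classical function from A to B *)
Definition is_fun (f : var) (A B : cls) : bform :=
  classical f ∧ f ⊆ cprod A B ∧ cdom f ≡ A ∧
  ∀ x y z, (pmem x y f ∧ pmem x z f) → bang (y ≐ z).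

Definition ax_extensionality : bform :=
  ∀ x y, x ≐ y ⇔ (∀ z, z ∈ x ⇔ z ∈ y).
Definition ax_comprehension (phi : form) : bform :=
  ∀ u, ∃ x, ∀ y, y ∈ x ⇔ (y ∈ u ∧ app1 phi y).
Definition ax_classical_superset : bform :=
  ∀ x, ∃ C, x ⊆ C ∧ ∀ y, circ (y ∈ C).
Definition ax_replacement (phi : form) : bform :=
  ((∀ x y, circ (app2 phi x y)) ∧
   (∀ x, ∃ y, app2 phi x y ∧ ∀ z, app2 phi x z → bang (y ≐ z))) →
  ∀ x, ∃ y, ∀ z, z ∈ y ⇔ (∃ w, w ∈ x ∧ app2 phi w z).
Definition ax_pairing : bform :=
  ∀ u v, ∃ x, ∀ y, y ∈ x ⇔ (bang (y ≐ u) ∨ bang (y ≐ v)).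
Definition ax_power_set : bform :=
  ∀ u, ∃ v, ∀ x, x ∈ v ⇔ bang (x ⊆ u).
Definition ax_union : bform :=
  ∀ u, ∃ x, ∀ y, y ∈ x ⇔ (∃ z, y ∈ z ∧ z ∈ u).

Definition inductive (x : var) : bform :=
  the cempty (fun e => e ∈ x) ∧ ∀ y, y ∈ x → the (csucc y) (fun s => s ∈ x).
Definition ax_infinity : bform := ∃ x, inductive x.

Definition ax_foundation (phi : form) : bform :=
  (∀ x, (∀ y, y ∈ cup (cbang x) (cquest x) → app1 phi y) → app1 phi x) →
  ∀ u, app1 phi u.
Definition ax_choice : bform :=
  ∀ u, classical u → (∀ x, x ∈ u → ∃ y, y ∈ x) →
    ∃ f B, is_fun f u B ∧ ∀ x, x ∈ u → ∃ y, pmem x y f ∧ y ∈ x.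

Inductive PZFC : form -> Prop :=
| PZFC_extensionality : PZFC (closed ax_extensionality)
| PZFC_comprehension phi : PZFC (closed (ax_comprehension phi))
| PZFC_classical_superset : PZFC (closed ax_classical_superset)
| PZFC_replacement phi : PZFC (closed (ax_replacement phi))
| PZFC_pairing : PZFC (closed ax_pairing)
| PZFC_power_set : PZFC (closed ax_power_set)
| PZFC_union : PZFC (closed ax_union)
| PZFC_infinity : PZFC (closed ax_infinity)
| PZFC_foundation phi : PZFC (closed (ax_foundation phi))
| PZFC_choice : PZFC (closed ax_choice).

Definition ACLA : bform :=
  (∃ x, ∼ (cbang x ⊆ cquest x)) ∧ (∃ x, ∼ (cquest x ⊆ cbang x)).
Definition ACLA_cons : bform :=
  (∀ x, cbang x ⊆ cquest x) ∧ (∃ x, ∼ (cquest x ⊆ cbang x)).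
Definition ACLA_comp : bform :=
  (∀ x, cquest x ⊆ cbang x) ∧ (∃ x, ∼ (cbang x ⊆ cquest x)).
Definition all_classical : bform := ∀ x, cbang x ≡ cquest x.

Definition omega : cls := fun n => ∀ x, (classical x ∧ inductive x) → n ∈ x.

(** !(x = k) for the von Neumann numeral k *)
Fixpoint is_num (k : nat) (x : var) : bform :=
  match k with
  | O => bang (x ≡ cempty)
  | S k => ∃ y, is_num k y ∧ bang (x ≡ csucc y)
  end.
Definition the_num (k : nat) (phi : var -> bform) : bform :=
  ∃ x, is_num k x ∧ phi x.

(** A^n, whose elements are the classical functions from n = {0,...,n-1} to A *)
Definition tuples (A : cls) (n : var) : cls := fun t => bang (is_fun t n A).

(** A vocabulary consists of a classical set of constant symbols, a classical
    set of relation symbols (all symbols being classical sets) and a classical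
    function giving the arity of each relation symbol. *)
Record vocab : Type := Vocab { consts : var; rels : var; arity : var }.

Definition is_vocab (L : vocab) : bform :=
  classical (consts L) ∧ (∀ c, c ∈ consts L → classical c) ∧
  classical (rels L) ∧ (∀ R, R ∈ rels L → classical R) ∧
  is_fun (arity L) (rels L) omega.

Definition has_arity (L : vocab) (R n : var) : bform :=
  R ∈ rels L ∧ pmem R n (arity L).

(** The variable v_i is (0,i) and the constant c is (1,c). *)
Definition is_varterm (t i : var) : bform :=
  i ∈ omega ∧ the_num 0 (fun k => is_opair t k i).
Definition is_constterm (L : vocab) (t c : var) : bform :=
  c ∈ consts L ∧ the_num 1 (fun k => is_opair t k c).
Definition term (L : vocab) : cls := fun t =>
  (∃ i, is_varterm t i) ∨ (∃ c, is_constterm L t c).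

(** !(z = (k,(a,b))) *)
Definition is_code (k : nat) (z a b : var) : bform :=
  the_num k (fun n => ∃ q, is_opair q a b ∧ is_opair z n q).

Definition bot_code (z : var) : bform := the cempty (fun e => is_code 0 z e e).
Definition eq_code (z t u : var) : bform := is_code 1 z t u.
Definition rel_code (z R t : var) : bform := is_code 2 z R t.
Definition neg_code (z p : var) : bform := the cempty (fun e => is_code 3 z p e).
Definition and_code (z p q : var) : bform := is_code 4 z p q.
Definition or_code (z p q : var) : bform := is_code 5 z p q.
Definition imp_code (z p q : var) : bform := is_code 6 z p q.
Definition all_code (z i p : var) : bform := is_code 7 z i p.
Definition ex_code (z i p : var) : bform := is_code 8 z i p.

Definition formula_closed (L : vocab) (X : cls) : bform :=
  (∀ z, bot_code z → z ∈ X) ∧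
  (∀ z t u, (t ∈ term L ∧ u ∈ term L ∧ eq_code z t u) → z ∈ X) ∧
  (∀ z R n t,
     (has_arity L R n ∧ t ∈ tuples (term L) n ∧ rel_code z R t) → z ∈ X) ∧
  (∀ z p, (p ∈ X ∧ neg_code z p) → z ∈ X) ∧
  (∀ z p q, (p ∈ X ∧ q ∈ X ∧ and_code z p q) → z ∈ X) ∧
  (∀ z p q, (p ∈ X ∧ q ∈ X ∧ or_code z p q) → z ∈ X) ∧
  (∀ z p q, (p ∈ X ∧ q ∈ X ∧ imp_code z p q) → z ∈ X) ∧
  (∀ z i p, (i ∈ omega ∧ p ∈ X ∧ all_code z i p) → z ∈ X) ∧
  (∀ z i p, (i ∈ omega ∧ p ∈ X ∧ ex_code z i p) → z ∈ X).

(** The set of formulas is the least classical set closed under formation. *)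
Definition formula (L : vocab) : cls := fun z =>
  ∀ X, (classical X ∧ formula_closed L X) → z ∈ X.

(** In all structures below [M] is the domain and [K] the interpretation of
    the constants. A family (R^M), indexed by the relation symbols R, of sets
    of tuples is given by the set I of all pairs (R,t) with t ∈ R^M;
    [rel_of I R] recovers R^M. *)
Definition rel_of (I : var) (R : var) : cls := fun t => pmem R t I.

Definition rel_space (L : vocab) (M : var) : cls := fun z =>
  ∃ R n t, is_opair z R t ∧ has_arity L R n ∧ t ∈ tuples M n.

Definition assignments (M : var) : cls := fun s => bang (is_fun s omega M).

(** s[i := a] *)
Definition update (s i a : var) : cls := fun z =>
  is_opair z i a ∨ (∃ j b, is_opair z j b ∧ pmem j b s ∧ ¬ (j ≐ i)).

Definition value (L : vocab) (K s t a : var) : bform :=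
  (∃ i, is_varterm t i ∧ pmem i a s) ∨ (∃ c, is_constterm L t c ∧ pmem c a K).

(** r is the tuple of the values of the terms of the n-tuple t. *)
Definition values (L : vocab) (K s n t r : var) : bform :=
  ∀ i x a, (i ∈ n ∧ pmem i x t ∧ pmem i a r) → value L K s x a.

(** [recursion L M K clause] says that [clause z s c] holds for every formula
    z and assignment s, where c is the shape of z: its main connective with
    its immediate subformulas or, when z is atomic, its relation symbol with
    the values of its terms under s. *)
Inductive shape : Type :=
| SBot
| SEq (a b : var)
| SRel (R r : var)
| SNeg (p : var)
| SAnd (p q : var)
| SOr (p q : var)
| SImp (p q : var)
| SAll (i p : var)
| SEx (i p : var).

Definition recursion (L : vocab) (M K : var)
    (clause : var -> var -> shape -> bform) : bform :=
  ∀ s, s ∈ assignments M →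
  (∀ z, bot_code z → clause z s SBot) ∧
  (∀ z t u a b,
     (t ∈ term L ∧ u ∈ term L ∧ eq_code z t u ∧
      value L K s t a ∧ value L K s u b) → clause z s (SEq a b)) ∧
  (∀ z R n t r,
     (has_arity L R n ∧ t ∈ tuples (term L) n ∧ rel_code z R t ∧
      r ∈ tuples M n ∧ values L K s n t r) → clause z s (SRel R r)) ∧
  (∀ z p, (p ∈ formula L ∧ neg_code z p) → clause z s (SNeg p)) ∧
  (∀ z p q, (p ∈ formula L ∧ q ∈ formula L ∧ and_code z p q) →
     clause z s (SAnd p q)) ∧
  (∀ z p q, (p ∈ formula L ∧ q ∈ formula L ∧ or_code z p q) →
     clause z s (SOr p q)) ∧
  (∀ z p q, (p ∈ formula L ∧ q ∈ formula L ∧ imp_code z p q) →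
     clause z s (SImp p q)) ∧
  (∀ z i p, (i ∈ omega ∧ p ∈ formula L ∧ all_code z i p) →
     clause z s (SAll i p)) ∧
  (∀ z i p, (i ∈ omega ∧ p ∈ formula L ∧ ex_code z i p) →
     clause z s (SEx i p)).

(** (p, s[i := a]) ∈ S *)
Definition inst (S : var) (p s i a : var) : bform :=
  the (update s i a) (fun s' => pmem p s' S).

(** A formula with free variables holds in a structure when it is satisfied
    under all assignments. *)
Definition holds (S M p : var) : bform := ∀ s, s ∈ assignments M → pmem p s S.
Definition holds_all (S M Sigma : var) : bform :=
  ∀ p, p ∈ Sigma → holds S M p.

Definition is_tarski (L : vocab) (M K I : var) : bform :=
  classical M ∧ (∃ a, a ∈ M) ∧ is_fun K (consts L) M ∧ I ⊆ rel_space L M.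

Definition tarski_clause (M I S : var) (z s : var) (c : shape) : bform :=
  pmem z s S ⇔
  match c with
  | SBot => ⊥
  | SEq a b => a ≐ b
  | SRel R r => r ∈ rel_of I R
  | SNeg p => ∼ pmem p s S
  | SAnd p q => pmem p s S ∧ pmem q s S
  | SOr p q => pmem p s S ∨ pmem q s S
  | SImp p q => pmem p s S → pmem q s S
  | SAll i p => ∀ a, a ∈ M → inst S p s i a
  | SEx i p => ∃ a, a ∈ M ∧ inst S p s i a
  end.

(** S is the satisfaction relation of (M,K,I); it need not be classical. *)
Definition tarski_sat (L : vocab) (M K I S : var) : bform :=
  S ⊆ cprod (formula L) (assignments M) ∧
  recursion L M K (tarski_clause M I S).

Definition tarski_holds (L : vocab) (M K I p : var) : bform :=
  ∃ S, bang (tarski_sat L M K I S) ∧ holds S M p.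
Definition tarski_holds_all (L : vocab) (M K I Sigma : var) : bform :=
  ∀ p, p ∈ Sigma → tarski_holds L M K I p.

Definition tarski_conseq (L : vocab) (Sigma phi : var) : bform :=
  ∀ M K I, is_tarski L M K I →
    (tarski_holds_all L M K I Sigma → tarski_holds L M K I phi).

(** [P], [N] are the positive and negative interpretations of the relation
    symbols and [EP], [EN] those of equality. *)
Record tfs : Type := TFS { tM : var; tK : var; tP : var; tN : var; tEP : var; tEN : var }.

Definition is_tf (L : vocab) (X : tfs) : bform :=
  classical (tM X) ∧ (∃ a, a ∈ tM X) ∧ is_fun (tK X) (consts L) (tM X) ∧
  classical (tP X) ∧ tP X ⊆ rel_space L (tM X) ∧
  classical (tN X) ∧ tN X ⊆ rel_space L (tM X) ∧
  classical (tEP X) ∧ tEP X ⊆ cprod (tM X) (tM X) ∧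
  classical (tEN X) ∧ tEN X ⊆ cprod (tM X) (tM X) ∧
  (∀ a b, pmem a b (tEN X) → pmem b a (tEN X)) ∧
  (∀ a b, (a ∈ tM X ∧ b ∈ tM X) → (pmem a b (tEP X) ↔ bang (a ≐ b))).

Definition tf_clause (X : tfs) (T F : var) (z s : var) (c : shape) : bform :=
  (pmem z s T ↔
   match c with
   | SBot => ⊥
   | SEq a b => pmem a b (tEP X)
   | SRel R r => r ∈ rel_of (tP X) R
   | SNeg p => pmem p s F
   | SAnd p q => pmem p s T ∧ pmem q s T
   | SOr p q => pmem p s T ∨ pmem q s T
   | SImp p q => pmem p s T → pmem q s T
   | SAll i p => ∀ a, a ∈ tM X → inst T p s i a
   | SEx i p => ∃ a, a ∈ tM X ∧ inst T p s i a
   end) ∧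
  (pmem z s F ↔
   match c with
   | SBot => ¬ ⊥
   | SEq a b => pmem a b (tEN X)
   | SRel R r => r ∈ rel_of (tN X) R
   | SNeg p => pmem p s T
   | SAnd p q => pmem p s F ∨ pmem q s F
   | SOr p q => pmem p s F ∧ pmem q s F
   | SImp p q => pmem p s T ∧ pmem q s F
   | SAll i p => ∃ a, a ∈ tM X ∧ inst F p s i a
   | SEx i p => ∀ a, a ∈ tM X → inst F p s i a
   end).

(** T and F are the classical truth and falsity relations of X. *)
Definition tf_sat (L : vocab) (X : tfs) (T F : var) : bform :=
  classical T ∧ T ⊆ cprod (formula L) (assignments (tM X)) ∧
  classical F ∧ F ⊆ cprod (formula L) (assignments (tM X)) ∧
  recursion L (tM X) (tK X) (tf_clause X T F).

Definition tf_holds (L : vocab) (X : tfs) (p : var) : bform :=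
  ∃ T F, bang (tf_sat L X T F) ∧ holds T (tM X) p.
Definition tf_holds_all (L : vocab) (X : tfs) (Sigma : var) : bform :=
  ∀ p, p ∈ Sigma → tf_holds L X p.

Definition tf_conseq_in (C : vocab -> tfs -> bform)
    (L : vocab) (Sigma phi : var) : bform :=
  ∀ M K P N EP EN, let X := TFS M K P N EP EN in
    (is_tf L X ∧ C L X) → (tf_holds_all L X Sigma → tf_holds L X phi).

Definition is_consistent (L : vocab) (X : tfs) : bform :=
  (∀ R, R ∈ rels L → cap (rel_of (tP X) R) (rel_of (tN X) R) ≡ cempty) ∧
  cap (tEP X) (tEN X) ≡ cempty.
Definition is_complete (L : vocab) (X : tfs) : bform :=
  (∀ R n, has_arity L R n →
     cup (rel_of (tP X) R) (rel_of (tN X) R) ≡ tuples (tM X) n) ∧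
  cup (tEP X) (tEN X) ≡ cprod (tM X) (tM X).

Definition bs4_conseq (L : vocab) (Sigma phi : var) : bform :=
  ∀ M K P N EP EN, let X := TFS M K P N EP EN in
    is_tf L X → (tf_holds_all L X Sigma → tf_holds L X phi).
Definition k3_conseq : vocab -> var -> var -> bform := tf_conseq_in is_consistent.
Definition lfi1_conseq : vocab -> var -> var -> bform := tf_conseq_in is_complete.

Definition is_fol (L : vocab) (M K I : var) : bform :=
  classical M ∧ (∃ a, a ∈ M) ∧ is_fun K (consts L) M ∧
  classical I ∧ I ⊆ rel_space L M.

(** Two-valued satisfaction: equality is true identity and ∼ is classical
    negation. *)
Definition fol_clause (M I S : var) (z s : var) (c : shape) : bform :=
  pmem z s S ↔
  match c with
  | SBot => ⊥
  | SEq a b => bang (a ≐ b)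
  | SRel R r => r ∈ rel_of I R
  | SNeg p => ¬ pmem p s S
  | SAnd p q => pmem p s S ∧ pmem q s S
  | SOr p q => pmem p s S ∨ pmem q s S
  | SImp p q => pmem p s S → pmem q s S
  | SAll i p => ∀ a, a ∈ M → inst S p s i a
  | SEx i p => ∃ a, a ∈ M ∧ inst S p s i a
  end.

Definition fol_sat (L : vocab) (M K I S : var) : bform :=
  classical S ∧ S ⊆ cprod (formula L) (assignments M) ∧
  recursion L M K (fol_clause M I S).

Definition fol_holds (L : vocab) (M K I p : var) : bform :=
  ∃ S, bang (fol_sat L M K I S) ∧ holds S M p.
Definition fol_holds_all (L : vocab) (M K I Sigma : var) : bform :=
  ∀ p, p ∈ Sigma → fol_holds L M K I p.

Definition fol_conseq (L : vocab) (Sigma phi : var) : bform :=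
  ∀ M K I, is_fol L M K I →
    (fol_holds_all L M K I Sigma → fol_holds L M K I phi).

Definition tarski_is (conseq : vocab -> var -> var -> bform) : bform :=
  ∀ C R A, let L := Vocab C R A in
    is_vocab L → ∀ Sigma, Sigma ⊆ formula L → ∀ phi, phi ∈ formula L →
      (tarski_conseq L Sigma phi ↔ conseq L Sigma phi).

Definition exactly_one (p q r s : bform) : bform :=
  (p ∨ q ∨ r ∨ s) ∧
  ¬ (p ∧ q) ∧ ¬ (p ∧ r) ∧ ¬ (p ∧ s) ∧ ¬ (q ∧ r) ∧ ¬ (q ∧ s) ∧ ¬ (r ∧ s).

(* Main.v *)
(** We argue in an arbitrary T/F-model of PZFC. A set x amounts to a pair (x^!, x^?) of
    classical sets, and Comprehension produces every such pair of subsets of a given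
    set as soon as there is a glut (z both in and out of some x) and a gap (z neither in
    nor out of some x); without gluts it produces those with x^! contained in x^?, and
    without gaps those with x^? contained in x^!. So ACLA and its variants say which of
    gluts and gaps exist, which gives (5).

    The clauses of Tarski satisfaction split into the T/F clauses for the positive and
    the negative extension of the satisfaction relation. Hence a Tarski model is a
    T/F-model, consistent if there are no gluts and complete if there are no gaps.
    Conversely, replace each element a of a T/F-model by a set a' with a'^! = {a} and
    a'^? = {b : not b =^- a}: then =^- becomes the falsity of equality of sets, and the
    satisfaction relation is transported along a |-> a'. The sets needed exist if there
    is a glut or the T/F-model is consistent, and if there is a gap or it is complete.

    For the converse implications the empty vocabulary suffices: ~(v_0 = v_1) has
    bot as a Tarski consequence iff there are no gluts, and ~(v_0 = v_1) -> bot has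
    v_0 = v_1 as a Tarski consequence iff there are no gaps. On the side of T/F-models
    this is decided by two-element models in which =^- is total, or empty; these need
    the recursion theorem for formulas inside PZFC. *)

(* In a T/F-model the truth and the falsity of a formula are ordinary two-valued statements. So the
   mathematics is done in classical Rocq about the elements of the model, and the internal formulas
   are tied to it only at the end, by computing their truth conditions. Two obstacles shape this.
   The axiom schemas speak of formulas, hence every predicate fed to Comprehension, Replacement,
   Foundation or an induction must be shown first-order definable with parameters. And truth
   conditions are not compositional on their own: ∼, ⇔ and ⊆ consult falsity as well. So both
   conditions are translated together, and falsity is dropped only below ! or in the premise of →,
   where it has no influence. The test formulas need no relation symbols because equality itself can
   be non-classical: the domain of a Tarski model is a classical set, but its elements may be
   arbitrary sets. *)
From Stdlib Require Import Classical ClassicalEpsilon FunctionalExtensionality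
  PropExtensionality ProofIrrelevance PeanoNat Lia.
Require Import Defs.
Local Open Scope bs4_scope.

Local Notation "x 'ε' y" := (mem_pos _ x y) (at level 70, no associativity).
Local Notation out := (mem_neg _).

(** * Definable predicates *)

Section Renaming.
Context {W : tfmodel}.
Local Notation D := (dom W).

Lemma scons_ren (a : D) (rho : nat -> D) (xi : nat -> nat) :
  (fun i => scons a rho (scons 0 (fun i => S (xi i)) i)) = scons a (fun i => rho (xi i)).
Proof. apply functional_extensionality; intros [|i]; reflexivity. Qed.

(** Truth and falsity are exchanged at [Neg], and falsity uses truth at [Imp], so the induction
    carries both. *)
Lemma truth_falsity_ren (p : form) : forall (xi : nat -> nat) (rho : nat -> D),
  (truth W rho (ren xi p) <-> truth W (fun i => rho (xi i)) p) /\
  (falsity W rho (ren xi p) <-> falsity W (fun i => rho (xi i)) p).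
Proof.
  induction p; intros xi rho; simpl; try tauto;
    try (specialize (IHp xi rho); tauto);
    try (specialize (IHp1 xi rho); specialize (IHp2 xi rho); tauto).
  all: split; split; try (intros H a; specialize (H a)); try (intros [a H]; exists a);
    revert H; rewrite <- (scons_ren a rho xi); apply IHp.
Qed.

Lemma truth_ren (p : form) (xi : nat -> nat) (rho : nat -> D) :
  truth W rho (ren xi p) <-> truth W (fun i => rho (xi i)) p.
Proof. apply truth_falsity_ren. Qed.

Lemma falsity_ren (p : form) (xi : nat -> nat) (rho : nat -> D) :
  falsity W rho (ren xi p) <-> falsity W (fun i => rho (xi i)) p.
Proof. apply truth_falsity_ren. Qed.

End Renaming.

Section Definability.
Context {W : tfmodel}.
Local Notation D := (dom W).

(** The indices of a formula are read through [v] either as arguments of the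
    predicate or as parameters from the model. *)
Definition env (v : nat -> nat + D) (rho : nat -> D) : nat -> D :=
  fun k => match v k with inl i => rho i | inr a => a end.

(** First-order definability with parameters. The environment serves as the list of arguments, so
    that quantifiers are handled by shifting it. Only truth is tested: falsity is controlled by
    putting ! in front of the formula when it is used. *)
Definition Def (P : (nat -> D) -> Prop) : Prop :=
  exists phi v, forall rho, P rho <-> truth W (env v rho) phi.

Lemma Def_iff (P Q : (nat -> D) -> Prop) :
  (forall rho, P rho <-> Q rho) -> Def Q -> Def P.
Proof.
  intros E (phi & v & H); exists phi, v; intros rho; rewrite E; apply H.
Qed.

Lemma Def_ren (xi : nat -> nat) (P : (nat -> D) -> Prop) :
  Def P -> Def (fun rho => P (fun i => rho (xi i))).
Proof.
  intros (phi & v & H).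
  exists phi, (fun k => match v k with inl i => inl (xi i) | inr a => inr a end).
  intros rho; rewrite H.
  replace (env v (fun i => rho (xi i))) with
    (env (fun k => match v k with inl i => inl (xi i) | inr a => inr a end) rho);
    [tauto|].
  apply functional_extensionality; intros k; unfold env; destruct (v k); reflexivity.
Qed.

(** Two predicates come with unrelated index maps. Moving one formula to the even and the other to
    the odd indices lets both be read through a single map. *)
Definition interleave {T : Type} (v1 v2 : nat -> T) : nat -> T :=
  fun k => if Nat.even k then v1 (Nat.div2 k) else v2 (Nat.div2 k).

Lemma interleave_even {T} (v1 v2 : nat -> T) k : interleave v1 v2 (2 * k) = v1 k.
Proof.
  unfold interleave. rewrite Nat.div2_double.
  replace (Nat.even (2 * k)) with true; [reflexivity|].
  symmetry; apply Nat.even_spec; exists k; reflexivity.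
Qed.

Lemma interleave_odd {T} (v1 v2 : nat -> T) k : interleave v1 v2 (S (2 * k)) = v2 k.
Proof.
  unfold interleave. rewrite Nat.div2_succ_double.
  replace (Nat.even (S (2 * k))) with false; [reflexivity|].
  rewrite Nat.even_succ, <- Nat.negb_even.
  replace (Nat.even (2 * k)) with true; [reflexivity|].
  symmetry; apply Nat.even_spec; exists k; reflexivity.
Qed.

Lemma Def_pair (P Q : (nat -> D) -> Prop) :
  Def P -> Def Q ->
  exists phi psi v,
    (forall rho, P rho <-> truth W (env v rho) phi) /\
    (forall rho, Q rho <-> truth W (env v rho) psi).
Proof.
  intros (phi & v & H) (psi & w & K).
  exists (ren (fun k => 2 * k) phi), (ren (fun k => S (2 * k)) psi), (interleave v w).
  split; intros rho; rewrite truth_ren; [rewrite H | rewrite K].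
  - replace (fun i => env (interleave v w) rho (2 * i)) with (env v rho); [tauto|].
    apply functional_extensionality; intros k; unfold env.
    rewrite interleave_even; reflexivity.
  - replace (fun i => env (interleave v w) rho (S (2 * i))) with (env w rho); [tauto|].
    apply functional_extensionality; intros k; unfold env.
    rewrite interleave_odd; reflexivity.
Qed.

Lemma Def_False : Def (fun _ => False).
Proof. exists Bot, (fun i => inl i); intros rho; simpl; tauto. Qed.

Lemma Def_and (P Q : (nat -> D) -> Prop) :
  Def P -> Def Q -> Def (fun rho => P rho /\ Q rho).
Proof.
  intros HP HQ; destruct (Def_pair P Q HP HQ) as (phi & psi & v & H & K).
  exists (And phi psi), v; intros rho; simpl; rewrite <- H, <- K; tauto.
Qed.

Lemma Def_or (P Q : (nat -> D) -> Prop) :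
  Def P -> Def Q -> Def (fun rho => P rho \/ Q rho).
Proof.
  intros HP HQ; destruct (Def_pair P Q HP HQ) as (phi & psi & v & H & K).
  exists (Or phi psi), v; intros rho; simpl; rewrite <- H, <- K; tauto.
Qed.

Lemma Def_imp (P Q : (nat -> D) -> Prop) :
  Def P -> Def Q -> Def (fun rho => P rho -> Q rho).
Proof.
  intros HP HQ; destruct (Def_pair P Q HP HQ) as (phi & psi & v & H & K).
  exists (Imp phi psi), v; intros rho; simpl; rewrite <- H, <- K; tauto.
Qed.

Lemma Def_not (P : (nat -> D) -> Prop) : Def P -> Def (fun rho => ~ P rho).
Proof. intros H; apply Def_imp; [exact H | apply Def_False]. Qed.

Lemma Def_True : Def (fun _ => True).
Proof. eapply Def_iff; [|apply (Def_not _ Def_False)]; tauto. Qed.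

Lemma Def_equiv (P Q : (nat -> D) -> Prop) :
  Def P -> Def Q -> Def (fun rho => P rho <-> Q rho).
Proof. intros; apply Def_and; apply Def_imp; assumption. Qed.

(** By excluded middle P amounts to [True] or to [False], so a condition that does not depend on the
    environment is definable whatever it says. *)
Lemma Def_const (P : Prop) : Def (fun _ => P).
Proof.
  destruct (classic P) as [H|H]; eapply Def_iff;
    [|exact Def_True| |exact Def_False]; tauto.
Qed.

(** Below a binder, an index that was mapped to argument 0 has to denote the bound variable;
    [under_ren] sends it to 0. The value [inl 0] that [under] keeps for it is a dummy that is never
    read. *)
Definition under (v : nat -> nat + D) : nat -> nat + D :=
  fun k => match v k with inl (S i) => inl i | inl 0 => inl 0 | inr a => inr a end.
Definition under_ren (v : nat -> nat + D) : nat -> nat :=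
  fun k => match v k with inl 0 => 0 | _ => S k end.

Lemma env_under (v : nat -> nat + D) (a : D) (rho : nat -> D) :
  (fun i => scons a (env (under v) rho) (under_ren v i)) = env v (scons a rho).
Proof.
  apply functional_extensionality; intros k; unfold env, under, under_ren.
  destruct (v k) as [[|i]|b] eqn:E; simpl; rewrite ?E; reflexivity.
Qed.

Lemma Def_all (Q : D -> (nat -> D) -> Prop) :
  Def (fun rho => Q (rho 0) (fun i => rho (S i))) ->
  Def (fun rho => forall a, Q a rho).
Proof.
  intros (phi & v & H). exists (All (ren (under_ren v) phi)), (under v).
  intros rho; simpl; split; intros K a; specialize (K a).
  - rewrite truth_ren, env_under. apply (H (scons a rho)). exact K.
  - rewrite truth_ren, env_under in K. apply (H (scons a rho)). exact K.
Qed.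

Lemma Def_ex (Q : D -> (nat -> D) -> Prop) :
  Def (fun rho => Q (rho 0) (fun i => rho (S i))) ->
  Def (fun rho => exists a, Q a rho).
Proof.
  intros (phi & v & H). exists (Ex (ren (under_ren v) phi)), (under v).
  intros rho; simpl; split; intros [a K]; exists a.
  - rewrite truth_ren, env_under. apply (H (scons a rho)). exact K.
  - rewrite truth_ren, env_under in K. apply (H (scons a rho)). exact K.
Qed.

(** There are no function symbols, so an operation is definable through its graph, with the value at
    index 0. *)
Definition DT (t : (nat -> D) -> D) : Prop :=
  Def (fun rho => rho 0 = t (fun i => rho (S i))).

Lemma DT_var (i : nat) : DT (fun rho => rho i).
Proof.
  exists (Eq 0 1), (fun k => match k with 0 => inl 0 | _ => inl (S i) end).
  intros rho; simpl; tauto.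
Qed.

Lemma DT_const (a : D) : DT (fun _ => a).
Proof.
  exists (Eq 0 1), (fun k => match k with 0 => inl 0 | _ => inr a end).
  intros rho; simpl; tauto.
Qed.

Lemma DT_shift (t : (nat -> D) -> D) : DT t -> DT (fun rho => t (fun i => rho (S i))).
Proof.
  intros H. apply (Def_ren (fun i => match i with 0 => 0 | S i => S (S i) end)) in H.
  exact H.
Qed.

(** A term is eliminated by quantifying over its value. *)
Lemma Def_subst (P : D -> (nat -> D) -> Prop) (t : (nat -> D) -> D) :
  Def (fun rho => P (rho 0) (fun i => rho (S i))) -> DT t ->
  Def (fun rho => P (t rho) rho).
Proof.
  intros HP HT.
  apply (Def_iff _ (fun rho => exists a, a = t rho /\ P a rho)).
  - intros rho; split; [intros H; exists (t rho); auto | intros (a & -> & H); exact H].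
  - apply (Def_ex (fun a rho => a = t rho /\ P a rho)), Def_and; assumption.
Qed.

Lemma Def_app1 (P : D -> Prop) (s : (nat -> D) -> D) :
  Def (fun rho => P (rho 0)) -> DT s -> Def (fun rho => P (s rho)).
Proof. intros HP Hs; apply (Def_subst (fun a _ => P a)); assumption. Qed.

Lemma Def_app2 (P : D -> D -> Prop) (s t : (nat -> D) -> D) :
  Def (fun rho => P (rho 0) (rho 1)) -> DT s -> DT t ->
  Def (fun rho => P (s rho) (t rho)).
Proof.
  intros HP Hs Ht. apply (Def_subst (fun a rho => P a (t rho))); [|exact Hs].
  apply (Def_subst (fun b rho => P (rho 0) b)); [|apply DT_shift, Ht].
  apply (Def_ren (fun i => match i with 0 => 1 | S i => i end)) in HP. exact HP.
Qed.

Lemma Def_app3 (P : D -> D -> D -> Prop) (s t u : (nat -> D) -> D) :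
  Def (fun rho => P (rho 0) (rho 1) (rho 2)) -> DT s -> DT t -> DT u ->
  Def (fun rho => P (s rho) (t rho) (u rho)).
Proof.
  intros HP Hs Ht Hu. apply (Def_subst (fun a rho => P a (t rho) (u rho))); [|exact Hs].
  apply (Def_subst (fun b rho => P (rho 0) b (u (fun i => rho (S i))))); [|apply DT_shift, Ht].
  apply (Def_subst (fun c rho => P (rho 1) (rho 0) c)); [|do 2 apply DT_shift in Hu; exact Hu].
  apply (Def_ren (fun i => match i with 0 => 2 | 1 => 1 | _ => 0 end)) in HP. exact HP.
Qed.

Lemma Def_app4 (P : D -> D -> D -> D -> Prop) (s t u v : (nat -> D) -> D) :
  Def (fun rho => P (rho 0) (rho 1) (rho 2) (rho 3)) -> DT s -> DT t -> DT u -> DT v ->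
  Def (fun rho => P (s rho) (t rho) (u rho) (v rho)).
Proof.
  intros HP Hs Ht Hu Hv.
  apply (Def_subst (fun a rho => P a (t rho) (u rho) (v rho))); [|exact Hs].
  apply (Def_subst (fun b rho => P (rho 0) b (u (fun i => rho (S i)))
    (v (fun i => rho (S i))))); [|apply DT_shift, Ht].
  apply (Def_subst (fun c rho => P (rho 1) (rho 0) c (v (fun i => rho (S (S i))))));
    [|do 2 apply DT_shift in Hu; exact Hu].
  apply (Def_subst (fun d rho => P (rho 2) (rho 1) (rho 0) d));
    [|do 3 apply DT_shift in Hv; exact Hv].
  apply (Def_ren (fun i => match i with 0 => 3 | 1 => 2 | 2 => 1 | _ => 0 end)) in HP.
  exact HP.
Qed.

Lemma DT_app1 (g : D -> D) (s : (nat -> D) -> D) :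
  DT (fun rho => g (rho 0)) -> DT s -> DT (fun rho => g (s rho)).
Proof.
  intros Hg Hs. apply (Def_app2 (fun a b => a = g b) (fun rho => rho 0)
    (fun rho => s (fun i => rho (S i)))); [exact Hg|apply DT_var|apply DT_shift, Hs].
Qed.

Lemma DT_app2 (g : D -> D -> D) (s t : (nat -> D) -> D) :
  DT (fun rho => g (rho 0) (rho 1)) -> DT s -> DT t ->
  DT (fun rho => g (s rho) (t rho)).
Proof.
  intros Hg Hs Ht. apply (Def_app3 (fun a b c => a = g b c) (fun rho => rho 0)
    (fun rho => s (fun i => rho (S i))) (fun rho => t (fun i => rho (S i))));
    [exact Hg|apply DT_var|apply DT_shift, Hs|apply DT_shift, Ht].
Qed.

Lemma DT_app3 (g : D -> D -> D -> D) (s t u : (nat -> D) -> D) :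
  DT (fun rho => g (rho 0) (rho 1) (rho 2)) -> DT s -> DT t -> DT u ->
  DT (fun rho => g (s rho) (t rho) (u rho)).
Proof.
  intros Hg Hs Ht Hu. apply (Def_app4 (fun a b c d => a = g b c d) (fun rho => rho 0)
    (fun rho => s (fun i => rho (S i))) (fun rho => t (fun i => rho (S i)))
    (fun rho => u (fun i => rho (S i))));
    [exact Hg|apply DT_var|apply DT_shift, Hs|apply DT_shift, Ht|apply DT_shift, Hu].
Qed.

Lemma Def_eq (s t : (nat -> D) -> D) : DT s -> DT t -> Def (fun rho => s rho = t rho).
Proof.
  apply (Def_app2 eq).
  exists (Eq 0 1), (fun i => inl i); intros rho; simpl; tauto.
Qed.

Lemma Def_mem (s t : (nat -> D) -> D) : DT s -> DT t -> Def (fun rho => s rho ε t rho).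
Proof.
  apply (Def_app2 (mem_pos W)).
  exists (Mem 0 1), (fun i => inl i); intros rho; simpl; tauto.
Qed.

Lemma Def_out (s t : (nat -> D) -> D) : DT s -> DT t -> Def (fun rho => out (s rho) (t rho)).
Proof.
  apply (Def_app2 (mem_neg W)).
  exists (Neg (Mem 0 1)), (fun i => inl i); intros rho; simpl; tauto.
Qed.

Lemma Def_eq_neg (s t : (nat -> D) -> D) :
  DT s -> DT t -> Def (fun rho => eq_neg W (s rho) (t rho)).
Proof.
  apply (Def_app2 (eq_neg W)).
  exists (Neg (Eq 0 1)), (fun i => inl i); intros rho; simpl; tauto.
Qed.

End Definability.

Local Notation Def1 P := (Def (fun rho => P (rho 0))).
Local Notation Def2 P := (Def (fun rho => P (rho 0) (rho 1))).
Local Notation DT1 g := (DT (fun rho => g (rho 0))).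
Local Notation DT2 g := (DT (fun rho => g (rho 0) (rho 1))).
Local Notation DT3 g := (DT (fun rho => g (rho 0) (rho 1) (rho 2))).

(** [dfn_ext] is redefined each time a derived notion becomes available, and so is
    [brl_ext] below. *)
Ltac dfn_ext := fail.
Ltac dfn_step := cbv beta;
  lazymatch goal with
  | |- Def (fun rho => False) => apply Def_False
  | |- Def (fun rho => True) => apply Def_True
  | |- Def (fun rho => _ /\ _) => apply Def_and
  | |- Def (fun rho => _ \/ _) => apply Def_or
  | |- Def (fun rho => _ <-> _) => apply Def_equiv
  | |- Def (fun rho => ~ _) => apply Def_not
  | |- Def (fun rho => exists a, _) => apply Def_ex
  | |- Def (fun rho => forall a : dom _, _) => apply Def_all
  | |- Def (fun rho => _ -> _) => apply Def_imp
  | |- Def (fun rho => _ = _) => apply Def_eq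
  | |- Def (fun rho => mem_pos _ _ _) => apply Def_mem
  | |- Def (fun rho => mem_neg _ _ _) => apply Def_out
  | |- Def (fun rho => eq_neg _ _ _) => apply Def_eq_neg
  | |- DT (fun rho => rho _) => apply DT_var
  | |- DT (fun _ => ?a) => apply DT_const
  | _ => first
    [ dfn_ext
    | match goal with
      | H : Def1 ?P |- Def (fun rho => ?P _) => apply (Def_app1 P _ H)
      | H : Def2 ?P |- Def (fun rho => ?P _ _) => apply (Def_app2 P _ _ H)
      | H : DT1 ?g |- DT (fun rho => ?g _) => apply (DT_app1 g _ H)
      | H : DT2 ?g |- DT (fun rho => ?g _ _) => apply (DT_app2 g _ _ H)
      (* Matches only when the predicate does not depend on [rho]. *)
      | |- Def (fun rho => ?P) => apply Def_const
      end ]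
  end.
Ltac dfn := solve [repeat dfn_step].

(** * Truth conditions *)

Section Semantics.
Context {W : tfmodel}.
Local Notation D := (dom W).

(** A world [(d, rho)] is an environment that has been extended by [d] binders, so
    that the level [x : var] denotes [rho (d - S x)] in it. *)
Definition world : Type := (nat * (nat -> D))%type.
Definition wle (w w' : world) : Prop :=
  exists k, fst w' = k + fst w /\ forall i, snd w' (k + i) = snd w i.
Definition push (a : D) (w : world) : world := (S (fst w), scons a (snd w)).
(** Past the levels of the world the environment is [rho], which supplies the parameters of an axiom
    schema. *)
Definition base (w : world) (rho : nat -> D) : Prop :=
  forall j, snd w (fst w + j) = rho j.
Definition vrel (w : world) (x : var) (a : D) : Prop :=
  x < fst w /\ snd w (fst w - S x) = a.

(** [b] has truth condition [P] and falsity condition [N], also in all extensions of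
    the world: this is what allows a translation to be used under quantifiers. *)
Definition brel (w : world) (b : bform) (P N : Prop) : Prop :=
  forall w', wle w w' ->
    (truth W (snd w') (b (fst w')) <-> P) /\ (falsity W (snd w') (b (fst w')) <-> N).
Definition brelT (w : world) (b : bform) (P : Prop) : Prop :=
  forall w', wle w w' -> (truth W (snd w') (b (fst w')) <-> P).
Definition frel (w : world) (f : var -> bform) (P N : D -> Prop) : Prop :=
  forall w' x a, wle w w' -> vrel w' x a -> brel w' (f x) (P a) (N a).
Definition frelT (w : world) (f : var -> bform) (P : D -> Prop) : Prop :=
  forall w' x a, wle w w' -> vrel w' x a -> brelT w' (f x) (P a).

Lemma wle_refl (w : world) : wle w w.
Proof. exists 0; split; reflexivity. Qed.

Lemma wle_trans (u v w : world) : wle u v -> wle v w -> wle u w.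
Proof.
  intros (k & H1 & H2) (m & K1 & K2). exists (m + k). split; [lia|].
  intros i. rewrite <- Nat.add_assoc, K2. apply H2.
Qed.

Lemma wle_push (a : D) (w : world) : wle w (push a w).
Proof. exists 1; split; reflexivity. Qed.

Lemma vrel_push (a : D) (w : world) : vrel (push a w) (fst w) a.
Proof. split; simpl; [lia|]. rewrite Nat.sub_diag. reflexivity. Qed.

Lemma vrel_le (w w' : world) (x : var) (a : D) : wle w w' -> vrel w x a -> vrel w' x a.
Proof.
  intros (k & H1 & H2) [K1 K2]. split; [lia|].
  rewrite <- K2, <- H2, H1. f_equal. lia.
Qed.

Lemma frel_le (w w' : world) f P N : wle w w' -> frel w f P N -> frel w' f P N.
Proof. intros L H u x a L' V. apply H; [eapply wle_trans; eassumption|exact V]. Qed.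

Lemma frelT_le (w w' : world) f P : wle w w' -> frelT w f P -> frelT w' f P.
Proof. intros L H u x a L' V. apply H; [eapply wle_trans; eassumption|exact V]. Qed.

Lemma brel_iff w b (P N P' N' : Prop) :
  brel w b P N -> (P <-> P') -> (N <-> N') -> brel w b P' N'.
Proof. intros H E F u L. destruct (H u L). rewrite <- E, <- F. tauto. Qed.

Lemma brelT_iff w b (P P' : Prop) : brelT w b P -> (P <-> P') -> brelT w b P'.
Proof. intros H E u L. rewrite <- E. apply H, L. Qed.

Lemma frel_intro w f (P N : D -> Prop) :
  (forall w' x a, wle w w' -> vrel w' x a ->
    exists P' N', brel w' (f x) P' N' /\ P' = P a /\ N' = N a) -> frel w f P N.
Proof. intros H u x a L V. destruct (H u x a L V) as (P' & N' & K & <- & <-). exact K. Qed.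

Lemma frelT_intro w f (P : D -> Prop) :
  (forall w' x a, wle w w' -> vrel w' x a -> exists P', brelT w' (f x) P' /\ P' = P a) ->
  frelT w f P.
Proof. intros H u x a L V. destruct (H u x a L V) as (P' & K & <-). exact K. Qed.

Lemma frel_iff w f (P N P' N' : D -> Prop) : frel w f P N ->
  (forall a, P a <-> P' a) -> (forall a, N a <-> N' a) -> frel w f P' N'.
Proof. intros H E F u x a L V. eapply brel_iff; [apply H|apply E|apply F]; assumption. Qed.

Lemma brelT_brel w b (P N : Prop) : brel w b P N -> brelT w b P.
Proof. intros H u L. apply H, L. Qed.

Lemma brel_bot w : brel w bbot False True.
Proof. intros u L; simpl; tauto. Qed.

Lemma vrel_ix w x a : vrel w x a -> snd w (ix (fst w) x) = a.
Proof. intros [_ H]; exact H. Qed.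

Lemma brel_mem w x y a b : vrel w x a -> vrel w y b -> brel w (bmem x y) (a ε b) (out a b).
Proof.
  intros V V' u L. apply (vrel_le _ _ _ _ L), vrel_ix in V, V'. simpl.
  rewrite V, V'. tauto.
Qed.

Lemma brel_eq w x y a b : vrel w x a -> vrel w y b -> brel w (x ≐ y) (a = b) (eq_neg W a b).
Proof.
  intros V V' u L. apply (vrel_le _ _ _ _ L), vrel_ix in V, V'. simpl.
  rewrite V, V'. tauto.
Qed.

Lemma brel_neg w p P N : brel w p P N -> brel w (∼ p) N P.
Proof. intros H u L; simpl. destruct (H u L); tauto. Qed.

Lemma brel_and w p q P N Q M : brel w p P N -> brel w q Q M -> brel w (p ∧ q) (P /\ Q) (N \/ M).
Proof. intros H K u L; simpl. destruct (H u L), (K u L); tauto. Qed.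

(** For truth alone, the second conjunct may be translated under the assumption that the first is
    true. This serves definitions such as [is_vocab], whose later clauses have a simple meaning only
    once the earlier ones hold. Falsity offers no such assumption. *)
Lemma brelT_and w p q (P Q : Prop) :
  brelT w p P -> (P -> brelT w q Q) -> brelT w (p ∧ q) (P /\ Q).
Proof.
  intros H K u L; simpl. specialize (H u L).
  split; [intros [H1 H2]|intros [H1 H2]]; (split; [tauto|]); apply (K ltac:(tauto) u L), H2.
Qed.

Lemma brel_or w p q P N Q M : brel w p P N -> brel w q Q M -> brel w (p ∨ q) (P \/ Q) (N /\ M).
Proof. intros H K u L; simpl. destruct (H u L), (K u L); tauto. Qed.

Lemma brelT_or w p q (P Q : Prop) : brelT w p P -> brelT w q Q -> brelT w (p ∨ q) (P \/ Q).
Proof. intros H K u L; simpl. specialize (H u L); specialize (K u L); tauto. Qed.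

Lemma brel_imp w p q (P Q M : Prop) :
  brelT w p P -> brel w q Q M -> brel w (p → q) (P -> Q) (P /\ M).
Proof. intros H K u L; simpl. specialize (H u L); destruct (K u L); tauto. Qed.

Lemma brelT_imp w p q (P Q : Prop) :
  brelT w p P -> (P -> brelT w q Q) -> brelT w (p → q) (P -> Q).
Proof.
  intros H K u L; simpl. specialize (H u L). split; intros J X.
  - apply (K X u L); tauto.
  - apply (K ltac:(tauto) u L); tauto.
Qed.

Lemma frel_push w f P N u a : frel w f P N -> wle w u ->
  (truth W (scons a (snd u)) (f (fst u) (S (fst u))) <-> P a) /\
  (falsity W (scons a (snd u)) (f (fst u) (S (fst u))) <-> N a).
Proof.
  intros H L. apply (fun L V => H (push a u) (fst u) a L V (push a u) (wle_refl _));
    [eapply wle_trans; [exact L|apply wle_push]|apply vrel_push].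
Qed.

Lemma frelT_push w f P u a : frelT w f P -> wle w u ->
  (truth W (scons a (snd u)) (f (fst u) (S (fst u))) <-> P a).
Proof.
  intros H L. apply (fun L V => H (push a u) (fst u) a L V (push a u) (wle_refl _));
    [eapply wle_trans; [exact L|apply wle_push]|apply vrel_push].
Qed.

Lemma brel_all w f P N : frel w f P N -> brel w (ball f) (forall a, P a) (exists a, N a).
Proof.
  intros H u L. assert (K := fun a => frel_push w f P N u a H L). simpl.
  split; split; try (intros J a; apply K, J); intros [a J]; exists a; apply K, J.
Qed.

Lemma brel_ex w f P N : frel w f P N -> brel w (bex f) (exists a, P a) (forall a, N a).
Proof.
  intros H u L. assert (K := fun a => frel_push w f P N u a H L). simpl.
  split; split; try (intros J a; apply K, J); intros [a J]; exists a; apply K, J.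
Qed.

Lemma brelT_all w f P : frelT w f P -> brelT w (ball f) (forall a, P a).
Proof.
  intros H u L. assert (K := fun a => frelT_push w f P u a H L). simpl.
  split; intros J a; apply K, J.
Qed.

Lemma brelT_ex w f P : frelT w f P -> brelT w (bex f) (exists a, P a).
Proof.
  intros H u L. assert (K := fun a => frelT_push w f P u a H L). simpl.
  split; intros [a J]; exists a; apply K, J.
Qed.

Lemma base_le (w w' : world) (rho : nat -> D) : wle w w' -> base w rho -> base w' rho.
Proof.
  intros (k & H1 & H2) H j. rewrite H1, <- Nat.add_assoc, H2. apply H.
Qed.

Lemma brel_app1 phi x w rho a : base w rho -> vrel w x a ->
  brel w (app1 phi x) (truth W (scons a rho) phi) (falsity W (scons a rho) phi).
Proof.
  intros B V u L. apply (vrel_le _ _ _ _ L) in V. apply (base_le _ _ _ L) in B.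
  unfold app1. rewrite truth_ren, falsity_ren.
  replace (fun i => snd u (scons (ix (fst u) x) (fun j => fst u + j) i))
    with (scons a rho); [tauto|].
  apply functional_extensionality; intros [|i]; simpl.
  - symmetry; apply vrel_ix, V.
  - symmetry; apply B.
Qed.

Lemma brel_app2 phi x y w rho a b : base w rho -> vrel w x a -> vrel w y b ->
  brel w (app2 phi x y) (truth W (scons a (scons b rho)) phi)
    (falsity W (scons a (scons b rho)) phi).
Proof.
  intros B V1 V2 u L. apply (vrel_le _ _ _ _ L) in V1, V2. apply (base_le _ _ _ L) in B.
  unfold app2. rewrite truth_ren, falsity_ren.
  replace (fun i => snd u (scons (ix (fst u) x) (scons (ix (fst u) y) (fun j => fst u + j)) i))
    with (scons a (scons b rho)); [tauto|].
  apply functional_extensionality; intros [|[|i]]; simpl.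
  - symmetry; apply vrel_ix, V1.
  - symmetry; apply vrel_ix, V2.
  - symmetry; apply B.
Qed.

Lemma models_closed (b : bform) (P : (nat -> D) -> Prop) :
  (forall w rho, base w rho -> brelT w b (P rho)) ->
  models W (closed b) <-> forall rho, P rho.
Proof.
  intros H. split; intros K rho.
  - apply (H (0, rho) rho (fun j => eq_refl) (0, rho) (wle_refl _)), K.
  - apply (H (0, rho) rho (fun j => eq_refl) (0, rho) (wle_refl _)), K.
Qed.

(** The falsity of !p is the failure of its truth, so that p itself needs only a truth condition. *)
Lemma brel_bang w p P : brelT w p P -> brel w (bang p) P (~ P).
Proof. intros H u L; simpl. specialize (H u L). tauto. Qed.

Lemma brel_quest w p P N : brel w p P N -> brel w (quest p) (~ N) N.
Proof. intros H u L; simpl. destruct (H u L). tauto. Qed.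

Lemma brelT_iff_form w p q (P Q : Prop) : brelT w p P -> brelT w q Q -> brelT w (p ↔ q) (P <-> Q).
Proof. intros H K u L; simpl. specialize (H u L); specialize (K u L); tauto. Qed.

Lemma brel_siff w p q P N Q M : brel w p P N -> brel w q Q M ->
  brel w (p ⇔ q) ((P <-> Q) /\ (N <-> M)) ((P /\ M) \/ (Q /\ N)).
Proof. intros H K u L; simpl. destruct (H u L), (K u L); tauto. Qed.

Lemma brel_simp w p q P N Q M : brel w p P N -> brel w q Q M ->
  brel w (p ⇒ q) ((P -> Q) /\ (M -> N)) (P /\ M).
Proof. intros H K u L; simpl. destruct (H u L), (K u L); tauto. Qed.

Lemma brelT_circ w p P N : brel w p P N -> brelT w (circ p) (N <-> ~ P).
Proof. intros H u L; simpl. destruct (H u L). tauto. Qed.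

Lemma frel_elem w x a : vrel w x a -> frel w (elem x) (fun y => y ε a) (fun y => out y a).
Proof. intros V u y b L V'. apply brel_mem; [exact V'|eapply vrel_le; eassumption]. Qed.

Lemma brel_inc w x a (A : cls) P N : frel w A P N -> vrel w x a -> brel w (x ∈ A) (P a) (N a).
Proof. intros H V. apply H; [apply wle_refl|exact V]. Qed.

Lemma brel_ceq w A B PA NA PB NB : frel w A PA NA -> frel w B PB NB ->
  brel w (A ≡ B) (forall y, (PA y <-> PB y) /\ (NA y <-> NB y))
    (exists y, (PA y /\ NB y) \/ (PB y /\ NA y)).
Proof.
  intros H K. apply brel_all. intros u y a L V.
  apply brel_siff; eapply brel_inc; try eassumption; eapply frel_le; eassumption.
Qed.

Lemma brel_csub w A B PA NA PB NB : frel w A PA NA -> frel w B PB NB ->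
  brel w (A ⊆ B) (forall y, (PA y -> PB y) /\ (NB y -> NA y)) (exists y, PA y /\ NB y).
Proof.
  intros H K. apply brel_all. intros u y a L V.
  apply brel_simp; eapply brel_inc; try eassumption; eapply frel_le; eassumption.
Qed.

Lemma frel_cbang w A P N : frel w A P N -> frel w (cbang A) P (fun y => ~ P y).
Proof.
  intros H u y a L V. apply brel_bang. eapply brelT_brel, brel_inc; [|exact V].
  eapply frel_le; eassumption.
Qed.

Lemma frel_cquest w A P N : frel w A P N -> frel w (cquest A) (fun y => ~ N y) N.
Proof.
  intros H u y a L V. eapply brel_quest, brel_inc; [|exact V].
  eapply frel_le; eassumption.
Qed.

Lemma brelT_classical w A P N : frel w A P N -> brelT w (classical A) (forall y, N y <-> ~ P y).
Proof.
  intros H. eapply brelT_iff.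
  - apply brelT_all. intros u y a L V.
    assert (K := frel_le _ _ _ _ _ L H).
    apply brelT_iff_form; eapply brelT_brel, brel_inc; try exact V.
    + eapply frel_cbang; exact K.
    + eapply frel_cquest; exact K.
  - split; intros J y; specialize (J y); tauto.
Qed.

Lemma frel_cempty w : frel w cempty (fun _ => False) (fun _ => True).
Proof. intros u y a L V. apply brel_bot. Qed.

Lemma frel_cup w A B PA NA PB NB : frel w A PA NA -> frel w B PB NB ->
  frel w (cup A B) (fun y => PA y \/ PB y) (fun y => NA y /\ NB y).
Proof. intros H K u y a L V. apply brel_or; eapply brel_inc; try exact V; eapply frel_le; eassumption. Qed.

Lemma frel_cap w A B PA NA PB NB : frel w A PA NA -> frel w B PB NB ->
  frel w (cap A B) (fun y => PA y /\ PB y) (fun y => NA y \/ NB y).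
Proof. intros H K u y a L V. apply brel_and; eapply brel_inc; try exact V; eapply frel_le; eassumption. Qed.

Lemma frel_upair w u v a b : vrel w u a -> vrel w v b ->
  frel w (upair u v) (fun y => y = a \/ y = b) (fun y => ~ (y = a \/ y = b)).
Proof.
  intros V1 V2 w' y c L V. eapply brel_iff.
  - apply brel_or; eapply brel_bang, brelT_brel, brel_eq; first [exact V | eapply vrel_le; eassumption].
  - reflexivity.
  - tauto.
Qed.

Lemma frel_sing w u a : vrel w u a -> frel w (sing u) (fun y => y = a) (fun y => ~ y = a).
Proof.
  intros V1 w' y c L V. eapply brel_bang, brelT_brel, brel_eq; first [exact V | eapply vrel_le; eassumption].
Qed.

(** The falsity of the existential says that every x either is not the set or falsifies φ. As d is
    the only such set, this is the falsity of φ at d. *)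
Lemma brel_the w A phi PA NA P N d :
  frel w A PA NA -> frel w phi P N ->
  (forall y, (y ε d <-> PA y) /\ (out y d <-> NA y)) ->
  (forall d', (forall y, (y ε d' <-> PA y) /\ (out y d' <-> NA y)) -> d' = d) ->
  brel w (the A phi) (P d) (N d).
Proof.
  intros HA HP Hd U. eapply brel_iff.
  - apply brel_ex. intros u x a L V. apply brel_and.
    + eapply brel_bang, brelT_brel, brel_ceq; [apply frel_elem, V|eapply frel_le; eassumption].
    + apply (HP u x a L V).
  - split; [intros (x & H1 & H2); rewrite <- (U x H1); exact H2|].
    intros H; exists d; split; [exact Hd|exact H].
  - split; [|intros H x].
    + intros H; destruct (H d) as [K|K]; [exfalso; exact (K Hd)|exact K].
    + destruct (classic (forall y, (y ε x <-> PA y) /\ (out y x <-> NA y))) as [K|K];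
        [right; rewrite (U x K); exact H|left; exact K].
Qed.

End Semantics.

Arguments world W : clear implicits.

Ltac lift L :=
  repeat match goal with
  | H : vrel ?w _ _ |- _ => match type of L with wle w _ => apply (vrel_le _ _ _ _ L) in H end
  | H : base ?w _ |- _ => match type of L with wle w _ => apply (base_le _ _ _ L) in H end
  | H : frel ?w _ _ _ |- _ => match type of L with wle w _ => apply (frel_le _ _ _ _ _ L) in H end
  | H : frelT ?w _ _ |- _ => match type of L with wle w _ => apply (frelT_le _ _ _ _ L) in H end
  end.
Ltac intro_var :=
  let w := fresh "w" in let x := fresh "x" in let a := fresh "a" in
  let L := fresh "L" in let V := fresh "V" in
  intros w x a L V; lift L.

(** The truth conditions may be existential variables; they are instantiated
    only after the body of the quantifier has been translated. *)
Ltac frel_var := apply frel_intro; intro_var; do 2 eexists; split; [|split; reflexivity].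
Ltac frelT_var := apply frelT_intro; intro_var; eexists; split; [|reflexivity].

Ltac brl_ext := fail.
Ltac brl_step :=
  first
  [ eassumption
  | match goal with
    | |- _ -> _ => intro
    | |- frel _ (elem _) _ _ => apply frel_elem
    | |- frel _ (cbang _) _ _ => eapply frel_cbang
    | |- frel _ (cquest _) _ _ => eapply frel_cquest
    | |- frel _ cempty _ _ => apply frel_cempty
    | |- frel _ (cup _ _) _ _ => eapply frel_cup
    | |- frel _ (cap _ _) _ _ => eapply frel_cap
    | |- frel _ (upair _ _) _ _ => eapply frel_upair
    | |- frel _ (sing _) _ _ => eapply frel_sing
    | |- brel _ bbot _ _ => apply brel_bot
    | |- brel _ (bmem _ _) _ _ => eapply brel_mem
    | |- brel _ (beq _ _) _ _ => eapply brel_eq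
    | |- brel _ (siff _ _) _ _ => eapply brel_siff
    | |- brel _ (simp _ _) _ _ => eapply brel_simp
    | |- brel _ (bang _) _ _ => eapply brel_bang
    | |- brel _ (quest _) _ _ => eapply brel_quest
    | |- brel _ (ceq _ _) _ _ => eapply brel_ceq
    | |- brel _ (csub _ _) _ _ => eapply brel_csub
    | |- brel _ (inc _ _) _ _ => eapply brel_inc
    | |- brel _ (bneg _) _ _ => eapply brel_neg
    | |- brel _ (band _ _) _ _ => eapply brel_and
    | |- brel _ (bor _ _) _ _ => eapply brel_or
    | |- brel _ (bimp _ _) _ _ => eapply brel_imp
    | |- brel _ (ball _) _ _ => eapply brel_all
    | |- brel _ (bex _) _ _ => eapply brel_ex
    | |- brel _ (app1 _ _) _ _ => eapply brel_app1
    | |- brel _ (app2 _ _ _) _ _ => eapply brel_app2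
    | |- brelT _ (circ _) _ => eapply brelT_circ
    | |- brelT _ (classical _) _ => eapply brelT_classical
    | |- brelT _ (band (bimp ?p ?q) (bimp ?q ?p)) _ => eapply brelT_iff_form
    | |- brelT _ (band _ _) _ => eapply brelT_and
    | |- brelT _ (bor _ _) _ => eapply brelT_or
    | |- brelT _ (bimp _ _) _ => eapply brelT_imp
    | |- brelT _ (ball _) _ => eapply brelT_all
    | |- brelT _ (bex _) _ => eapply brelT_ex
    end
  | brl_ext
  | match goal with
    | |- brelT _ _ _ => eapply brelT_brel
    | |- frel _ (fun _ => _) _ _ =>
        apply frel_intro; intro_var; do 2 eexists; split; [|split]
    | |- frelT _ (fun _ => _) _ => apply frelT_intro; intro_var; eexists; split
    | |- _ = _ => reflexivity
    end ].
Ltac brl := cbv beta; repeat (brl_step; cbv beta).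

(** * Sets *)

Class pzfc_model (W : tfmodel) : Prop :=
  pzfc_truth : forall q, PZFC q -> models W q.

Section SetTheory.
Context {W : tfmodel} {HW : pzfc_model W}.
Local Notation D := (dom W).

Definition cl (x : D) : Prop := forall y, out y x <-> ~ y ε x.

(** [d] has positive extension [A] (that is, d^!) and complement of the
    negative extension [B] (that is, d^?). *)
Definition ext2 (d : D) (A B : D -> Prop) : Prop :=
  forall y, (y ε d <-> A y) /\ (out y d <-> ~ B y).

Lemma axiom_truth (b : bform) (P : (nat -> D) -> Prop) (rho : nat -> D) :
  PZFC (closed b) -> (forall w rho, base w rho -> brelT w b (P rho)) -> P rho.
Proof. intros H K. apply (proj1 (models_closed b P K)), HW, H. Qed.

(** The meaning of an axiom is not stated by hand: it is an existential variable that [brl]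
    solves. *)
Local Ltac axiom E b H rho :=
  eassert (E : _);
  [ eapply (axiom_truth b _ rho H); let w := fresh in let B := fresh in
    intros w ? B; unfold b; brl
  | cbv beta in E ].

Lemma ax_ext (x y : D) :
  (x = y <-> forall z, (z ε x <-> z ε y) /\ (out z x <-> out z y)) /\
  (eq_neg W x y <-> exists z, (z ε x /\ out z y) \/ (z ε y /\ out z x)).
Proof.
  axiom E ax_extensionality PZFC_extensionality (fun _ : nat => x). apply E.
Qed.

Lemma ext2_unique (A B : D -> Prop) (d d' : D) : ext2 d A B -> ext2 d' A B -> d = d'.
Proof.
  intros H H'. apply ax_ext. intros z. specialize (H z); specialize (H' z). tauto.
Qed.

Lemma eq_negE (x y : D) :
  eq_neg W x y <-> exists z, (z ε x /\ out z y) \/ (z ε y /\ out z x).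
Proof. apply ax_ext. Qed.

Lemma comprehension (phi : form) (rho : nat -> D) (u : D) :
  exists x, forall y,
    (y ε x <-> y ε u /\ truth W (scons y rho) phi) /\
    (out y x <-> out y u \/ falsity W (scons y rho) phi).
Proof.
  eassert (E : _).
  { eapply (axiom_truth (ax_comprehension phi) _ rho (PZFC_comprehension phi)).
    intros; unfold ax_comprehension; brl. }
  apply E.
Qed.

(** The form in which the schemas want a predicate: its argument at index 0, followed by parameters
    only. *)
Lemma Def1_formula (P : D -> Prop) :
  Def1 P -> exists phi rho, forall y, P y <-> truth W (scons y rho) phi.
Proof.
  intros (phi & v & H).
  exists (ren (under_ren v) phi), (env (under v) (fun _ => epsilon (dom_inh W) (fun _ => True))).
  intros y. rewrite truth_ren, env_under. symmetry. rewrite <- H. simpl. tauto.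
Qed.

Lemma separation2 (P : D -> Prop) (u : D) :
  Def1 P -> exists x, ext2 x (fun y => y ε u /\ P y) (fun y => ~ out y u /\ P y).
Proof.
  intros HP; destruct (Def1_formula P HP) as (phi & rho & H).
  (* [Neg (Imp phi Bot)] is !φ, which is false exactly when [phi] is not true; nothing is known
     about the falsity of [phi] itself. *)
  destruct (comprehension (Neg (Imp phi Bot)) rho u) as [x Hx].
  exists x; intros y; specialize (Hx y); simpl in Hx. rewrite <- H in Hx. tauto.
Qed.

Lemma superset (x : D) : exists C, cl C /\ (forall y, y ε x -> y ε C) /\
  (forall y, ~ out y x -> y ε C).
Proof.
  axiom E ax_classical_superset PZFC_classical_superset (fun _ : nat => x). destruct (E x) as [C [H K]].
  simpl in H, K. exists C. repeat split; intros.
  - specialize (K y); tauto.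
  - specialize (K y); tauto.
  - apply H; assumption.
  - destruct (H y) as [_ H']. specialize (K y). tauto.
Qed.

Definition isset2 (A B : D -> Prop) : Prop := exists d, ext2 d A B.
Definition isset (A : D -> Prop) : Prop := isset2 A A.

(** Choice only provides a name: by extensionality the set is unique if it exists, and [DT_mk] then
    makes the name definable. Without existence it is an arbitrary element, hence the existence
    hypotheses below. *)
Definition mk (A B : D -> Prop) : D := epsilon (dom_inh W) (fun d => ext2 d A B).
Definition setof (A : D -> Prop) : D := mk A A.

Lemma mk_spec (A B : D -> Prop) : isset2 A B -> ext2 (mk A B) A B.
Proof. intros H. unfold mk. apply epsilon_spec. exact H. Qed.

Lemma mk_unique (A B : D -> Prop) (d : D) : ext2 d A B -> mk A B = d.
Proof. intros H. apply (ext2_unique A B); [apply mk_spec; exists d|]; exact H. Qed.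

Lemma in_setof (A : D -> Prop) (y : D) : isset A -> (y ε setof A <-> A y).
Proof. intros H. apply mk_spec in H. apply H. Qed.

Lemma out_setof (A : D -> Prop) (y : D) : isset A -> (out y (setof A) <-> ~ A y).
Proof. intros H. apply mk_spec in H. apply H. Qed.

Lemma cl_setof (A : D -> Prop) : isset A -> cl (setof A).
Proof. intros H y. rewrite out_setof, in_setof by exact H. tauto. Qed.

Lemma ext2_self (d : D) : ext2 d (fun y => y ε d) (fun y => ~ out y d).
Proof. intros y; split; [tauto|]. split; [tauto|apply NNPP]. Qed.

Lemma cl_ext2 (d : D) (A : D -> Prop) : cl d -> (forall y, y ε d <-> A y) -> ext2 d A A.
Proof. intros H K y. split; [apply K|]. rewrite (H y), K. tauto. Qed.

Lemma cl_eq (x y : D) : cl x -> cl y -> (forall z, z ε x <-> z ε y) -> x = y.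
Proof.
  intros Hx Hy H. apply (ext2_unique (fun z => z ε y) (fun z => z ε y)).
  - apply cl_ext2; assumption.
  - apply cl_ext2; [assumption|tauto].
Qed.

Lemma set_eq (x y : D) : (forall z, z ε x <-> z ε y) ->
  (forall z, out z x <-> out z y) -> x = y.
Proof.
  intros H K. apply (ext2_unique (fun z => z ε y) (fun z => ~ out z y)).
  - intros z; split; [apply H|]. rewrite K. split; [tauto|apply NNPP].
  - apply ext2_self.
Qed.

Lemma isset2_iff (A B A' B' : D -> Prop) :
  (forall y, A y <-> A' y) -> (forall y, B y <-> B' y) -> isset2 A' B' -> isset2 A B.
Proof.
  intros HA HB [d H]; exists d; intros y. rewrite HA, HB. apply H.
Qed.

Lemma isset_iff (A A' : D -> Prop) :
  (forall y, A y <-> A' y) -> isset A' -> isset A.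
Proof. intros H; apply isset2_iff; exact H. Qed.

(** Separation from d itself would inherit its negative extension. From a classical superset,
    membership in d cuts out the classical set d^!. *)
Lemma isset_in (d : D) : isset (fun y => y ε d).
Proof.
  destruct (superset d) as (C & HC & H1 & H2).
  destruct (separation2 (fun y => y ε d) C) as [x Hx]; [dfn|].
  exists x; intros y; specialize (Hx y); specialize (HC y); specialize (H1 y). tauto.
Qed.

Lemma isset_Def (A : D -> Prop) : isset A -> Def1 A.
Proof.
  intros [d H]. apply (Def_iff _ (fun rho => rho 0 ε d)); [|dfn].
  intros rho; specialize (H (rho 0)); tauto.
Qed.

Lemma isset_sep (P Q : D -> Prop) :
  Def1 P -> isset Q -> (forall y, P y -> Q y) -> isset P.
Proof.
  intros HP [d H] K. destruct (separation2 P d HP) as [x Hx].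
  exists x; intros y; specialize (H y); specialize (Hx y); specialize (K y). tauto.
Qed.

Lemma DT_mk (A B : (nat -> D) -> D -> Prop) :
  (forall rho, isset2 (A rho) (B rho)) ->
  Def (fun rho => A (fun i => rho (S i)) (rho 0)) ->
  Def (fun rho => B (fun i => rho (S i)) (rho 0)) ->
  DT (fun rho => mk (A rho) (B rho)).
Proof.
  intros H HA HB.
  apply (Def_iff _ (fun rho => ext2 (rho 0) (A (fun i => rho (S i))) (B (fun i => rho (S i))))).
  - intros rho; split.
    + intros ->; apply mk_spec, H.
    + intros K; symmetry; apply mk_unique, K.
  - unfold ext2.
    assert (HA' := Def_ren (fun i => match i with 0 => 0 | S i => S (S i) end) _ HA).
    assert (HB' := Def_ren (fun i => match i with 0 => 0 | S i => S (S i) end) _ HB).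
    simpl in HA', HB'.
    apply (Def_all (fun y rho => (y ε rho 0 <-> A (fun i => rho (S i)) y) /\
      (out y (rho 0) <-> ~ B (fun i => rho (S i)) y))).
    apply Def_and; apply Def_equiv; try apply Def_not; try assumption; dfn.
Qed.

Lemma DT_setof (A : (nat -> D) -> D -> Prop) :
  (forall rho, isset (A rho)) ->
  Def (fun rho => A (fun i => rho (S i)) (rho 0)) -> DT (fun rho => setof (A rho)).
Proof. intros H K. apply DT_mk; assumption. Qed.

Lemma isset_pair (u v : D) : isset (fun y => y = u \/ y = v).
Proof.
  axiom E ax_pairing PZFC_pairing (fun _ : nat => u). destruct (E u v) as [x H]. simpl in H.
  exists x; intros y. specialize (H y). tauto.
Qed.

Lemma isset_sing (u : D) : isset (fun y => y = u).
Proof. eapply isset_iff; [|apply (isset_pair u u)]. tauto. Qed.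

Lemma isset_empty : isset (fun _ => False).
Proof.
  destruct (dom_inh W) as [d]. apply (isset_sep _ (fun y => y = d)).
  - dfn.
  - apply isset_sing.
  - tauto.
Qed.

Lemma isset2_bigunion (u : D) :
  isset2 (fun y => exists z, y ε z /\ z ε u) (fun y => exists z, ~ out y z /\ ~ out z u).
Proof.
  axiom E ax_union PZFC_union (fun _ : nat => u). destruct (E u) as [x H]. simpl in H.
  exists x; intros y; specialize (H y). split; [tauto|]. split; intros K.
  - intros (z & K1 & K2). destruct H as [_ [H _]]. specialize (H K z). tauto.
  - apply H. intros z. destruct (classic (out y z)) as [|K1]; [tauto|].
    destruct (classic (out z u)); [tauto|]. exfalso; apply K; exists z; tauto.
Qed.

Lemma isset2_union (A B A' B' : D -> Prop) : isset2 A B -> isset2 A' B' ->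
  isset2 (fun y => A y \/ A' y) (fun y => B y \/ B' y).
Proof.
  intros [d H] [d' H']. destruct (isset_pair d d') as [p Hp].
  eapply isset2_iff; [| |apply (isset2_bigunion p)]; intros y.
  - split.
    + intros [K|K]; [exists d|exists d']; split; try apply Hp; try apply H; try apply H'; auto.
    + intros (z & K & L). apply Hp in L. destruct L as [->| ->]; [left; apply H|right; apply H']; exact K.
  - split.
    + intros [K|K]; [exists d|exists d'];
        specialize (H y); specialize (H' y); rewrite (proj2 (Hp _)); tauto.
    + intros (z & K & L). rewrite (proj2 (Hp _)) in L. apply NNPP in L.
      specialize (H y); specialize (H' y).
      destruct L as [->| ->]; [left|right]; apply NNPP; tauto.
Qed.

Lemma isset_union (A B : D -> Prop) : isset A -> isset B -> isset (fun y => A y \/ B y).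
Proof. apply isset2_union. Qed.

Lemma isset_sub (u : D) :
  isset (fun x => (forall z, z ε x -> z ε u) /\ (forall z, out z u -> out z x)).
Proof.
  axiom E ax_power_set PZFC_power_set (fun _ : nat => u). destruct (E u) as [v H]. simpl in H.
  exists v; intros x; specialize (H x).
  assert (K : (forall y, (y ε x -> y ε u) /\ (out y u -> out y x)) <->
    (forall z, z ε x -> z ε u) /\ (forall z, out z u -> out z x)).
  { split; [intros K; split; intros z; apply K|intros [K1 K2] z; auto]. }
  tauto.
Qed.

Lemma isset_pow (A : D -> Prop) :
  isset A -> isset (fun x => cl x /\ forall y, y ε x -> A y).
Proof.
  intros [u H]. eapply isset_sep; [|apply (isset_sub u)|].
  - assert (HA : Def1 A) by (apply isset_Def; exists u; exact H). unfold cl. dfn.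
  - intros x [Hx K]. split; intros z L.
    + apply H, K, L.
    + apply Hx. intros Kz. apply H in L. auto.
Qed.

Lemma isset2_image (g : D -> D) (u : D) : DT1 g ->
  isset2 (fun z => exists w, w ε u /\ z = g w) (fun z => exists w, ~ out w u /\ z = g w).
Proof.
  intros (phi & v & H).
  (* The formula defines the graph of g in every environment, so the indices beyond value and
     argument may hold any element. *)
  set (d0 := epsilon (dom_inh W) (fun _ => True)).
  set (rho0 := fun k => env v (fun _ => d0) k).
  (* the formula G(w,z) has index 0 for w and index 1 for z *)
  set (xi := fun k => match v k with inl 0 => 1 | inl 1 => 0 | _ => S (S k) end).
  (* Replacement asks for a classical formula, which ! provides. *)
  set (psi := Neg (Imp (ren xi phi) Bot)).
  assert (Hpsi : forall w z, truth W (scons w (scons z rho0)) (ren xi phi) <-> z = g w).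
  { intros w z. rewrite truth_ren. specialize (H (scons z (scons w (fun _ => d0)))).
    simpl in H. rewrite H.
    replace (env v (scons z (scons w (fun _ => d0)))) with
      (fun i => scons w (scons z rho0) (xi i)); [tauto|].
    apply functional_extensionality; intros k; unfold env, xi, rho0, env.
    destruct (v k) as [[|[|i]]|a] eqn:E; simpl; rewrite ?E; reflexivity. }
  eassert (E : _).
  { eapply (axiom_truth (ax_replacement psi) _ rho0 (PZFC_replacement psi)).
    intros; unfold ax_replacement; brl. }
  destruct E with (a := u) as [y Hy].
  - split; simpl.
    + intros a b. tauto.
    + intros a. exists (g a). rewrite Hpsi. split; [tauto|].
      intros b. rewrite Hpsi. intros [-> _]; reflexivity.
  - exists y. intros z. specialize (Hy z). simpl in Hy. destruct Hy as [H1 H2]. split.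
    + rewrite H1. split; intros [w K]; exists w; revert K; rewrite Hpsi; tauto.
    + rewrite H2. split.
      * intros K (w & K1 & K2). specialize (K w). rewrite Hpsi in K. tauto.
      * intros K w. rewrite Hpsi. destruct (classic (out w u)); [tauto|].
        right. intros L. apply K. exists w; auto.
Qed.

Lemma isset_image (g : D -> D) (P : D -> Prop) : DT1 g -> isset P ->
  isset (fun z => exists w, P w /\ z = g w).
Proof.
  intros Hg [u H]. eapply isset2_iff; [| |apply (isset2_image g u Hg)];
    intros z; split; intros (w & K & E); exists w; (split; [|exact E]);
    specialize (H w); tauto.
Qed.

Lemma isset_bigunion (P : D -> Prop) (Q : D -> D -> Prop) :
  isset P -> (forall x, isset (Q x)) -> Def2 Q ->
  isset (fun y => exists x, P x /\ Q x y).
Proof.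
  intros HP HQ DQ.
  assert (Hg : DT1 (fun x => setof (Q x))).
  { apply (DT_setof (fun rho => Q (rho 0))); [intros; apply HQ|].
    apply (Def_app2 Q); [exact DQ|apply DT_var|apply DT_var]. }
  destruct (isset_image _ P Hg HP) as [u Hu].
  eapply isset2_iff; [| |apply (isset2_bigunion u)]; intros y; split.
  - intros (x & K1 & K2). exists (setof (Q x)). rewrite in_setof by apply HQ.
    split; [exact K2|]. apply Hu; exists x; auto.
  - intros (z & K1 & K2). apply Hu in K2. destruct K2 as (x & K2 & ->).
    rewrite in_setof in K1 by apply HQ. exists x; auto.
  - intros (x & K1 & K2). exists (setof (Q x)). rewrite out_setof by apply HQ.
    split; [tauto|]. rewrite (proj2 (Hu _)). intros K; apply K. exists x; auto.
  - intros (z & K1 & K2). rewrite (proj2 (Hu _)) in K2. apply NNPP in K2.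
    destruct K2 as (x & K2 & ->).
    rewrite out_setof in K1 by apply HQ. exists x; split; [exact K2|apply NNPP, K1].
Qed.

(** The induction hypothesis of the axiom covers x^! ∪ x^?, in particular the true members of x. *)
Lemma foundation (P : D -> Prop) : Def1 P ->
  (forall x, (forall y, y ε x -> P y) -> P x) -> forall u, P u.
Proof.
  intros HP IH u. destruct (Def1_formula P HP) as (phi & rho & H).
  eassert (E : _).
  { eapply (axiom_truth (ax_foundation phi) _ rho (PZFC_foundation phi)).
    intros; unfold ax_foundation; brl. }
  cbv beta in E. apply H, E. intros x K. apply H, IH. intros y Ky. apply H, K. tauto.
Qed.

Lemma no_2cycle (x y : D) : x ε y -> ~ y ε x.
Proof.
  revert y. apply (foundation (fun x => forall y, x ε y -> ~ y ε x)); [dfn|].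
  intros u IH v Huv Hvu. exact (IH v Hvu u Hvu Huv).
Qed.

Definition empty : D := setof (fun _ => False).
Definition sg (u : D) : D := setof (fun y => y = u).
Definition pr (u v : D) : D := setof (fun y => y = u \/ y = v).
Definition kp (u v : D) : D := pr (sg u) (pr u v).

Lemma cl_empty : cl empty.
Proof. apply cl_setof, isset_empty. Qed.

Lemma in_empty (y : D) : ~ y ε empty.
Proof. intros H. apply (in_setof (fun _ => False)) in H; [exact H|apply isset_empty]. Qed.

Lemma in_sg (u y : D) : y ε sg u <-> y = u.
Proof. apply (in_setof (fun y => y = u)), isset_sing. Qed.

Lemma in_pr (u v y : D) : y ε pr u v <-> y = u \/ y = v.
Proof. apply (in_setof (fun y => y = u \/ y = v)), isset_pair. Qed.

Lemma DT_sg : DT1 sg.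
Proof. apply (DT_setof (fun rho y => y = rho 0)); [intros; apply isset_sing|dfn]. Qed.

Lemma DT_pr : DT2 pr.
Proof.
  apply (DT_setof (fun rho y => y = rho 0 \/ y = rho 1)); [intros; apply isset_pair|dfn].
Qed.

Lemma DT_kp : DT2 kp.
Proof.
  unfold kp. apply (DT_app2 pr); [exact DT_pr| |]; [apply (DT_app1 sg)|apply (DT_app2 pr)];
    auto using DT_sg, DT_pr, DT_var.
Qed.

Lemma sg_inj (u v : D) : sg u = sg v -> u = v.
Proof. intros H. apply in_sg. rewrite <- H. apply in_sg. reflexivity. Qed.

Lemma kp_inj (u v u' v' : D) : kp u v = kp u' v' -> u = u' /\ v = v'.
Proof.
  intros H.
  assert (E : u = u').
  { assert (K : sg u ε kp u' v') by (rewrite <- H; apply in_pr; auto).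
    apply in_pr in K. destruct K as [K|K]; [apply sg_inj, K|].
    assert (L : u' ε sg u) by (rewrite K; apply in_pr; auto).
    apply in_sg in L. congruence. }
  subst u'. split; [reflexivity|].
  assert (K : forall x y, pr u x = pr u y \/ pr u x = sg u -> x = y \/ x = u).
  { intros x y [K|K]; assert (L : x ε pr u x) by (apply in_pr; auto);
      rewrite K in L; [apply in_pr in L|apply in_sg in L]; tauto. }
  assert (A : forall x y, kp u x = kp u y -> x = y \/ x = u).
  { intros x y E. apply K. assert (L : pr u x ε kp u y) by (rewrite <- E; apply in_pr; auto).
    apply in_pr in L. tauto. }
  destruct (A _ _ H), (A _ _ (eq_sym H)); congruence.
Qed.

Lemma sg_neq_empty (u : D) : sg u <> empty.
Proof. intros H. apply (in_empty u). rewrite <- H. apply in_sg. reflexivity. Qed.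

Definition opP (P Q : D -> Prop) (z : D) : Prop :=
  (exists x, P x /\ z = kp x empty) \/ (exists y, Q y /\ z = kp y (sg empty)).
Definition op (a b : D) : D :=
  mk (opP (fun x => x ε a) (fun y => y ε b)) (opP (fun x => ~ out x a) (fun y => ~ out y b)).

Lemma isset2_op (a b : D) :
  isset2 (opP (fun x => x ε a) (fun y => y ε b)) (opP (fun x => ~ out x a) (fun y => ~ out y b)).
Proof.
  apply isset2_union; apply isset2_image; apply (DT_app2 kp);
    auto using DT_kp, DT_var, DT_const.
Qed.

Lemma op_spec (a b : D) :
  ext2 (op a b) (opP (fun x => x ε a) (fun y => y ε b))
    (opP (fun x => ~ out x a) (fun y => ~ out y b)).
Proof. apply mk_spec, isset2_op. Qed.

Lemma DT_op : DT2 op.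
Proof.
  assert (H := DT_kp). assert (K := DT_sg).
  apply (DT_mk (fun rho => opP (fun x => x ε rho 0) (fun y => y ε rho 1))
    (fun rho => opP (fun x => ~ out x (rho 0)) (fun y => ~ out y (rho 1))));
    [intros; apply isset2_op| |]; unfold opP; apply Def_or;
    apply Def_ex, Def_and; try dfn; apply Def_eq; auto using DT_var; apply (DT_app2 kp);
    auto using DT_var, DT_const.
Qed.

Lemma opP_l (P Q : D -> Prop) (x : D) : opP P Q (kp x empty) <-> P x.
Proof.
  split; [|intros H; left; exists x; auto].
  intros [(y & H & E)|(y & H & E)]; apply kp_inj in E; destruct E as [E F].
  - congruence.
  - destruct (sg_neq_empty empty); congruence.
Qed.

Lemma opP_r (P Q : D -> Prop) (x : D) : opP P Q (kp x (sg empty)) <-> Q x.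
Proof.
  split; [|intros H; right; exists x; auto].
  intros [(y & H & E)|(y & H & E)]; apply kp_inj in E; destruct E as [E F].
  - destruct (sg_neq_empty empty); congruence.
  - congruence.
Qed.

(** The tags keep the coordinates apart: at [kp z empty] the pair shows whether z is in a and
    whether it is out of a, and at [kp z (sg empty)] the same for b. So both extensions of both
    coordinates are recovered. *)
Lemma op_inj (a b a' b' : D) : op a b = op a' b' -> a = a' /\ b = b'.
Proof.
  intros H. assert (K := op_spec a b). assert (K' := op_spec a' b'). rewrite H in K.
  split; apply set_eq; intros z.
  - specialize (K (kp z empty)); specialize (K' (kp z empty)). rewrite opP_l in K, K'. tauto.
  - specialize (K (kp z empty)); specialize (K' (kp z empty)). rewrite !opP_l in K, K'.
    split; intros L; apply NNPP; tauto.
  - specialize (K (kp z (sg empty))); specialize (K' (kp z (sg empty))).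
    rewrite opP_r in K, K'. tauto.
  - specialize (K (kp z (sg empty))); specialize (K' (kp z (sg empty))).
    rewrite !opP_r in K, K'. split; intros L; apply NNPP; tauto.
Qed.

Lemma isset_prod (P Q : D -> Prop) : isset P -> isset Q ->
  isset (fun z => exists a b, P a /\ Q b /\ z = op a b).
Proof.
  intros HP HQ. apply isset_Def in HQ as DQ. assert (H := DT_op).
  apply (isset_iff _ (fun z => exists a, P a /\ (exists b, Q b /\ z = op a b))).
  - intros z; split; [intros (a & b & K1 & K2 & E)|intros (a & K1 & b & K2 & E)]; eauto 6.
  - apply (isset_bigunion P (fun a z => exists b, Q b /\ z = op a b)); [exact HP| |].
    + intros a. apply isset_image; [|exact HQ]. apply (DT_app2 op); auto using DT_var, DT_const.
    + apply (Def_ex (fun b rho => Q b /\ rho 1 = op (rho 0) b)), Def_and; [dfn|].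
      apply Def_eq; auto using DT_var; apply (DT_app2 op); auto using DT_var.
Qed.

(** * Natural numbers *)

Definition suc (y : D) : D :=
  mk (fun z => z ε y \/ z = y) (fun z => ~ out z y \/ z = y).

Lemma suc_spec (y : D) : ext2 (suc y) (fun z => z ε y \/ z = y) (fun z => ~ out z y \/ z = y).
Proof.
  apply mk_spec, isset2_union; [exists y; apply ext2_self|apply isset_sing].
Qed.

Lemma in_suc (y z : D) : z ε suc y <-> z ε y \/ z = y.
Proof. apply suc_spec. Qed.

Lemma DT_suc : DT1 suc.
Proof.
  apply (DT_mk (fun rho z => z ε rho 0 \/ z = rho 0) (fun rho z => ~ out z (rho 0) \/ z = rho 0)).
  - intros. apply isset2_union; [eexists; apply ext2_self|apply isset_sing].
  - dfn.
  - dfn.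
Qed.

Lemma suc_inj (m n : D) : suc m = suc n -> m = n.
Proof.
  intros H. assert (K : m ε suc n) by (rewrite <- H; apply in_suc; auto).
  assert (L : n ε suc m) by (rewrite H; apply in_suc; auto).
  apply in_suc in K, L. destruct K as [K|K], L as [L|L]; try congruence.
  destruct (no_2cycle _ _ K L).
Qed.

Lemma suc_neq_empty (n : D) : suc n <> empty.
Proof. intros H. apply (in_empty n). rewrite <- H. apply in_suc; auto. Qed.

Definition ind (x : D) : Prop := empty ε x /\ forall y, y ε x -> suc y ε x.
Definition inom (n : D) : Prop := forall x, cl x -> ind x -> n ε x.

End SetTheory.

Ltac dfn_sets :=
  match goal with
  | |- DT (fun rho => sg _) => apply (DT_app1 sg _ DT_sg)
  | |- DT (fun rho => pr _ _) => apply (DT_app2 pr _ _ DT_pr)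
  | |- DT (fun rho => kp _ _) => apply (DT_app2 kp _ _ DT_kp)
  | |- DT (fun rho => op _ _) => apply (DT_app2 op _ _ DT_op)
  | |- DT (fun rho => suc _) => apply (DT_app1 suc _ DT_suc)
  | H : isset ?P |- Def (fun rho => ?P _) => apply (Def_app1 P _ (isset_Def P H))
  | |- Def (fun rho => cl _) => unfold cl
  | |- Def (fun rho => ind _) => unfold ind
  end.
Ltac dfn_ext ::= dfn_sets.

Section Infinity.
Context {W : tfmodel} {HW : pzfc_model W}.
Local Notation D := (dom W).

Lemma eq_empty (d : D) : (forall y, (y ε d <-> False) /\ (out y d <-> True)) -> d = empty.
Proof.
  intros H. apply (ext2_unique (fun _ => False) (fun _ => False)).
  - intros y; specialize (H y); tauto.
  - apply mk_spec, isset_empty.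
Qed.

Lemma empty_ext (y : D) : (y ε empty <-> False) /\ (out y empty <-> True).
Proof. assert (H := mk_spec _ _ isset_empty y). unfold empty, setof. tauto. Qed.

Lemma brel_empty (w : world W) phi (P N : D -> Prop) :
  frel w phi P N -> brel w (the cempty phi) (P empty) (N empty).
Proof.
  intros H. eapply brel_the; [apply frel_cempty|exact H|exact empty_ext|exact eq_empty].
Qed.

Lemma brel_suc (w : world W) phi (P N : D -> Prop) y b : vrel w y b ->
  frel w phi P N -> brel w (the (csucc y) phi) (P (suc b)) (N (suc b)).
Proof.
  intros V H. unfold csucc. eapply brel_the.
  - eapply frel_cup; [apply frel_elem, V|apply frel_sing, V].
  - exact H.
  - intros z. destruct (suc_spec b z) as [K L]. split; [exact K|]. tauto.
  - intros d K. symmetry. apply mk_unique. intros z; specialize (K z). tauto.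
Qed.

End Infinity.

Ltac brl_ext ::=
  match goal with
  | |- brel _ (the cempty _) _ _ => eapply brel_empty
  | |- brel _ (the (csucc _) _) _ _ => eapply brel_suc
  end.

Section Omega.
Context {W : tfmodel} {HW : pzfc_model W}.
Local Notation D := (dom W).

Lemma brelT_inductive (w : world W) x a : vrel w x a -> brelT w (inductive x) (ind a).
Proof. intros V. eapply brelT_iff; [unfold inductive; brl|reflexivity]. Qed.

(** The inductive set of the axiom may be non-classical, but its positive extension is a classical
    inductive set, and ω is separated from that. *)
Lemma isset_inom : isset (inom (W := W)).
Proof.
  destruct (dom_inh W) as [d].
  eassert (E : _).
  { eapply (axiom_truth ax_infinity _ (fun _ => d) PZFC_infinity).
    intros; unfold ax_infinity. apply brelT_ex. intro_var. apply brelT_inductive; eassumption. }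
  cbv beta in E. destruct E as [x [H1 H2]].
  apply (isset_sep _ (fun y => y ε x)).
  - unfold inom. dfn.
  - apply isset_in.
  - intros n H. apply (in_setof (fun y => y ε x)); [apply isset_in|].
    apply H; [apply cl_setof, isset_in|]. split.
    + apply (in_setof (fun y => y ε x)); [apply isset_in|exact H1].
    + intros y K. apply (in_setof (fun y => y ε x)); [apply isset_in|].
      apply H2. apply (in_setof (fun y => y ε x)) in K; [exact K|apply isset_in].
Qed.

Lemma inom_empty : inom (empty (W := W)).
Proof. intros x _ H; apply H. Qed.

Lemma inom_suc (n : D) : inom n -> inom (suc n).
Proof. intros Hn x Hx H. apply H, Hn; assumption. Qed.

Lemma inom_ind (P : D -> Prop) : Def1 P -> P empty ->
  (forall n, inom n -> P n -> P (suc n)) -> forall n, inom n -> P n.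
Proof.
  intros HP H0 HS n Hn.
  assert (K : isset (fun n => inom n /\ P n)).
  { apply (isset_sep _ inom); [assert (H := isset_inom); dfn|exact isset_inom|tauto]. }
  apply (in_setof (fun n => inom n /\ P n) n K).
  apply Hn; [apply cl_setof, K|]. split.
  - apply (in_setof _ _ K). split; [exact inom_empty|exact H0].
  - intros y Hy. apply (in_setof _ _ K) in Hy. apply (in_setof _ _ K).
    split; [apply inom_suc|apply HS]; tauto.
Qed.

Lemma inom_trans (n : D) : inom n -> forall i, i ε n -> inom i.
Proof.
  assert (H := isset_inom).
  revert n. refine (inom_ind _ _ _ _); [dfn| |].
  - intros i K. destruct (in_empty i K).
  - intros n Hn IH i K. apply in_suc in K. destruct K as [K| ->]; auto.
Qed.

Fixpoint num (k : nat) : D := match k with 0 => empty | S k => suc (num k) end.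

Lemma num_inj (k m : nat) : num k = num m -> k = m.
Proof.
  revert m; induction k; intros [|m] H; simpl in H; try reflexivity.
  - destruct (suc_neq_empty (num m)); congruence.
  - destruct (suc_neq_empty (num k)); congruence.
  - f_equal. apply IHk, suc_inj, H.
Qed.

Lemma inom_num (k : nat) : inom (num k).
Proof. induction k; [exact inom_empty|apply inom_suc, IHk]. Qed.

End Omega.

(** * Closure of a set under ordered pairs *)

Section PairClosure.
Context {W : tfmodel} {HW : pzfc_model W}.
Local Notation D := (dom W).
Context (a0 : D).

(** Keeping the old elements makes the stages cumulative, on which [pclos_directed] relies. *)
Definition pstep (c : D) : D :=
  setof (fun z => z ε c \/ exists a b, a ε c /\ b ε c /\ z = op a b).

Lemma isset_pstep (c : D) : isset (fun z => z ε c \/ exists a b, a ε c /\ b ε c /\ z = op a b).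
Proof. apply isset_union; [apply isset_in|apply isset_prod; apply isset_in]. Qed.

Lemma in_pstep (c z : D) : z ε pstep c <-> z ε c \/ exists a b, a ε c /\ b ε c /\ z = op a b.
Proof. apply (in_setof (fun z => z ε c \/ exists a b, a ε c /\ b ε c /\ z = op a b)), isset_pstep. Qed.

Lemma DT_pstep : DT1 pstep.
Proof.
  apply (DT_setof (fun rho z => z ε rho 0 \/ exists a b, a ε rho 0 /\ b ε rho 0 /\ z = op a b)).
  - intros; apply isset_pstep.
  - dfn.
Qed.

(** The graph of the iteration of [pstep] from [a0], given by finite
    derivations. *)
Definition pderiv (g : D) : Prop :=
  forall y, y ε g -> y = op empty a0 \/ exists m c, op m c ε g /\ y = op (suc m) (pstep c).
Definition piter (n x : D) : Prop := exists g, op n x ε g /\ pderiv g.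

Lemma Def_piter : Def2 piter.
Proof.
  assert (H := DT_pstep). unfold piter, pderiv. dfn.
Qed.

Lemma piter0 : piter empty a0.
Proof.
  exists (sg (op empty a0)). split; [apply in_sg; reflexivity|].
  intros y H; apply in_sg in H; auto.
Qed.

Lemma piterS (n x : D) : piter n x -> piter (suc n) (pstep x).
Proof.
  intros (g & H & K).
  assert (L : isset (fun y => y ε g \/ y = op (suc n) (pstep x)))
    by (apply isset_union; [apply isset_in|apply isset_sing]).
  exists (setof (fun y => y ε g \/ y = op (suc n) (pstep x))).
  split; [apply (in_setof _ _ L); auto|].
  intros y Hy. apply (in_setof _ _ L) in Hy. destruct Hy as [Hy| ->].
  - destruct (K y Hy) as [E|(m & c & Hm & E)]; [auto|].
    right; exists m, c; split; [apply (in_setof _ _ L); auto|exact E].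
  - right; exists n, x; split; [apply (in_setof _ _ L); auto|reflexivity].
Qed.

Lemma piter_inv (n x : D) : piter n x ->
  (n = empty /\ x = a0) \/ exists m c, piter m c /\ n = suc m /\ x = pstep c.
Proof.
  intros (g & H & K). destruct (K _ H) as [E|(m & c & Hm & E)]; apply op_inj in E.
  - auto.
  - right. exists m, c. split; [exists g; auto|tauto].
Qed.

Lemma piter_unique (n : D) : inom n -> forall x x', piter n x -> piter n x' -> x = x'.
Proof.
  assert (H := Def_piter).
  revert n. refine (inom_ind _ _ _ _); [dfn| |].
  - intros x x' K K'. apply piter_inv in K, K'.
    destruct K as [[_ ->]|(m & c & _ & E & _)]; [|destruct (suc_neq_empty m); auto].
    destruct K' as [[_ ->]|(m & c & _ & E & _)]; [|destruct (suc_neq_empty m); auto].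
    reflexivity.
  - intros n Hn IH x x' K K'. apply piter_inv in K, K'.
    destruct K as [[E _]|(m & c & K & E & ->)]; [destruct (suc_neq_empty n E)|].
    apply suc_inj in E; subst m.
    destruct K' as [[E _]|(m & c' & K' & E & ->)]; [destruct (suc_neq_empty n E)|].
    apply suc_inj in E; subst m.
    f_equal. apply IH; assumption.
Qed.

Lemma piter_ex (n : D) : inom n -> exists x, piter n x.
Proof.
  assert (H := Def_piter).
  revert n. refine (inom_ind _ _ _ _); [dfn| |].
  - exists a0; exact piter0.
  - intros n _ [x K]. exists (pstep x). apply piterS, K.
Qed.

Definition pclos (y : D) : Prop := exists n, inom n /\ exists x, piter n x /\ y ε x.

Lemma isset_pclos : isset pclos.
Proof.
  assert (H := Def_piter). assert (HI := isset_inom (W := W)).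
  (* The guard [inom n] is doubled because [isset_bigunion] wants a set at every index, also outside
     ω. *)
  apply (isset_iff _ (fun y => exists n, inom n /\ (inom n /\ exists x, piter n x /\ y ε x))).
  { intros y; split; [intros (n & H1 & H2)|intros (n & H1 & H2 & H3)]; exists n; auto. }
  apply (isset_bigunion inom (fun n y => inom n /\ exists x, piter n x /\ y ε x)).
  - exact HI.
  - intros n. destruct (classic (inom n)) as [Hn|Hn].
    + destruct (piter_ex n Hn) as [x K]. apply (isset_iff _ (fun y => y ε x)); [|apply isset_in].
      intros y; split.
      * intros (_ & x' & K' & L). rewrite (piter_unique n Hn x x' K K'); exact L.
      * intros L; split; [exact Hn|]. exists x; auto.
    + apply (isset_iff _ (fun _ => False)); [tauto|apply isset_empty].
  - dfn.
Qed.

Lemma pclos_base (y : D) : y ε a0 -> pclos y.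
Proof. intros H. exists empty. split; [exact inom_empty|]. exists a0. split; [exact piter0|exact H]. Qed.

(** Two stages lie in a common one. Induction on n with m fixed avoids order and addition on ω:
    stage m serves for n = 0, and a stage that serves for n serves for the successor of n after one
    more step. *)
Lemma pclos_directed (n : D) : inom n -> forall m, inom m ->
  exists k, inom k /\ forall x y z, piter n x -> piter m y -> piter k z ->
    forall u, u ε x \/ u ε y -> u ε z.
Proof.
  assert (H := Def_piter). assert (HI := isset_inom (W := W)).
  intros Hn m Hm. revert n Hn. refine (inom_ind _ _ _ _); [dfn| |].
  - exists m. split; [exact Hm|]. intros x y z K1 K2 K3 u.
    rewrite (piter_unique _ Hm _ _ K3 K2).
    rewrite (piter_unique _ inom_empty _ _ K1 piter0). clear K1 K3 z x.
    revert m Hm y K2 u. 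
    apply (inom_ind (fun m => forall y, piter m y -> forall u, u ε a0 \/ u ε y -> u ε y)).
    + dfn.
    + intros y K. rewrite (piter_unique _ inom_empty _ _ K piter0). tauto.
    + intros m Hm IH y K u [L|L]; [|exact L].
      destruct (piter_ex m Hm) as [c Kc].
      rewrite (piter_unique _ (inom_suc _ Hm) _ _ K (piterS _ _ Kc)).
      apply in_pstep. left. apply (IH c Kc). auto.
  - intros n Hn (k & Hk & IH). exists (suc k). split; [apply inom_suc, Hk|].
    intros x y z K1 K2 K3 u L.
    destruct (piter_ex n Hn) as [c Kc]. destruct (piter_ex k Hk) as [d Kd].
    rewrite (piter_unique _ (inom_suc _ Hn) _ _ K1 (piterS _ _ Kc)) in L.
    rewrite (piter_unique _ (inom_suc _ Hk) _ _ K3 (piterS _ _ Kd)).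
    specialize (IH c y d Kc K2 Kd). apply in_pstep. rewrite in_pstep in L.
    destruct L as [[L|(a & b & La & Lb & E)]|L]; auto.
    right. exists a, b. auto.
Qed.

Lemma pclos_op (a b : D) : pclos a -> pclos b -> pclos (op a b).
Proof.
  intros (n & Hn & x & K1 & La) (m & Hm & y & K2 & Lb).
  destruct (pclos_directed n Hn m Hm) as (k & Hk & H).
  destruct (piter_ex k Hk) as [z K3].
  exists (suc k). split; [apply inom_suc, Hk|]. exists (pstep z).
  split; [apply piterS, K3|]. apply in_pstep. right. exists a, b.
  split; [|split]; [| |reflexivity]; eapply H; eauto.
Qed.

End PairClosure.

(** Provides room for the codes of formulas, which are iterated pairs: the set of formulas is
    separated from such a U. *)
Lemma pair_closure {W : tfmodel} {HW : pzfc_model W} (A : dom W -> Prop) : isset A ->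
  exists U : dom W -> Prop, isset U /\ (forall x, A x -> U x) /\
    forall a b, U a -> U b -> U (op a b).
Proof.
  intros H. exists (pclos (setof A)). split; [apply isset_pclos|]. split.
  - intros x K. apply pclos_base, in_setof; assumption.
  - apply pclos_op.
Qed.

(** * Functions and formulas *)

Section Functions.
Context {W : tfmodel} {HW : pzfc_model W}.
Local Notation D := (dom W).

Definition isfun (f : D) (P Q : D -> Prop) : Prop :=
  cl f /\ (forall z, z ε f -> exists a b, z = op a b /\ P a /\ Q b) /\
  (forall x, P x -> exists y, op x y ε f) /\
  (forall x y z, op x y ε f -> op x z ε f -> y = z).

Lemma isfun_dom f P Q x y : isfun f P Q -> op x y ε f -> P x /\ Q y.
Proof.
  intros (_ & H & _) K. destruct (H _ K) as (a & b & E & Ha & Hb).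
  apply op_inj in E. destruct E; subst; auto.
Qed.

Lemma isfun_ext f g P Q Q' : isfun f P Q -> isfun g P Q' ->
  (forall x a b, op x a ε f -> op x b ε g -> a = b) -> f = g.
Proof.
  intros (F1 & F2 & F3 & F4) (G1 & G2 & G3 & G4) H.
  apply cl_eq; [assumption|assumption|]. intros z; split; intros K.
  - destruct (F2 z K) as (a & b & -> & Ha & Hb). destruct (G3 a Ha) as [c Hc].
    rewrite (H a b c K Hc). exact Hc.
  - destruct (G2 z K) as (a & b & -> & Ha & Hb). destruct (F3 a Ha) as [c Hc].
    rewrite <- (H a c b Hc K). exact Hc.
Qed.

Lemma isset_isfun (P Q : D -> Prop) :
  isset P -> isset Q -> isset (fun f => isfun f P Q).
Proof.
  intros HP HQ. eapply isset_sep; [|apply isset_pow, (isset_prod P Q HP HQ)|].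
  - unfold isfun. dfn.
  - intros f (H1 & H2 & _). split; [exact H1|]. intros y Hy.
    destruct (H2 y Hy) as (a & b & E & Ha & Hb). exists a, b; auto.
Qed.

Lemma isfun_graph (P Q : D -> Prop) (G : D -> D -> Prop) :
  isset P -> isset Q -> Def2 G ->
  (forall x, P x -> exists y, Q y /\ G x y) ->
  (forall x y z, P x -> Q y -> Q z -> G x y -> G x z -> y = z) ->
  exists f, isfun f P Q /\ forall x y, op x y ε f <-> P x /\ Q y /\ G x y.
Proof.
  intros HP HQ HG H1 H2.
  assert (K : isset (fun z => exists x y, z = op x y /\ P x /\ Q y /\ G x y)).
  { eapply isset_sep; [|apply (isset_prod P Q HP HQ)|].
    - dfn.
    - intros z (x & y & E & Hx & Hy & _). exists x, y; auto. }
  assert (L : forall x y, op x y ε setof (fun z => exists x y, z = op x y /\ P x /\ Q y /\ G x y)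
    <-> P x /\ Q y /\ G x y).
  { intros x y. rewrite (in_setof _ _ K). split.
    - intros (a & b & E & Hx). apply op_inj in E. destruct E; subst; exact Hx.
    - intros Hx; exists x, y; auto. }
  eexists. split; [|exact L]. split; [apply cl_setof, K|]. split; [|split].
  - intros z Hz. apply (in_setof _ _ K) in Hz. destruct Hz as (x & y & E & Hx & Hy & _).
    exists x, y; auto.
  - intros x Hx. destruct (H1 x Hx) as (y & Hy & Hxy). exists y. apply L; auto.
  - intros x y z Hy Hz. apply L in Hy, Hz. apply (H2 x); tauto.
Qed.

End Functions.

(** * Coded vocabularies, terms and formulas *)

Section Syntax.
Context {W : tfmodel} {HW : pzfc_model W}.
Local Notation D := (dom W).

Record voc : Type := Voc {
  vC : D; vR : D; vA : D;
  vC_cl : cl vC;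
  vC_el : forall c, c ε vC -> cl c;
  vR_cl : cl vR;
  vR_el : forall r, r ε vR -> cl r;
  vA_fun : isfun vA (fun r => r ε vR) inom
}.

Context (L : voc).

Definition tm (t : D) : Prop :=
  (exists i, inom i /\ t = op (num 0) i) \/ (exists c, c ε vC L /\ t = op (num 1) c).
Definition arr (r n : D) : Prop := r ε vR L /\ op r n ε vA L.
(** [cl n] belongs to the internal meaning of a tuple: n has to agree with the domain of a classical
    function in both extensions, and is therefore classical. *)
Definition tup (Q : D -> Prop) (n t : D) : Prop := cl n /\ isfun t (fun i => i ε n) Q.
Definition code (k : nat) (a b : D) : D := op (num k) (op a b).

Lemma code_inj k a b k' a' b' : code k a b = code k' a' b' -> k = k' /\ a = a' /\ b = b'.
Proof.
  intros E. apply op_inj in E. destruct E as [E1 E2]. apply op_inj in E2.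
  apply num_inj in E1. tauto.
Qed.

Lemma isset_term : isset tm.
Proof.
  assert (H := isset_inom (W := W)).
  apply isset_union.
  - apply isset_image; [dfn|exact H].
  - apply isset_image; [dfn|apply isset_in].
Qed.

Lemma arr_inom r n : arr r n -> inom n.
Proof. intros [_ H]. apply (isfun_dom _ _ _ _ _ (vA_fun L) H). Qed.

Lemma arr_fun r n m : arr r n -> arr r m -> n = m.
Proof. intros [_ H] [_ K]. destruct (vA_fun L) as (_ & _ & _ & F). eapply F; eassumption. Qed.

Lemma tup_pow (Q : D -> Prop) n t : inom n -> tup Q n t ->
  cl t /\ forall y, y ε t -> exists a b, inom a /\ Q b /\ y = op a b.
Proof.
  intros Hn (_ & H1 & H2 & _). split; [exact H1|].
  intros y Hy. destruct (H2 y Hy) as (a & b & E & Ha & Hb). exists a, b.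
  split; [exact (inom_trans n Hn a Ha)|auto].
Qed.

Definition fclosed (X : D -> Prop) : Prop :=
  X (code 0 empty empty) /\
  (forall t u, tm t -> tm u -> X (code 1 t u)) /\
  (forall r n t, arr r n -> tup tm n t -> X (code 2 r t)) /\
  (forall p, X p -> X (code 3 p empty)) /\
  (forall p q, X p -> X q -> X (code 4 p q)) /\
  (forall p q, X p -> X q -> X (code 5 p q)) /\
  (forall p q, X p -> X q -> X (code 6 p q)) /\
  (forall i p, inom i -> X p -> X (code 7 i p)) /\
  (forall i p, inom i -> X p -> X (code 8 i p)).

Definition fm (z : D) : Prop := forall X, cl X -> fclosed (fun z => z ε X) -> z ε X.

Lemma fm_closed : fclosed fm.
Proof.
  repeat split; intros; intros X HX C; assert (C' := C);
    destruct C' as (C0 & C1 & C2 & C3 & C4 & C5 & C6 & C7 & C8).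
  - exact C0.
  - apply C1; assumption.
  - eapply C2; eassumption.
  - apply C3; auto.
  - apply C4; auto.
  - apply C5; auto.
  - apply C6; auto.
  - apply C7; auto.
  - apply C8; auto.
Qed.

Lemma Def_fclosed : Def1 (fun X => fclosed (fun z => z ε X)).
Proof.
  assert (H1 := isset_inom (W := W)). assert (H2 := isset_term).
  unfold fclosed, arr, tup, code, isfun. dfn.
Qed.

Lemma fclosed_set : exists U : D -> Prop, isset U /\ fclosed U.
Proof.
  assert (HI := isset_inom (W := W)). assert (HT := isset_term).
  (* The argument tuples of atoms are functions and not iterated pairs, so all classical subsets of
     ω × terms go into the initial set. *)
  destruct (pair_closure (fun x => inom x \/ tm x \/ x ε vR L \/
    (cl x /\ forall y, y ε x -> exists a b, inom a /\ tm b /\ y = op a b)))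
    as (U & HU & HB & HP).
  { apply isset_union; [exact HI|]. apply isset_union; [exact HT|].
    apply isset_union; [apply isset_in|].
    eapply isset_iff; [|apply isset_pow, (isset_prod inom tm HI HT)]. reflexivity. }
  exists U. split; [exact HU|].
  assert (Hcode : forall k a b, U a -> U b -> U (code k a b)).
  { intros k a b Ha Hb. apply HP; [|apply HP; assumption]. apply HB. left. apply inom_num. }
  assert (He : U empty) by (apply HB; left; exact inom_empty).
  repeat split; intros; apply Hcode; auto.
  - apply HB. right; right; left. apply H.
  - apply HB. right; right; right. eapply tup_pow; [eapply arr_inom|]; eassumption.
Qed.

Lemma isset_fm : isset fm.
Proof.
  destruct fclosed_set as (U & HU & HC).
  apply (isset_sep _ U); [|exact HU|].
  - assert (H := Def_fclosed). unfold fm.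
    apply (Def_all (fun X rho => cl X -> fclosed (fun z => z ε X) -> rho 0 ε X)).
    apply Def_imp; [dfn|]. apply Def_imp; [|dfn].
    apply (Def_app1 (fun X => fclosed (fun z => z ε X))); [exact H|dfn].
  - intros z Hz. apply (in_setof U z HU). apply Hz; [apply cl_setof, HU|].
    replace (fun z => z ε setof U) with U; [exact HC|].
    apply functional_extensionality; intros y; apply propositional_extensionality.
    symmetry; apply in_setof, HU.
Qed.

Lemma fm_ind (P : D -> Prop) : Def1 P ->
  P (code 0 empty empty) ->
  (forall t u, tm t -> tm u -> P (code 1 t u)) ->
  (forall r n t, arr r n -> tup tm n t -> P (code 2 r t)) ->
  (forall p, fm p -> P p -> P (code 3 p empty)) ->
  (forall p q, fm p -> fm q -> P p -> P q -> P (code 4 p q)) ->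
  (forall p q, fm p -> fm q -> P p -> P q -> P (code 5 p q)) ->
  (forall p q, fm p -> fm q -> P p -> P q -> P (code 6 p q)) ->
  (forall i p, inom i -> fm p -> P p -> P (code 7 i p)) ->
  (forall i p, inom i -> fm p -> P p -> P (code 8 i p)) ->
  forall z, fm z -> P z.
Proof.
  intros HP P0 P1 P2 P3 P4 P5 P6 P7 P8 z Hz.
  assert (HF := isset_fm).
  assert (K : isset (fun z => fm z /\ P z)) by (apply (isset_sep _ fm); [dfn|exact HF|tauto]).
  apply (in_setof _ z K). apply Hz; [apply cl_setof, K|].
  replace (fun z => z ε setof (fun z => fm z /\ P z)) with (fun z => fm z /\ P z).
  2: { apply functional_extensionality; intros y; apply propositional_extensionality.
       symmetry; apply (in_setof _ _ K). }
  destruct fm_closed as (C0 & C1 & C2 & C3 & C4 & C5 & C6 & C7 & C8).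
  repeat split; intros;
    repeat match goal with H : fm _ /\ P _ |- _ => destruct H end; auto.
  - apply (C2 r n t); assumption.
  - apply (P2 r n t); assumption.
Qed.

End Syntax.

Arguments voc W : clear implicits.

Ltac dfn_syntax :=
  match goal with
  | |- DT (fun rho => code _ _ _) => unfold code
  | |- Def (fun rho => isfun _ _ _) => unfold isfun
  | |- Def (fun rho => tup _ _ _) => unfold tup
  | |- Def (fun rho => arr _ _ _) => unfold arr
  | |- Def (fun rho => inom _) => apply (Def_app1 inom _ (isset_Def _ isset_inom))
  | |- Def (fun rho => tm ?L _) => apply (Def_app1 (tm L) _ (isset_Def _ (isset_term L)))
  | |- Def (fun rho => fm ?L _) => apply (Def_app1 (fm L) _ (isset_Def _ (isset_fm L)))
  end.
Ltac dfn_ext ::= first [dfn_sets | dfn_syntax].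

Section Assignments.
Context {W : tfmodel} {HW : pzfc_model W}.
Local Notation D := (dom W).

Definition updP (s i a z : D) : Prop :=
  z = op i a \/ exists j b, z = op j b /\ op j b ε s /\ j <> i.
Definition upd (s i a : D) : D := setof (updP s i a).

Lemma isset_upd (s i a : D) : isset (updP s i a).
Proof.
  apply isset_union; [apply isset_sing|].
  apply (isset_sep _ (fun z => z ε s)); [dfn|apply isset_in|].
  intros z (j & b & -> & H & _); exact H.
Qed.

Lemma in_upd (s i a j b : D) :
  op j b ε upd s i a <-> (j = i /\ b = a) \/ (op j b ε s /\ j <> i).
Proof.
  unfold upd. rewrite (in_setof _ _ (isset_upd s i a)). split.
  - intros [E|(j' & b' & E & H)]; apply op_inj in E; destruct E; subst; auto.
  - intros [[-> ->]|H]; [left; reflexivity|right; exists j, b; tauto].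
Qed.

Lemma DT_upd : DT3 upd.
Proof.
  apply (DT_setof (fun rho => updP (rho 0) (rho 1) (rho 2))); [intros; apply isset_upd|].
  unfold updP. dfn.
Qed.

Lemma isfun_upd (s i a : D) (P Q : D -> Prop) :
  isfun s P Q -> P i -> Q a -> isfun (upd s i a) P Q.
Proof.
  intros Hs Hi Ha. assert (H := Hs). destruct H as (H1 & H2 & H3 & H4).
  split; [apply cl_setof, isset_upd|]. split; [|split].
  - intros z Hz. apply (in_setof _ _ (isset_upd s i a)) in Hz.
    destruct Hz as [-> |(j & b & -> & Hz & _)]; [exists i, a; auto|apply H2, Hz].
  - intros x Hx. destruct (classic (x = i)) as [->|N].
    + exists a. apply in_upd; auto.
    + destruct (H3 x Hx) as [y Hy]. exists y. apply in_upd; auto.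
  - intros x y z Hy Hz. apply in_upd in Hy, Hz.
    destruct Hy as [[E1 ->]|[Hy N1]], Hz as [[E2 ->]|[Hz N2]]; try tauto.
    eapply H4; eassumption.
Qed.

End Assignments.

(** As [shape], over the elements of a model *)
Inductive dshape {T : Type} : Type :=
| HBot
| HEq (a b : T)
| HRel (r v : T)
| HNeg (p : T)
| HAnd (p q : T)
| HOr (p q : T)
| HImp (p q : T)
| HAll (i p : T)
| HEx (i p : T).
Arguments dshape T : clear implicits.

Definition isub {T : Type} (p : T) (c : dshape T) : Prop :=
  match c with
  | HBot | HEq _ _ | HRel _ _ => False
  | HNeg q | HAll _ q | HEx _ q => p = q
  | HAnd q r | HOr q r | HImp q r => p = q \/ p = r
  end.

(** * Structures, values of terms and shapes of formulas *)

Section Structures.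
Context {W : tfmodel} {HW : pzfc_model W}.
Local Notation D := (dom W).
Context (L : voc W).

Record str : Type := Str {
  sM : D; sK : D;
  sM_cl : cl sM;
  sM_ne : exists a, a ε sM;
  sK_fun : isfun sK (fun c => c ε vC L) (fun a => a ε sM)
}.

(** Equality ([EP], [EN]) and the relation symbols ([PP], [NN]) *)
Record interp : Type := Interp { EP : D -> D -> Prop; EN : D -> D -> Prop;
  PP : D -> D -> Prop; NN : D -> D -> Prop }.

Context (X : str).

Definition asg (s : D) : Prop := isfun s inom (fun a => a ε sM X).
Definition val (s t a : D) : Prop :=
  (exists i, (inom i /\ t = op (num 0) i) /\ op i a ε s) \/
  (exists c, (c ε vC L /\ t = op (num 1) c) /\ op c a ε sK X).
Definition vals (s n t r : D) : Prop :=
  forall i x a, i ε n /\ op i x ε t /\ op i a ε r -> val s x a.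

(** The shape of an atom records values under s in place of terms, so that the clauses for truth and
    falsity never mention terms. *)
Definition fits (s z : D) (c : dshape D) : Prop :=
  match c with
  | HBot => z = code 0 empty empty
  | HEq a b => exists t u, tm L t /\ tm L u /\ z = code 1 t u /\ val s t a /\ val s u b
  | HRel r v => exists n t, arr L r n /\ tup (tm L) n t /\ z = code 2 r t /\
      tup (fun a => a ε sM X) n v /\ vals s n t v
  | HNeg p => fm L p /\ z = code 3 p empty
  | HAnd p q => fm L p /\ fm L q /\ z = code 4 p q
  | HOr p q => fm L p /\ fm L q /\ z = code 5 p q
  | HImp p q => fm L p /\ fm L q /\ z = code 6 p q
  | HAll i p => inom i /\ fm L p /\ z = code 7 i p
  | HEx i p => inom i /\ fm L p /\ z = code 8 i p
  end.

Definition tval (I : interp) (T F : D -> D -> Prop) (s : D) (c : dshape D) : Prop :=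
  match c with
  | HBot => False
  | HEq a b => EP I a b
  | HRel r v => PP I r v
  | HNeg p => F p s
  | HAnd p q => T p s /\ T q s
  | HOr p q => T p s \/ T q s
  | HImp p q => T p s -> T q s
  | HAll i p => forall a, a ε sM X -> T p (upd s i a)
  | HEx i p => exists a, a ε sM X /\ T p (upd s i a)
  end.

Definition fval (I : interp) (T F : D -> D -> Prop) (s : D) (c : dshape D) : Prop :=
  match c with
  | HBot => True
  | HEq a b => EN I a b
  | HRel r v => NN I r v
  | HNeg p => T p s
  | HAnd p q => F p s \/ F q s
  | HOr p q => F p s /\ F q s
  | HImp p q => T p s /\ F q s
  | HAll i p => exists a, a ε sM X /\ F p (upd s i a)
  | HEx i p => forall a, a ε sM X -> F p (upd s i a)
  end.

Definition Sat (I : interp) (T F : D -> D -> Prop) : Prop :=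
  forall s z c, asg s -> fits s z c ->
    (T z s <-> tval I T F s c) /\ (F z s <-> fval I T F s c).

(** The truth and falsity relations are definable relations here, not sets, so that
    the same notion covers Tarski models, T/F-models and two-valued models. *)
Definition aholds (I : interp) (p : D) : Prop :=
  exists T F, Def2 T /\ Def2 F /\ Sat I T F /\ forall s, asg s -> T p s.

Lemma isset_asg : isset asg.
Proof. apply isset_isfun; [apply isset_inom|apply isset_in]. Qed.

Lemma asg_app s i : asg s -> inom i -> exists a, a ε sM X /\ op i a ε s.
Proof.
  intros Hs Hi. destruct (proj1 (proj2 (proj2 Hs)) i Hi) as [a Ha].
  exists a. split; [apply (isfun_dom _ _ _ _ _ Hs Ha)|exact Ha].
Qed.

Lemma asg_upd s i a : asg s -> inom i -> a ε sM X -> asg (upd s i a).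
Proof. intros; apply isfun_upd; assumption. Qed.

Lemma val_ex s t : asg s -> tm L t -> exists a, a ε sM X /\ val s t a.
Proof.
  intros Hs [(i & Hi & E)|(c & Hc & E)].
  - destruct (asg_app s i Hs Hi) as (a & Ha & K). exists a. split; [exact Ha|].
    left; exists i; auto.
  - destruct (sK_fun X) as (_ & _ & H & _). destruct (H c Hc) as [a Ha]. exists a.
    split; [apply (isfun_dom _ _ _ _ _ (sK_fun X) Ha)|]. right; exists c; auto.
Qed.

Lemma val_in s t a : asg s -> val s t a -> a ε sM X.
Proof.
  intros Hs [(i & _ & H)|(c & _ & H)].
  - apply (isfun_dom _ _ _ _ _ Hs H).
  - apply (isfun_dom _ _ _ _ _ (sK_fun X) H).
Qed.

Lemma val_fun s t a b : asg s -> val s t a -> val s t b -> a = b.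
Proof.
  intros (_ & _ & _ & Hs). destruct (sK_fun X) as (_ & _ & _ & HK).
  intros [(i & [_ E] & H)|(c & [_ E] & H)] [(i' & [_ E'] & H')|(c' & [_ E'] & H')];
    subst t; apply op_inj in E'; destruct E' as [E1 E2]; subst.
  - eapply Hs; eassumption.
  - apply num_inj in E1; discriminate.
  - apply num_inj in E1; discriminate.
  - eapply HK; eassumption.
Qed.

Lemma Def_val : Def (fun rho => val (rho 0) (rho 1) (rho 2)).
Proof. unfold val. dfn. Qed.

Lemma vals_fun s n t v v' : asg s -> tup (tm L) n t ->
  tup (fun a => a ε sM X) n v -> tup (fun a => a ε sM X) n v' ->
  vals s n t v -> vals s n t v' -> v = v'.
Proof.
  intros Hs [_ Ht] [_ Hv] [_ Hv'] H H'. apply (isfun_ext v v' _ _ _ Hv Hv').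
  intros i a b Ha Hb. destruct (isfun_dom _ _ _ _ _ Hv Ha) as [Hi _].
  destruct Ht as (_ & _ & Ht & _). destruct (Ht i Hi) as [x Hx].
  apply (val_fun s x); [exact Hs|apply (H i x a)|apply (H' i x b)]; auto.
Qed.

Lemma vals_ex s n t : asg s -> inom n -> tup (tm L) n t ->
  exists v, tup (fun a => a ε sM X) n v /\ vals s n t v.
Proof.
  intros Hs Hn [Hc Ht]. assert (Ht' := Ht). destruct Ht' as (T1 & T2 & T3 & T4).
  assert (HV := Def_val).
  destruct (isfun_graph (fun i => i ε n) (fun a => a ε sM X)
    (fun i a => exists x, op i x ε t /\ val s x a)) as (v & Hv & K).
  - apply isset_in.
  - apply isset_in.
  - apply Def_ex, Def_and; [dfn|].
    apply (Def_app3 val (fun _ => s) (fun rho => rho 0) (fun rho => rho 2)); auto using DT_var, DT_const.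
  - intros i Hi. destruct (T3 i Hi) as [x Hx].
    destruct (val_ex s x Hs) as (a & Ha & Hxa); [apply (isfun_dom _ _ _ _ _ Ht Hx)|].
    exists a; split; [exact Ha|]. exists x; auto.
  - intros i a b _ _ _ (x & Hx & Ha) (y & Hy & Hb).
    rewrite (T4 _ _ _ Hy Hx) in Hb. apply (val_fun s x); assumption.
  - exists v. split; [split; assumption|]. intros i x a (Hi & Hx & Ha).
    apply K in Ha. destruct Ha as (_ & _ & y & Hy & H). rewrite (T4 _ _ _ Hx Hy). exact H.
Qed.

(** Unique readability of codes, together with the uniqueness of the values of terms. *)
Lemma fits_fun s z c c' : asg s -> fits s z c -> fits s z c' -> c = c'.
Proof.
  intros Hs H H'.
  destruct c, c'; simpl in H, H';
    repeat match goal with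
    | H : exists x, _ |- _ => destruct H
    | H : _ /\ _ |- _ => destruct H
    end; subst;
    match goal with E : code _ _ _ = code _ _ _ |- _ => apply code_inj in E; destruct E as (E1 & E2 & E3) end;
    try discriminate; subst; try reflexivity.
  - f_equal; eapply val_fun; eassumption.
  - match goal with
    | H1 : arr _ _ ?n, H2 : arr _ _ ?m |- _ => assert (n = m) by (eapply arr_fun; eassumption); subst
    end.
    f_equal. eapply vals_fun; eassumption.
Qed.

Lemma fits_fm s z c : fits s z c -> fm L z.
Proof.
  destruct (fm_closed L) as (C0 & C1 & C2 & C3 & C4 & C5 & C6 & C7 & C8).
  destruct c; simpl; intros H;
    repeat match goal with
    | H : exists x, _ |- _ => destruct H
    | H : _ /\ _ |- _ => destruct H
    end; subst; auto. eapply C2; eassumption.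
Qed.

Lemma fits_isub s z c p : fits s z c -> isub p c -> fm L p.
Proof.
  destruct c; simpl; intros H K; try tauto; try (destruct K); subst; tauto.
Qed.

Lemma fits_ex z : fm L z -> forall s, asg s -> exists c, fits s z c.
Proof.
  intros Hz s Hs.
  enough (K : z = code 0 empty empty \/ (exists t u, tm L t /\ tm L u /\ z = code 1 t u) \/
    (exists r n t, arr L r n /\ tup (tm L) n t /\ z = code 2 r t) \/
    (exists p, fm L p /\ z = code 3 p empty) \/
    (exists p q, fm L p /\ fm L q /\ (z = code 4 p q \/ z = code 5 p q \/ z = code 6 p q)) \/
    (exists i p, inom i /\ fm L p /\ (z = code 7 i p \/ z = code 8 i p))).
  { destruct K as [K|[(t & u & Ht & Hu & E)|[(r & n & t & Hr & Ht & E)|[(p & K)|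
      [(p & q & Hp & Hq & [E|[E|E]])|(i & p & Hi & Hp & [E|E])]]]]].
    - exists HBot; exact K.
    - destruct (val_ex s t Hs Ht) as (a & _ & Ha). destruct (val_ex s u Hs Hu) as (b & _ & Hb).
      exists (HEq a b), t, u; auto.
    - destruct (vals_ex s n t Hs (arr_inom _ _ _ Hr) Ht) as (v & Hv & K).
      exists (HRel r v), n, t; auto.
    - exists (HNeg p); exact K.
    - exists (HAnd p q); simpl; auto.
    - exists (HOr p q); simpl; auto.
    - exists (HImp p q); simpl; auto.
    - exists (HAll i p); simpl; auto.
    - exists (HEx i p); simpl; auto. }
  revert z Hz. apply fm_ind; [dfn|intros..].
  - left; reflexivity.
  - right; left; exists t, u; auto.
  - do 2 right; left; exists r, n, t; auto.
  - do 3 right; left; exists p; auto.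
  - do 4 right; left; exists p, q. split; [assumption|split; [assumption|left; reflexivity]].
  - do 4 right; left; exists p, q. split; [assumption|split; [assumption|right; left; reflexivity]].
  - do 4 right; left; exists p, q. split; [assumption|split; [assumption|right; right; reflexivity]].
  - do 5 right; exists i, p. split; [assumption|split; [assumption|left; reflexivity]].
  - do 5 right; exists i, p. split; [assumption|split; [assumption|right; reflexivity]].
Qed.

(** A single induction hypothesis about immediate subformulas replaces the nine cases; every later
    induction on formulas has this form. *)
Lemma fm_ind_fits (P : D -> Prop) : Def1 P ->
  (forall z, fm L z -> (forall s c p, asg s -> fits s z c -> isub p c -> P p) -> P z) ->
  forall z, fm L z -> P z.
Proof.
  intros HP IH z Hz.
  destruct (fm_closed L) as (C0 & C1 & C2 & C3 & C4 & C5 & C6 & C7 & C8).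
  assert (K : forall z, fm L z -> (forall s, asg s -> exists c, fits s z c /\
    forall p, isub p c -> P p) -> P z).
  { intros x Hx H. apply IH; [exact Hx|]. intros s c p Hs Hf Hp.
    destruct (H s Hs) as (c' & Hf' & H'). apply H'.
    rewrite (fits_fun s x c' c Hs Hf' Hf). exact Hp. }
  revert z Hz. apply fm_ind; intros; [exact HP|apply K..]; auto; try (intros s Hs).
  - exists HBot. split; [reflexivity|intros ? []].
  - destruct (val_ex s t Hs) as (a & _ & Ha); [assumption|].
    destruct (val_ex s u Hs) as (b & _ & Hb); [assumption|].
    exists (HEq a b). split; [exists t, u; auto|intros ? []].
  - eapply C2; eassumption.
  - destruct (vals_ex s n t Hs) as (v & Hv & Hw); [eapply arr_inom; eassumption|assumption|].
    exists (HRel r v). split; [exists n, t; auto|intros ? []].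
  - exists (HNeg p). split; [split; [assumption|reflexivity]|intros ? ->; assumption].
  - exists (HAnd p q). split; [simpl; auto|intros ? [-> | ->]; assumption].
  - exists (HOr p q). split; [simpl; auto|intros ? [-> | ->]; assumption].
  - exists (HImp p q). split; [simpl; auto|intros ? [-> | ->]; assumption].
  - exists (HAll i p). split; [simpl; auto|intros ? ->; assumption].
  - exists (HEx i p). split; [simpl; auto|intros ? ->; assumption].
Qed.

End Structures.

Ltac dfn_structures :=
  match goal with
  | |- DT (fun rho => upd _ _ _) => apply (DT_app3 upd _ _ _ DT_upd)
  | |- Def (fun rho => val _ _ _ _ _) => unfold val
  | |- Def (fun rho => vals _ _ _ _ _ _) => unfold vals
  | |- Def (fun rho => asg ?L ?X _) => apply (Def_app1 (asg L X) _ (isset_Def _ (isset_asg L X)))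
  end.
Ltac dfn_ext ::= first [dfn_sets | dfn_syntax | dfn_structures].

(** * Satisfaction *)

Section Satisfaction.
Context {W : tfmodel} {HW : pzfc_model W}.
Local Notation D := (dom W).
Context (L : voc W) (X : str L) (I : interp (W := W)).

(** A clause consults T and F at immediate subformulas only, and the updates in the quantifier
    clauses are again assignments. *)
Lemma val_cong (T F T' F' : D -> D -> Prop) s z c : asg L X s -> fits L X s z c ->
  (forall p s, isub p c -> asg L X s -> (T p s <-> T' p s) /\ (F p s <-> F' p s)) ->
  (tval L X I T F s c <-> tval L X I T' F' s c) /\ (fval L X I T F s c <-> fval L X I T' F' s c).
Proof.
  intros Hs Hf H.
  destruct c; simpl in *; try tauto.
  - destruct (H p s eq_refl Hs). tauto.
  - destruct (H p s (or_introl eq_refl) Hs), (H q s (or_intror eq_refl) Hs). tauto.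
  - destruct (H p s (or_introl eq_refl) Hs), (H q s (or_intror eq_refl) Hs). tauto.
  - destruct (H p s (or_introl eq_refl) Hs), (H q s (or_intror eq_refl) Hs). tauto.
  - assert (K : forall a, a ε sM L X -> asg L X (upd s i a)) by (intros; apply asg_upd; tauto).
    split; split; try (intros J a Ha; apply (H p _ eq_refl (K a Ha)), J, Ha);
      intros (a & Ha & J); exists a; (split; [exact Ha|]); apply (H p _ eq_refl (K a Ha)), J.
  - assert (K : forall a, a ε sM L X -> asg L X (upd s i a)) by (intros; apply asg_upd; tauto).
    split; split; try (intros J a Ha; apply (H p _ eq_refl (K a Ha)), J, Ha);
      intros (a & Ha & J); exists a; (split; [exact Ha|]); apply (H p _ eq_refl (K a Ha)), J.
Qed.

Definition iconsistent : Prop :=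
  (forall a b, a ε sM L X -> b ε sM L X -> ~ (EP I a b /\ EN I a b)) /\
  (forall r n v, arr L r n -> tup (fun a => a ε sM L X) n v -> ~ (PP I r v /\ NN I r v)).
Definition icomplete : Prop :=
  (forall a b, a ε sM L X -> b ε sM L X -> EP I a b \/ EN I a b) /\
  (forall r n v, arr L r n -> tup (fun a => a ε sM L X) n v -> PP I r v \/ NN I r v).

(** Gluts come from atoms only: a compound formula that is both true and false passes this on to an
    immediate subformula. For p → q it is q that becomes a glut. *)
Lemma Sat_consistent (T F : D -> D -> Prop) : Def2 T -> Def2 F -> Sat L X I T F ->
  iconsistent -> forall z, fm L z -> forall s, asg L X s -> ~ (T z s /\ F z s).
Proof.
  intros HT HF HS [C1 C2]. refine (fm_ind_fits L X _ _ _); [dfn|].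
  intros z Hz IH s Hs. destruct (fits_ex L X z Hz s Hs) as [c Hc].
  destruct (HS s z c Hs Hc) as [-> ->].
  assert (IH' := fun p H => IH s c p Hs Hc H). clear IH.
  destruct c; simpl in *.
  - tauto.
  - destruct Hc as (t & u & _ & _ & _ & Ha & Hb). apply C1; eapply val_in; eassumption.
  - destruct Hc as (n & t & Hr & _ & _ & Hv & _). eapply C2; eassumption.
  - specialize (IH' p eq_refl s Hs). tauto.
  - assert (H1 := IH' p (or_introl eq_refl) s Hs). assert (H2 := IH' q (or_intror eq_refl) s Hs).
    tauto.
  - assert (H1 := IH' p (or_introl eq_refl) s Hs). assert (H2 := IH' q (or_intror eq_refl) s Hs).
    tauto.
  - assert (H1 := IH' p (or_introl eq_refl) s Hs). assert (H2 := IH' q (or_intror eq_refl) s Hs).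
    tauto.
  - intros [K (a & Ha & J)]. apply (IH' p eq_refl (upd s i a)); [apply asg_upd; tauto|auto].
  - intros [(a & Ha & J) K]. apply (IH' p eq_refl (upd s i a)); [apply asg_upd; tauto|auto].
Qed.

(** Dually, gaps come from atoms only; here → and the quantifiers use excluded middle for the truth
    and falsity of their parts. *)
Lemma Sat_complete (T F : D -> D -> Prop) : Def2 T -> Def2 F -> Sat L X I T F ->
  icomplete -> forall z, fm L z -> forall s, asg L X s -> T z s \/ F z s.
Proof.
  intros HT HF HS [C1 C2]. refine (fm_ind_fits L X _ _ _); [dfn|].
  intros z Hz IH s Hs. destruct (fits_ex L X z Hz s Hs) as [c Hc].
  destruct (HS s z c Hs Hc) as [-> ->].
  assert (IH' := fun p H => IH s c p Hs Hc H). clear IH.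
  destruct c; simpl in *.
  - tauto.
  - destruct Hc as (t & u & _ & _ & _ & Ha & Hb). apply C1; eapply val_in; eassumption.
  - destruct Hc as (n & t & Hr & _ & _ & Hv & _). eapply C2; eassumption.
  - specialize (IH' p eq_refl s Hs). tauto.
  - assert (H1 := IH' p (or_introl eq_refl) s Hs). assert (H2 := IH' q (or_intror eq_refl) s Hs).
    tauto.
  - assert (H1 := IH' p (or_introl eq_refl) s Hs). assert (H2 := IH' q (or_intror eq_refl) s Hs).
    tauto.
  - assert (H1 := IH' p (or_introl eq_refl) s Hs). assert (H2 := IH' q (or_intror eq_refl) s Hs).
    tauto.
  - destruct (classic (exists a, a ε sM L X /\ F p (upd s i a))) as [K|K]; [tauto|left].
    intros a Ha. destruct (IH' p eq_refl (upd s i a)) as [J|J]; [apply asg_upd; tauto|exact J|].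
    destruct K; exists a; auto.
  - destruct (classic (exists a, a ε sM L X /\ T p (upd s i a))) as [K|K]; [tauto|right].
    intros a Ha. destruct (IH' p eq_refl (upd s i a)) as [J|J]; [apply asg_upd; tauto| |exact J].
    destruct K; exists a; auto.
Qed.

(** Shapes are not elements of the model, so this is no first-order quantifier; it unfolds into a
    disjunction of nine blocks of quantifiers over arguments. *)
Lemma Def_exshape (Phi : (nat -> D) -> dshape D -> Prop) :
  Def (fun rho => Phi rho HBot) ->
  Def (fun rho => exists a b, Phi rho (HEq a b)) ->
  Def (fun rho => exists r v, Phi rho (HRel r v)) ->
  Def (fun rho => exists p, Phi rho (HNeg p)) ->
  Def (fun rho => exists p q, Phi rho (HAnd p q)) ->
  Def (fun rho => exists p q, Phi rho (HOr p q)) ->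
  Def (fun rho => exists p q, Phi rho (HImp p q)) ->
  Def (fun rho => exists i p, Phi rho (HAll i p)) ->
  Def (fun rho => exists i p, Phi rho (HEx i p)) ->
  Def (fun rho => exists c, Phi rho c).
Proof.
  intros.
  apply (Def_iff _ (fun rho => Phi rho HBot \/ (exists a b, Phi rho (HEq a b)) \/
    (exists r v, Phi rho (HRel r v)) \/ (exists p, Phi rho (HNeg p)) \/
    (exists p q, Phi rho (HAnd p q)) \/ (exists p q, Phi rho (HOr p q)) \/
    (exists p q, Phi rho (HImp p q)) \/ (exists i p, Phi rho (HAll i p)) \/
    (exists i p, Phi rho (HEx i p)))).
  - intros rho. split.
    + intros [[] Hc]; eauto 15.
    + intros K. repeat destruct K as [K|K]; repeat destruct K as [? K]; eauto.
  - repeat apply Def_or; assumption.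
Qed.

(** Existence of a satisfaction relation: the recursion is carried out by sets
    of triples (z,(A,B)), where A and B are the sets of assignments making z
    true and false, in which each triple is justified by others. *)
Section Recursion.
Context (HEP : Def2 (EP I)) (HEN : Def2 (EN I)) (HPP : Def2 (PP I)) (HNN : Def2 (NN I)).

Definition gT (g p s : D) : Prop := exists A B, op p (op A B) ε g /\ s ε A.
Definition gF (g p s : D) : Prop := exists A B, op p (op A B) ε g /\ s ε B.
(** Entries are demanded for all immediate subformulas: [gT] and [gF] read a missing entry as
    neither true nor false, which would spoil uniqueness. *)
Definition rjust (g z A B s : D) : Prop :=
  exists c, fits L X s z c /\ (forall p, isub p c -> exists A B, op p (op A B) ε g) /\
    (s ε A <-> tval L X I (gT g) (gF g) s c) /\ (s ε B <-> fval L X I (gT g) (gF g) s c).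
Definition rgood (g : D) : Prop :=
  forall y, y ε g -> exists z A B, y = op z (op A B) /\ fm L z /\
    (cl A /\ forall s, s ε A -> asg L X s) /\ (cl B /\ forall s, s ε B -> asg L X s) /\
    forall s, asg L X s -> rjust g z A B s.
Definition rval (z A B : D) : Prop := exists g, rgood g /\ op z (op A B) ε g.

Lemma Def_rgood : Def1 rgood.
Proof.
  unfold rgood.
  apply Def_all, Def_imp; [dfn|]. do 3 apply Def_ex.
  repeat (apply Def_and; [dfn|]). apply Def_all, Def_imp; [dfn|].
  unfold rjust. apply Def_exshape; simpl; unfold gT, gF; dfn.
Qed.

Lemma Def_rval : Def (fun rho => rval (rho 0) (rho 1) (rho 2)).
Proof. assert (H := Def_rgood). unfold rval. dfn. Qed.

Lemma rval_in g p A B : rgood g -> op p (op A B) ε g -> rval p A B.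
Proof. intros H K; exists g; auto. Qed.

Lemma rgood_inv g z A B : rgood g -> op z (op A B) ε g -> fm L z /\
    (cl A /\ forall s, s ε A -> asg L X s) /\ (cl B /\ forall s, s ε B -> asg L X s) /\
    forall s, asg L X s -> rjust g z A B s.
Proof.
  intros H K. destruct (H _ K) as (z' & A' & B' & E & R).
  apply op_inj in E. destruct E as [<- E]. apply op_inj in E. destruct E as [<- <-]. exact R.
Qed.

(** By induction the two derivations agree on the immediate subformulas, and the clauses then
    determine A and B. *)
Lemma rval_unique z : fm L z -> forall A B A' B', rval z A B -> rval z A' B' -> A = A' /\ B = B'.
Proof.
  assert (HR := Def_rval). revert z. refine (fm_ind_fits L X _ _ _).
  { repeat (apply Def_all || apply Def_imp); try dfn; apply (Def_app3 rval); auto using DT_var. }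
  intros z Hz IH A B A' B' (g & Hg & K) (g' & Hg' & K').
  destruct (rgood_inv g z A B Hg K) as (_ & [HA HA'] & [HB HB'] & J).
  destruct (rgood_inv g' z A' B' Hg' K') as (_ & [GA GA'] & [GB GB'] & J').
  assert (E : forall s, asg L X s -> (s ε A <-> s ε A') /\ (s ε B <-> s ε B')).
  { intros s Hs. destruct (J s Hs) as (c & Hc & Hsub & -> & ->).
    destruct (J' s Hs) as (c' & Hc' & Hsub' & -> & ->).
    rewrite <- (fits_fun L X s z c c' Hs Hc Hc') in *.
    apply (val_cong _ _ _ _ s z c Hs Hc).
    intros p s' Hp Hs'.
    destruct (Hsub p Hp) as (A1 & B1 & H1). destruct (Hsub' p Hp) as (A2 & B2 & H2).
    assert (V : forall A B A' B', rval p A B -> rval p A' B' -> A = A' /\ B = B')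
      by exact (IH s c p Hs Hc Hp).
    assert (V1 := rval_in _ _ _ _ Hg H1). assert (V2 := rval_in _ _ _ _ Hg' H2).
    destruct (V _ _ _ _ V1 V2); subst A2 B2.
    split; split; intros (A3 & B3 & H3 & M); exists A1, B1; (split; [assumption|]);
      match type of H3 with
      | _ ε g => destruct (V _ _ _ _ V1 (rval_in _ _ _ _ Hg H3)); subst; exact M
      | _ ε g' => destruct (V _ _ _ _ V2 (rval_in _ _ _ _ Hg' H3)); subst; exact M
      end. }
  split; apply cl_eq; auto; intros s; split; intros H;
    apply (E s); auto.
Qed.

Lemma rval_fm z A B : rval z A B -> fm L z.
Proof. intros (g & Hg & K). eapply rgood_inv; eassumption. Qed.

Definition rgraphP (y : D) : Prop := exists z A B, y = op z (op A B) /\ rval z A B.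
Definition rgraph : D := setof rgraphP.

Lemma isset_rgraphP : isset rgraphP.
Proof.
  assert (HR := Def_rval).
  eapply isset_sep; [| apply (isset_prod _ _ (isset_fm L)
    (isset_prod _ _ (isset_pow _ (isset_asg L X)) (isset_pow _ (isset_asg L X)))) |].
  - unfold rgraphP. do 3 apply Def_ex. apply Def_and; [dfn|].
    apply (Def_app3 rval); auto using DT_var.
  - intros y (z & A & B & -> & H). assert (H' := H). destruct H' as (g & Hg & K).
    destruct (rgood_inv g z A B Hg K) as (Hz & HA & HB & _).
    exists z, (op A B). split; [exact Hz|]. split; [|reflexivity]. exists A, B; auto.
Qed.

Lemma in_rgraph z A B : op z (op A B) ε rgraph <-> rval z A B.
Proof.
  unfold rgraph. rewrite (in_setof _ _ isset_rgraphP). split.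
  - intros (z' & A' & B' & E & H). apply op_inj in E. destruct E as [<- E].
    apply op_inj in E. destruct E as [<- <-]. exact H.
  - intros H. exists z, A, B; auto.
Qed.

Lemma gT_eq g p s A B : (forall A' B', op p (op A' B') ε g -> rval p A' B') ->
  op p (op A B) ε g -> (gT g p s <-> s ε A) /\ (gF g p s <-> s ε B).
Proof.
  intros H K. assert (V := H _ _ K).
  split; split; try (intros M; exists A, B; auto);
    intros (A' & B' & K' & M); destruct (rval_unique p (rval_fm _ _ _ V) _ _ _ _ V (H _ _ K'));
    subst; exact M.
Qed.

(** Enlarging g keeps a justification intact, since further entries for a subformula are values too
    and by uniqueness equal to the old one. *)
Lemma rjust_mono g h z A B s : asg L X s ->
  (forall p A B, op p (op A B) ε g -> op p (op A B) ε h) ->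
  (forall p A B, op p (op A B) ε g -> forall A' B', op p (op A' B') ε h -> rval p A' B') ->
  rjust g z A B s -> rjust h z A B s.
Proof.
  intros Hs H1 H2 (c & Hc & Hsub & EA & EB). exists c. split; [exact Hc|].
  assert (V : forall p s', isub p c -> asg L X s' ->
    (gT g p s' <-> gT h p s') /\ (gF g p s' <-> gF h p s')).
  { intros p s' Hp _. destruct (Hsub p Hp) as (A1 & B1 & K).
    destruct (gT_eq h p s' A1 B1 (H2 p A1 B1 K) (H1 _ _ _ K)) as [-> ->].
    apply (gT_eq g p s' A1 B1); [|exact K].
    intros A' B' K'. apply (H2 p A1 B1 K), H1, K'. }
  split; [|rewrite EA, EB; apply (val_cong _ _ _ _ s z c Hs Hc V)].
  intros p Hp. destruct (Hsub p Hp) as (A1 & B1 & K). exists A1, B1. apply H1, K.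
Qed.

Lemma rgood_rgraph : rgood rgraph.
Proof.
  intros y Hy. apply (in_setof _ _ isset_rgraphP) in Hy.
  destruct Hy as (z & A & B & -> & g & Hg & K).
  destruct (rgood_inv g z A B Hg K) as (Hz & HA & HB & J).
  exists z, A, B. split; [reflexivity|]. split; [exact Hz|]. split; [exact HA|]. split; [exact HB|].
  intros s Hs. apply (rjust_mono g); auto.
  - intros p A' B' H. apply in_rgraph. exists g; auto.
  - intros p A' B' _ A'' B'' H. apply in_rgraph, H.
Qed.

Lemma Def_gT g : Def2 (gT g) /\ Def2 (gF g).
Proof. unfold gT, gF; split; dfn. Qed.

Lemma rval_ex z : fm L z -> exists A B, rval z A B.
Proof.
  assert (HR := Def_rval). revert z. refine (fm_ind_fits L X _ _ _).
  { do 2 apply Def_ex. apply (Def_app3 rval); auto using DT_var. }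
  (* If z has no value yet, the triple added to the graph cannot clash with an entry of a formula
     that has one. *)
  intros z Hz IH. apply NNPP. intros N.
  assert (N' : forall A B, ~ rval z A B) by (intros A B H; apply N; exists A, B; exact H).
  clear N.
  set (PA := fun s => asg L X s /\ exists c, fits L X s z c /\ tval L X I (gT rgraph) (gF rgraph) s c).
  set (PB := fun s => asg L X s /\ exists c, fits L X s z c /\ fval L X I (gT rgraph) (gF rgraph) s c).
  destruct (Def_gT rgraph) as [DT DF].
  assert (HA : isset PA).
  { apply (isset_sep _ (asg L X)); [|apply isset_asg|unfold PA; tauto].
    unfold PA. apply Def_and; [dfn|]. apply Def_exshape; simpl; dfn. }
  assert (HB : isset PB).
  { apply (isset_sep _ (asg L X)); [|apply isset_asg|unfold PB; tauto].
    unfold PB. apply Def_and; [dfn|]. apply Def_exshape; simpl; dfn. }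
  assert (Hg : isset (fun y => y ε rgraph \/ y = op z (op (setof PA) (setof PB))))
    by (apply isset_union; [apply isset_in|apply isset_sing]).
  set (g := setof (fun y => y ε rgraph \/ y = op z (op (setof PA) (setof PB)))).
  assert (Ig : forall y, y ε g <-> y ε rgraph \/ y = op z (op (setof PA) (setof PB)))
    by (intros; apply (in_setof _ _ Hg)).
  assert (Old : forall p A B, rval p A B -> forall A' B', op p (op A' B') ε g -> rval p A' B').
  { intros p A B V A' B' K. apply Ig in K. destruct K as [K|K]; [apply in_rgraph, K|].
    apply op_inj in K. destruct K; subst. destruct (N' A B V). }
  apply (N' (setof PA) (setof PB)). exists g. split; [|apply Ig; auto].
  intros y Hy. apply Ig in Hy. destruct Hy as [Hy|E].
  - destruct (rgood_rgraph y Hy) as (z1 & A & B & E & Hz1 & KA & KB & J).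
    exists z1, A, B. repeat (split; [assumption|]).
    intros s Hs. apply (rjust_mono rgraph); auto.
    + intros p A1 B1 K. apply Ig; auto.
    + intros p A1 B1 K. apply (Old p A1 B1), in_rgraph, K.
  - exists z, (setof PA), (setof PB). split; [exact E|]. split; [exact Hz|].
    split; [split; [apply cl_setof, HA|intros s K; apply (in_setof _ _ HA) in K; apply K]|].
    split; [split; [apply cl_setof, HB|intros s K; apply (in_setof _ _ HB) in K; apply K]|].
    intros s Hs. apply (rjust_mono rgraph); auto.
    + intros p A1 B1 K. apply Ig; auto.
    + intros p A1 B1 K. apply (Old p A1 B1), in_rgraph, K.
    + destruct (fits_ex L X z Hz s Hs) as [c Hc]. exists c. split; [exact Hc|].
      split; [|split].
      * intros p Hp. destruct (IH s c p Hs Hc Hp) as (A & B & V). exists A, B. apply in_rgraph, V.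
      * rewrite (in_setof _ _ HA). unfold PA. split; [|intros K; split; [exact Hs|exists c; auto]].
        intros [_ (c' & Hc' & K)]. rewrite (fits_fun L X s z c c' Hs Hc Hc'). exact K.
      * rewrite (in_setof _ _ HB). unfold PB. split; [|intros K; split; [exact Hs|exists c; auto]].
        intros [_ (c' & Hc' & K)]. rewrite (fits_fun L X s z c c' Hs Hc Hc'). exact K.
Qed.

Lemma Sat_ex : exists T F, Def2 T /\ Def2 F /\ Sat L X I T F.
Proof.
  exists (gT rgraph), (gF rgraph). destruct (Def_gT rgraph) as [DT DF].
  split; [exact DT|]. split; [exact DF|]. intros s z c Hs Hc.
  destruct (rval_ex z (fits_fm _ _ _ _ _ Hc)) as (A & B & V). apply in_rgraph in V.
  destruct (gT_eq rgraph z s A B (fun A' B' => proj1 (in_rgraph z A' B')) V) as [-> ->].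
  destruct (rgood_inv rgraph z A B rgood_rgraph V) as (_ & _ & _ & J).
  destruct (J s Hs) as (c' & Hc' & _ & K).
  rewrite (fits_fun L X s z c c' Hs Hc Hc'). exact K.
Qed.

End Recursion.
End Satisfaction.

(** * Isomorphic structures *)

Section Isomorphism.
Context {W : tfmodel} {HW : pzfc_model W}.
Local Notation D := (dom W).
Context (L : voc W) (X X' : str L) (I I' : interp (W := W)) (H : D -> D -> Prop).
Local Notation M := (sM L X).
Local Notation M' := (sM L X').

(** H acts on the values of a function and fixes its arguments; the same relation serves for
    assignments, tuples and the interpretation of constants. *)
Definition sim (s s' : D) : Prop := forall i a a', H a a' -> (op i a ε s <-> op i a' ε s').

Record iso : Prop := Iso {
  iso_Def : Def2 H;
  iso_in : forall a a', H a a' -> a ε M /\ a' ε M';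
  iso_tot : forall a, a ε M -> exists a', H a a';
  iso_surj : forall a', a' ε M' -> exists a, H a a';
  iso_fun : forall a a' b', H a a' -> H a b' -> a' = b';
  iso_inj : forall a b a', H a a' -> H b a' -> a = b;
  iso_K : sim (sK L X) (sK L X');
  iso_EP : forall a b a' b', H a a' -> H b b' -> (EP I a b <-> EP I' a' b');
  iso_EN : forall a b a' b', H a a' -> H b b' -> (EN I a b <-> EN I' a' b');
  iso_PP : forall r n v v', arr L r n -> tup (fun a => a ε M) n v ->
    tup (fun a => a ε M') n v' -> sim v v' -> (PP I r v <-> PP I' r v');
  iso_NN : forall r n v v', arr L r n -> tup (fun a => a ε M) n v ->
    tup (fun a => a ε M') n v' -> sim v v' -> (NN I r v <-> NN I' r v')
}.

Context (HI : iso).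

Lemma sim_ex (P : D -> Prop) s' : isset P -> isfun s' P (fun a => a ε M') ->
  exists s, isfun s P (fun a => a ε M) /\ sim s s'.
Proof.
  intros HP Hs'. assert (HD := iso_Def HI). assert (Hs := Hs').
  destruct Hs as (S1 & S2 & S3 & S4).
  destruct (isfun_graph P (fun a => a ε M) (fun i a => exists a', H a a' /\ op i a' ε s'))
    as (s & Hs & K).
  - exact HP.
  - apply isset_in.
  - dfn.
  - intros i Hi. destruct (S3 i Hi) as [a' Ha'].
    destruct (isfun_dom _ _ _ _ _ Hs' Ha') as [_ Hm].
    destruct (iso_surj HI a' Hm) as [a Ha]. exists a.
    split; [apply (iso_in HI _ _ Ha)|]. exists a'; auto.
  - intros i a b _ _ _ (a' & Ha & Ka) (b' & Hb & Kb).
    rewrite (S4 _ _ _ Ka Kb) in Ha. exact (iso_inj HI _ _ _ Ha Hb).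
  - exists s. split; [exact Hs|]. intros i a a' Ha. rewrite K. split.
    + intros (_ & _ & b' & Hb & Kb). rewrite (iso_fun HI _ _ _ Ha Hb). exact Kb.
    + intros Ka. split; [apply (isfun_dom _ _ _ _ _ Hs' Ka)|].
      split; [apply (iso_in HI _ _ Ha)|]. exists a'; auto.
Qed.

Lemma sim_unique (P : D -> Prop) s t s' : isfun s P (fun a => a ε M) ->
  isfun t P (fun a => a ε M) -> sim s s' -> sim t s' -> s = t.
Proof.
  intros Hs Ht Ss St. apply (isfun_ext s t _ _ _ Hs Ht). intros x a b Ka Kb.
  destruct (isfun_dom _ _ _ _ _ Hs Ka) as [_ Ha].
  destruct (iso_tot HI a Ha) as [a' Haa]. apply (Ss x a a' Haa), (St x a a' Haa) in Ka.
  destruct Ht as (_ & _ & _ & F). eapply F; eassumption.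
Qed.

Lemma sim_upd s s' i a a' : sim s s' -> H a a' -> sim (upd s i a) (upd s' i a').
Proof.
  intros Hs Ha j b b' Hb. rewrite !in_upd, (Hs j b b' Hb).
  assert (E : b = a <-> b' = a').
  { split; intros ->; [exact (iso_fun HI _ _ _ Hb Ha)|exact (iso_inj HI _ _ _ Hb Ha)]. }
  tauto.
Qed.

Lemma val_sim s s' t a a' : sim s s' -> H a a' ->
  (val L X s t a <-> val L X' s' t a').
Proof.
  intros Hs Ha. unfold val. assert (HK := iso_K HI).
  split; (intros [(i & Hi & K)|(c & Hc & K)]; [left; exists i|right; exists c]);
    (split; [assumption|]); first [apply (Hs _ a a' Ha), K|apply (HK _ a a' Ha), K].
Qed.

Definition transport (T : D -> D -> Prop) (z s' : D) : Prop :=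
  exists s, asg L X s /\ sim s s' /\ T z s.

Lemma transport_eq T z s s' : asg L X s -> sim s s' -> (transport T z s' <-> T z s).
Proof.
  intros Hs S. split; [|intros K; exists s; auto].
  intros (t & Ht & St & K). rewrite (sim_unique _ s t s' Hs Ht S St). exact K.
Qed.

Lemma Def_transport T : Def2 T -> Def2 (transport T).
Proof. intros HT. assert (HD := iso_Def HI). unfold transport, sim. dfn. Qed.

(** A shape over X' is pulled back along H to the shape of the same formula over X, where the clause
    is known. In the quantifier cases, updates by a match updates by a'. *)
Lemma Sat_transport T F : Sat L X I T F -> Sat L X' I' (transport T) (transport F).
Proof.
  intros HS s' z c' Hs' Hc'.
  destruct (sim_ex inom s' isset_inom Hs') as (s & Hs & S).
  assert (TE : forall Y p, transport Y p s' <-> Y p s) by (intros; apply transport_eq; assumption).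
  assert (U : forall i p, inom i -> forall a a', H a a' -> forall Y,
    transport Y p (upd s' i a') <-> Y p (upd s i a)).
  { intros i p Hi a a' Ha Y. apply transport_eq; [|apply sim_upd; assumption].
    apply asg_upd; [exact Hs|exact Hi|apply (iso_in HI _ _ Ha)]. }
  rewrite !TE. destruct c' as [|a' b'|r v'|p|p q|p q|p q|i p|i p].
  - apply (HS s z HBot Hs Hc').
  - destruct Hc' as (t & u & Ht & Hu & E & Ha' & Hb').
    destruct (iso_surj HI a' (val_in L X' _ _ _ Hs' Ha')) as [a Ha].
    destruct (iso_surj HI b' (val_in L X' _ _ _ Hs' Hb')) as [b Hb].
    simpl. rewrite <- (iso_EP HI a b a' b' Ha Hb), <- (iso_EN HI a b a' b' Ha Hb).
    apply (HS s z (HEq a b) Hs). exists t, u. repeat (split; [assumption|]).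
    split; [apply (val_sim s s' t a a' S Ha), Ha'|apply (val_sim s s' u b b' S Hb), Hb'].
  - destruct Hc' as (n & t & Hr & Ht & E & Hv' & K).
    destruct (sim_ex (fun i => i ε n) v' (isset_in n) (proj2 Hv')) as (v & Hv & Sv).
    assert (Hv2 : tup (fun a => a ε M) n v) by (split; [apply Hv'|exact Hv]).
    simpl. rewrite <- (iso_PP HI r n v v' Hr Hv2 Hv' Sv), <- (iso_NN HI r n v v' Hr Hv2 Hv' Sv).
    apply (HS s z (HRel r v) Hs). exists n, t. repeat (split; [assumption|]).
    intros i x a (Hi & Hx & Ha).
    destruct (isfun_dom _ _ _ _ _ Hv Ha) as [_ Hm]. destruct (iso_tot HI a Hm) as [a' Haa].
    apply (val_sim s s' x a a' S Haa). apply (K i x a').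
    repeat (split; [assumption|]). apply (Sv i a a' Haa), Ha.
  - simpl. rewrite !TE. apply (HS s z (HNeg p) Hs Hc').
  - simpl. rewrite !TE. apply (HS s z (HAnd p q) Hs Hc').
  - simpl. rewrite !TE. apply (HS s z (HOr p q) Hs Hc').
  - simpl. rewrite !TE. apply (HS s z (HImp p q) Hs Hc').
  - specialize (U i p (proj1 Hc')).
    destruct (HS s z (HAll i p) Hs Hc') as [-> ->]. simpl. split; split.
    + intros K a' Ha'. destruct (iso_surj HI a' Ha') as [a Ha].
      apply (U a a' Ha), K, (iso_in HI _ _ Ha).
    + intros K a Ha. destruct (iso_tot HI a Ha) as [a' Haa].
      apply (U a a' Haa), K, (iso_in HI _ _ Haa).
    + intros (a & Ha & K). destruct (iso_tot HI a Ha) as [a' Haa]. exists a'.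
      split; [apply (iso_in HI _ _ Haa)|apply (U a a' Haa), K].
    + intros (a' & Ha' & K). destruct (iso_surj HI a' Ha') as [a Ha]. exists a.
      split; [apply (iso_in HI _ _ Ha)|apply (U a a' Ha), K].
  - specialize (U i p (proj1 Hc')).
    destruct (HS s z (HEx i p) Hs Hc') as [-> ->]. simpl. split; split.
    + intros (a & Ha & K). destruct (iso_tot HI a Ha) as [a' Haa]. exists a'.
      split; [apply (iso_in HI _ _ Haa)|apply (U a a' Haa), K].
    + intros (a' & Ha' & K). destruct (iso_surj HI a' Ha') as [a Ha]. exists a.
      split; [apply (iso_in HI _ _ Ha)|apply (U a a' Ha), K].
    + intros K a' Ha'. destruct (iso_surj HI a' Ha') as [a Ha].
      apply (U a a' Ha), K, (iso_in HI _ _ Ha).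
    + intros K a Ha. destruct (iso_tot HI a Ha) as [a' Haa].
      apply (U a a' Haa), K, (iso_in HI _ _ Haa).
Qed.

Lemma aholds_iso p : aholds L X I p -> aholds L X' I' p.
Proof.
  intros (T & F & HT & HF & HS & K).
  exists (transport T), (transport F). split; [apply Def_transport, HT|].
  split; [apply Def_transport, HF|]. split; [apply Sat_transport, HS|].
  intros s' Hs'. destruct (sim_ex inom s' isset_inom Hs') as (s & Hs & S).
  apply (transport_eq T p s s' Hs S), K, Hs.
Qed.

End Isomorphism.

Lemma iso_sym {W : tfmodel} {HW : pzfc_model W} (L : voc W) X X' I I' H :
  iso L X X' I I' H -> iso L X' X I' I (fun a b => H b a).
Proof.
  intros HI.
  assert (S : forall s s', sim (fun a b => H b a) s s' -> sim H s' s)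
    by (intros s s' K i a a' Ha; symmetry; apply K, Ha).
  constructor.
  - assert (HD := iso_Def _ _ _ _ _ _ HI). dfn.
  - intros a a' Ha. destruct (iso_in _ _ _ _ _ _ HI _ _ Ha); auto.
  - apply (iso_surj _ _ _ _ _ _ HI).
  - apply (iso_tot _ _ _ _ _ _ HI).
  - intros a a' b' Ha Hb. exact (iso_inj _ _ _ _ _ _ HI _ _ _ Ha Hb).
  - intros a b a' Ha Hb. exact (iso_fun _ _ _ _ _ _ HI _ _ _ Ha Hb).
  - intros i a a' Ha. symmetry. apply (iso_K _ _ _ _ _ _ HI), Ha.
  - intros a b a' b' Ha Hb. symmetry. apply (iso_EP _ _ _ _ _ _ HI); assumption.
  - intros a b a' b' Ha Hb. symmetry. apply (iso_EN _ _ _ _ _ _ HI); assumption.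
  - intros r n v v' Hr Hv Hv' K. symmetry. apply (iso_PP _ _ _ _ _ _ HI r n); auto.
  - intros r n v v' Hr Hv Hv' K. symmetry. apply (iso_NN _ _ _ _ _ _ HI r n); auto.
Qed.

(** * Tarski models and T/F-models *)

Section Models.
Context {W : tfmodel} {HW : pzfc_model W}.
Local Notation D := (dom W).

Definition Glut : Prop := exists x z : D, z ε x /\ out z x.
Definition Gap : Prop := exists x z : D, ~ z ε x /\ ~ out z x.

(** The condition z ∈ g does not involve y. So a single glut turns any classical A into a set x with
    x^! = A and x^? empty, and a single gap into one with x^! empty and x^? = A. *)
Lemma isset2_restrict (A : D -> Prop) (g z : D) : isset A ->
  isset2 (fun y => A y /\ z ε g) (fun y => A y /\ ~ out z g).
Proof.
  (* Index 0 is the element y, index 1 is z and index 2 is g. *)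
  intros HA. destruct (comprehension (Mem 1 2) (scons z (fun _ => g)) (setof A)) as [x Hx].
  exists x. intros y. specialize (Hx y). simpl in Hx.
  rewrite (in_setof A y HA), (out_setof A y HA) in Hx. tauto.
Qed.

(** Unions act separately on the two extensions, and (A, B) is the union of (A, ∅), (A ∩ B, A ∩ B)
    and (∅, B). The first part takes a glut and the last a gap, unless the middle part already
    suffices. *)
Lemma isset2_mk (A B : D -> Prop) : isset A -> isset B ->
  (Glut \/ forall y, A y -> B y) -> (Gap \/ forall y, B y -> A y) -> isset2 A B.
Proof.
  intros HA HB HG HP.
  assert (K1 : isset (fun y => A y /\ B y)).
  { apply (isset_sep _ A); [|exact HA|tauto]. apply isset_Def in HB. dfn. }
  assert (K2 : isset2 A (fun y => A y /\ B y)).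
  { destruct HG as [(g & z & G)|E].
    - eapply isset2_iff; [| |apply (isset2_union _ _ _ _ (isset2_restrict A g z HA) K1)];
        intros y; simpl; tauto.
    - eapply isset2_iff; [| |exact K1]; intros y; specialize (E y); tauto. }
  assert (K3 : isset2 (fun y => A y /\ B y) B).
  { destruct HP as [(g & z & G)|E].
    - eapply isset2_iff; [| |apply (isset2_union _ _ _ _ (isset2_restrict B g z HB) K1)];
        intros y; simpl; tauto.
    - eapply isset2_iff; [| |exact K1]; intros y; specialize (E y); tauto. }
  eapply isset2_iff; [| |exact (isset2_union _ _ _ _ K2 K3)]; intros y; simpl; tauto.
Qed.

(** If z is in a, it is not out of b, and without gaps it is then in b; likewise for being out. *)
Lemma noGap_eq (a b : D) : ~ Gap -> ~ eq_neg W a b -> a = b.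
Proof.
  intros G N. rewrite eq_negE in N.
  assert (K : forall x z : D, z ε x \/ out z x).
  { intros x z. apply NNPP. intros J. apply G. exists x, z. tauto. }
  assert (N' : forall z, ~ ((z ε a /\ out z b) \/ (z ε b /\ out z a)))
    by (intros z J; apply N; exists z; exact J).
  apply set_eq; intros z; specialize (N' z); destruct (K a z), (K b z); tauto.
Qed.

Lemma eq_neg_glut (a : D) : eq_neg W a a -> Glut.
Proof. rewrite eq_negE. intros (z & K). exists a, z. tauto. Qed.

Context (L : voc W).

Definition FA (X : str L) (y : D) : Prop := exists z s, y = op z s /\ fm L z /\ asg L X s.
Definition RS (X : str L) (y : D) : Prop :=
  exists r n v, y = op r v /\ arr L r n /\ tup (fun a => a ε sM L X) n v.
Definition MM (X : str L) (y : D) : Prop :=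
  exists a b, y = op a b /\ a ε sM L X /\ b ε sM L X.

(** Strong inclusion in a classical class: what fails P must be definitely out of S. *)
Definition subc (S : D) (P : D -> Prop) : Prop :=
  (forall y, y ε S -> P y) /\ (forall y, ~ P y -> out y S).

Lemma subc_setof (A P : D -> Prop) : isset A -> (forall y, A y -> P y) -> subc (setof A) P.
Proof.
  intros HA K. split; intros y Hy.
  - apply (in_setof A y HA) in Hy; auto.
  - apply (out_setof A y HA). auto.
Qed.

Definition Itar (J : D) : interp :=
  Interp eq (eq_neg W) (fun r v => op r v ε J) (fun r v => out (op r v) J).
Definition Itf (P N E1 E2 : D) : interp :=
  Interp (fun a b => op a b ε E1) (fun a b => op a b ε E2)
    (fun r v => op r v ε P) (fun r v => op r v ε N).
Definition Ifol (J : D) : interp :=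
  Interp eq (fun a b => a <> b) (fun r v => op r v ε J) (fun r v => ~ op r v ε J).

Definition holds_tar (X : str L) (J p : D) : Prop :=
  exists S, (subc S (FA X) /\
    Sat L X (Itar J) (fun z s => op z s ε S) (fun z s => out (op z s) S)) /\
    forall s, asg L X s -> op p s ε S.
Definition holds_tf (X : str L) (P N E1 E2 p : D) : Prop :=
  exists T F, (cl T /\ subc T (FA X) /\ cl F /\ subc F (FA X) /\
    Sat L X (Itf P N E1 E2) (fun z s => op z s ε T) (fun z s => op z s ε F)) /\
    forall s, asg L X s -> op p s ε T.
Definition holds_fol (X : str L) (J p : D) : Prop :=
  exists S, (cl S /\ subc S (FA X) /\
    forall s z c, asg L X s -> fits L X s z c ->
      (op z s ε S <->
       tval L X (Ifol J) (fun z s => op z s ε S) (fun z s => ~ op z s ε S) s c)) /\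
    forall s, asg L X s -> op p s ε S.

Lemma isset_FA X : isset (FA X).
Proof.
  eapply isset_iff; [|apply (isset_prod _ _ (isset_fm L) (isset_asg L X))].
  intros y; split; [intros (z & s & E & Hz & Hs)|intros (z & s & Hz & Hs & E)]; exists z, s; auto.
Qed.

Lemma isset_MM X : isset (MM X).
Proof.
  eapply isset_iff; [|apply (isset_prod _ _ (isset_in (sM L X)) (isset_in (sM L X)))].
  intros y; split; [intros (z & s & E & Hz & Hs)|intros (z & s & Hz & Hs & E)]; exists z, s; auto.
Qed.

Lemma isset_RS X : isset (RS X).
Proof.
  eapply isset_sep; [|apply (isset_prod _ _ (isset_in (vR L))
    (isset_pow _ (isset_prod _ _ isset_inom (isset_in (sM L X)))))|].
  - unfold RS. dfn.
  - intros y (r & n & v & -> & Hr & Hv). exists r, v.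
    split; [apply Hr|]. split; [|reflexivity].
    eapply tup_pow; [eapply arr_inom; exact Hr|exact Hv].
Qed.

Lemma FA_op X z s : FA X (op z s) <-> fm L z /\ asg L X s.
Proof.
  split; [|intros [H K]; exists z, s; auto].
  intros (z' & s' & E & H). apply op_inj in E. destruct E; subst; exact H.
Qed.

Definition graph2 (T : D -> D -> Prop) (X : str L) (y : D) : Prop :=
  exists z s, y = op z s /\ (fm L z /\ asg L X s) /\ T z s.

Lemma isset_graph2 (T : D -> D -> Prop) (X : str L) : Def2 T -> isset (graph2 T X).
Proof.
  intros HT. apply (isset_sep _ (FA X)); [|apply isset_FA|].
  - unfold graph2. dfn.
  - intros y (z & s & -> & H & _). apply FA_op, H.
Qed.

Lemma graph2_op T X z s : graph2 T X (op z s) <-> (fm L z /\ asg L X s) /\ T z s.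
Proof.
  split; [|intros H; exists z, s; auto].
  intros (z' & s' & E & H). apply op_inj in E. destruct E; subst; exact H.
Qed.

Lemma Sat_agree X I T F T' F' :
  (forall z s, fm L z -> asg L X s -> (T z s <-> T' z s) /\ (F z s <-> F' z s)) ->
  Sat L X I T F -> Sat L X I T' F'.
Proof.
  intros E H s z c Hs Hc.
  destruct (E z s (fits_fm _ _ _ _ _ Hc) Hs) as [<- <-].
  destruct (H s z c Hs Hc) as [-> ->].
  apply (val_cong L X I T F T' F' s z c Hs Hc).
  intros p s' Hp Hs'. apply E; [eapply fits_isub; eassumption|exact Hs'].
Qed.

Lemma aholds_tf X P N E1 E2 p : fm L p ->
  (holds_tf X P N E1 E2 p <-> aholds L X (Itf P N E1 E2) p).
Proof.
  intros Hp. split.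
  - intros (T & F & (_ & _ & _ & _ & HS) & H).
    exists (fun z s => op z s ε T), (fun z s => op z s ε F).
    split; [dfn|]. split; [dfn|]. split; assumption.
  - intros (T & F & HT & HF & HS & H).
    assert (K : forall Y, Def2 Y -> forall z s, fm L z -> asg L X s ->
      (op z s ε setof (graph2 Y X) <-> Y z s)).
    { intros Y HY z s Hz Hs. rewrite (in_setof _ _ (isset_graph2 Y X HY)), graph2_op. tauto. }
    assert (J : forall Y, Def2 Y -> cl (setof (graph2 Y X)) /\ subc (setof (graph2 Y X)) (FA X)).
    { intros Y HY. split; [apply cl_setof, isset_graph2, HY|].
      apply subc_setof; [apply isset_graph2, HY|].
      intros y (z & s & -> & Hzs & _). apply FA_op, Hzs. }
    exists (setof (graph2 T X)), (setof (graph2 F X)). split.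
    + destruct (J T HT), (J F HF). repeat (split; [assumption|]).
      apply (Sat_agree X _ T F); [|exact HS].
      intros z s Hz Hs. rewrite (K T HT z s Hz Hs), (K F HF z s Hz Hs). tauto.
    + intros s Hs. apply (K T HT p s Hp Hs), H, Hs.
Qed.

(** One set S has to carry both relations, with truth as S^! and the complement of falsity as S^?.
    It exists by [isset2_mk]: without gluts truth and falsity exclude each other, and without gaps
    they exhaust all cases. *)
Lemma aholds_tar X J p : fm L p -> (holds_tar X J p <-> aholds L X (Itar J) p).
Proof.
  intros Hp. split.
  - intros (S & (_ & HS) & H).
    exists (fun z s => op z s ε S), (fun z s => out (op z s) S).
    split; [dfn|]. split; [dfn|]. split; assumption.
  - intros (T & F & HT & HF & HS & H).
    set (A := graph2 T X). set (B := graph2 (fun z s => ~ F z s) X).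
    assert (HA : isset A) by (apply isset_graph2, HT).
    assert (HB : isset B) by (apply isset_graph2; dfn).
    assert (HAB : isset2 A B).
    { apply isset2_mk; [exact HA|exact HB| |].
      - destruct (classic Glut) as [G|G]; [left; exact G|right].
        intros y (z & s & -> & [Hz Hs] & K). apply graph2_op. split; [auto|]. intros K'.
        apply (Sat_consistent L X (Itar J) T F HT HF HS) with (z := z) (s := s); auto.
        split; simpl.
        + intros a b _ _ [-> E]. apply G, (eq_neg_glut b E).
        + intros r n v _ _ E. apply G. exists J, (op r v). exact E.
      - destruct (classic Gap) as [G|G]; [left; exact G|right].
        intros y (z & s & -> & [Hz Hs] & K). apply graph2_op. split; [auto|].
        destruct (Sat_complete L X (Itar J) T F HT HF HS) with (z := z) (s := s); auto; [|tauto].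
        split; simpl.
        + intros a b _ _. destruct (classic (eq_neg W a b)); [auto|left; apply noGap_eq; auto].
        + intros r n v _ _. apply NNPP. intros E. apply G. exists J, (op r v). tauto. }
    apply mk_spec in HAB. exists (mk A B). split; [split|].
    + split; intros y Hy.
      * apply HAB in Hy. destruct Hy as (z & s & -> & Hzs & _). apply FA_op, Hzs.
      * apply HAB. intros (z & s & -> & Hzs & _). apply Hy, FA_op, Hzs.
    + apply (Sat_agree X _ T F); [|exact HS]. intros z s Hz Hs.
      destruct (HAB (op z s)) as [-> ->]. unfold A, B. rewrite !graph2_op. tauto.
    + intros s Hs. apply HAB, graph2_op. auto.
Qed.

(** Internally there is only a truth clause. The complement of truth satisfies the falsity clauses
    by duality; conversely [Ifol] is consistent and complete, so falsity can only be the
    complement. *)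
Lemma aholds_fol X J p : fm L p -> (holds_fol X J p <-> aholds L X (Ifol J) p).
Proof.
  intros Hp. split.
  - intros (S & (_ & _ & HS) & H).
    exists (fun z s => op z s ε S), (fun z s => ~ op z s ε S).
    split; [dfn|]. split; [dfn|]. split; [|exact H].
    intros s z c Hs Hc. split; [apply HS; assumption|].
    rewrite (HS s z c Hs Hc). clear. destruct c; simpl; try tauto.
    + split; [|intros (a & Ha & K) K2; exact (K (K2 a Ha))].
      intros K. apply NNPP. intros K'. apply K. intros a Ha.
      apply NNPP. intros K''. apply K'. exists a; auto.
    + split; [intros K a Ha K2; apply K; exists a; auto|].
      intros K (a & Ha & K2). exact (K a Ha K2).
  - intros (T & F & HT & HF & HS & H).
    assert (HA := isset_graph2 T X HT).
    assert (EF : forall z s, fm L z -> asg L X s -> (F z s <-> ~ T z s)).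
    { intros z s Hz Hs.
      assert (C1 := fun C => Sat_consistent L X (Ifol J) T F HT HF HS C z Hz s Hs).
      assert (C2 := fun C => Sat_complete L X (Ifol J) T F HT HF HS C z Hz s Hs).
      assert (~ (T z s /\ F z s)) by (apply C1; split; simpl; tauto).
      assert (T z s \/ F z s) by (apply C2; split; simpl; intros; apply classic).
      tauto. }
    assert (K : forall z s, fm L z -> asg L X s -> (op z s ε setof (graph2 T X) <-> T z s)).
    { intros z s Hz Hs. rewrite (in_setof _ _ HA), graph2_op. tauto. }
    exists (setof (graph2 T X)). split; [split; [|split]|].
    + apply cl_setof, HA.
    + apply subc_setof; [exact HA|]. intros y (z & s & -> & Hzs & _). apply FA_op, Hzs.
    + intros s z c Hs Hc. rewrite (K z s (fits_fm _ _ _ _ _ Hc) Hs).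
      destruct (HS s z c Hs Hc) as [-> _]. apply (val_cong L X _ _ _ _ _ s z c Hs Hc).
      intros q s' Hq Hs'. assert (Hq' := fits_isub L X s z c q Hc Hq).
      rewrite (K q s' Hq' Hs'), (EF q s' Hq' Hs'). tauto.
    + intros s Hs. apply (K p s Hp Hs), H, Hs.
Qed.

End Models.

(** * From Tarski models to T/F-models and back *)

Section Conversions.
Context {W : tfmodel} {HW : pzfc_model W}.
Local Notation D := (dom W).
Context (L : voc W).

Definition is_tfs (X : str L) (P N E1 E2 : D) : Prop :=
  cl P /\ subc P (RS L X) /\ cl N /\ subc N (RS L X) /\
  cl E1 /\ subc E1 (MM L X) /\ cl E2 /\ subc E2 (MM L X) /\
  (forall a b, op a b ε E2 -> op b a ε E2) /\
  (forall a b, a ε sM L X /\ b ε sM L X -> (op a b ε E1 <-> a = b)).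

Lemma aholds_agree X I I' p :
  (forall a b, a ε sM L X -> b ε sM L X ->
    (EP I a b <-> EP I' a b) /\ (EN I a b <-> EN I' a b)) ->
  (forall r n v, arr L r n -> tup (fun a => a ε sM L X) n v ->
    (PP I r v <-> PP I' r v) /\ (NN I r v <-> NN I' r v)) ->
  aholds L X I p -> aholds L X I' p.
Proof.
  intros E1 E2 (T & F & HT & HF & HS & H). exists T, F.
  split; [exact HT|]. split; [exact HF|]. split; [|exact H].
  intros s z c Hs Hc. destruct (HS s z c Hs Hc) as [-> ->].
  destruct c; simpl; try tauto.
  - destruct Hc as (t & u & _ & _ & _ & Ha & Hb).
    apply E1; eapply val_in; eassumption.
  - destruct Hc as (n & t & Hr & _ & _ & Hv & _). eapply E2; eassumption.
Qed.

Lemma MM_op X a b : MM L X (op a b) <-> a ε sM L X /\ b ε sM L X.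
Proof.
  split; [|intros [H K]; exists a, b; auto].
  intros (z' & s' & E & H). apply op_inj in E. destruct E; subst; exact H.
Qed.

(** J is split into its two extensions. The negative one has to be cut down to [RS], because
    everything outside is out of J. *)
Lemma tf_of_tar X J : subc J (RS L X) ->
  exists P N E1 E2, is_tfs X P N E1 E2 /\
    (~ Glut (W := W) -> iconsistent L X (Itf P N E1 E2)) /\
    (~ Gap (W := W) -> icomplete L X (Itf P N E1 E2)) /\
    forall p, aholds L X (Itar J) p <-> aholds L X (Itf P N E1 E2) p.
Proof.
  intros HJ.
  assert (HRS := isset_RS L X). assert (HMM := isset_MM L X).
  assert (HP : isset (fun y => RS L X y /\ y ε J)) by (apply (isset_sep _ (RS L X)); [dfn|exact HRS|tauto]).
  assert (HN : isset (fun y => RS L X y /\ out y J)) by (apply (isset_sep _ (RS L X)); [dfn|exact HRS|tauto]).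
  assert (H1 : isset (fun y => MM L X y /\ exists a, y = op a a))
    by (apply (isset_sep _ (MM L X)); [dfn|exact HMM|tauto]).
  assert (H2 : isset (fun y => MM L X y /\ exists a b, y = op a b /\ eq_neg W a b))
    by (apply (isset_sep _ (MM L X)); [dfn|exact HMM|tauto]).
  set (P := setof (fun y => RS L X y /\ y ε J)).
  set (N := setof (fun y => RS L X y /\ out y J)).
  set (E1 := setof (fun y => MM L X y /\ exists a, y = op a a)).
  set (E2 := setof (fun y => MM L X y /\ exists a b, y = op a b /\ eq_neg W a b)).
  exists P, N, E1, E2.
  assert (K1 : forall a b, a ε sM L X -> b ε sM L X ->
    (op a b ε E1 <-> a = b)).
  { intros a b Ha Hb. unfold E1. rewrite (in_setof _ _ H1), MM_op. split.
    - intros [_ (c & E)]. apply op_inj in E. destruct E; congruence.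
    - intros ->. split; [auto|]. exists b; reflexivity. }
  assert (K2 : forall a b, op a b ε E2 <-> (a ε sM L X /\ b ε sM L X) /\ eq_neg W a b).
  { intros a b. unfold E2. rewrite (in_setof _ _ H2), MM_op. split.
    - intros [Hab (c & d & E & K)]. apply op_inj in E. destruct E; subst; auto.
    - intros [Hab K]. split; [exact Hab|]. exists a, b; auto. }
  assert (K3 : forall r n v, arr L r n -> tup (fun a => a ε sM L X) n v -> RS L X (op r v))
    by (intros r n v Hr Hv; exists r, n, v; auto).
  split; [|split; [|split]].
  - repeat (split; [first [apply cl_setof; assumption
      | apply subc_setof; [assumption|intros y Hy; apply Hy]]|]). split.
    + intros a b. rewrite !K2. intros [[Ha Hb] E]. split; [auto|]. apply eq_neg_sym, E.
    + intros a b [Ha Hb]. apply K1; assumption.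
  - intros G. split; simpl.
    + intros a b Ha Hb. rewrite (K1 a b Ha Hb), K2. intros [-> [_ E]]. apply G, (eq_neg_glut b E).
    + intros r n v Hr Hv. unfold P, N. rewrite (in_setof _ _ HP), (in_setof _ _ HN).
      intros E. apply G. exists J, (op r v). tauto.
  - intros G. split; simpl.
    + intros a b Ha Hb. rewrite (K1 a b Ha Hb), K2.
      destruct (classic (eq_neg W a b)); [tauto|left; apply noGap_eq; auto].
    + intros r n v Hr Hv. unfold P, N. rewrite (in_setof _ _ HP), (in_setof _ _ HN).
      assert (K := K3 r n v Hr Hv). apply NNPP. intros E. apply G. exists J, (op r v). tauto.
  - intros p.
    assert (A1 : forall a b, a ε sM L X -> b ε sM L X ->
      (EP (Itar J) a b <-> EP (Itf P N E1 E2) a b) /\ (EN (Itar J) a b <-> EN (Itf P N E1 E2) a b)).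
    { intros a b Ha Hb; simpl. rewrite (K1 a b Ha Hb), K2. tauto. }
    assert (A2 : forall r n v, arr L r n -> tup (fun a => a ε sM L X) n v ->
      (PP (Itar J) r v <-> PP (Itf P N E1 E2) r v) /\ (NN (Itar J) r v <-> NN (Itf P N E1 E2) r v)).
    { intros r n v Hr Hv; simpl. unfold P, N. rewrite (in_setof _ _ HP), (in_setof _ _ HN).
      assert (K := K3 r n v Hr Hv). tauto. }
    split; apply aholds_agree; try assumption; intros.
    + destruct (A1 a b) as [-> ->]; tauto.
    + destruct (A2 r n v) as [-> ->]; tauto.
Qed.

(** The element a of a T/F-model is represented by a set a' with a'^! = {a} and
    a'^? = {b : not b =^- a}, so that a' = b' is false exactly when a =^- b. *)
Lemma tar_of_tf X P N E1 E2 : is_tfs X P N E1 E2 ->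
  Glut (W := W) \/ iconsistent L X (Itf P N E1 E2) ->
  Gap (W := W) \/ icomplete L X (Itf P N E1 E2) ->
  exists X' J, subc J (RS L X') /\
    forall p, aholds L X (Itf P N E1 E2) p <-> aholds L X' (Itar J) p.
Proof.
  intros (P1 & P2 & N1 & N2 & C1 & S1 & C2 & S2 & Sy & Id) HG HP.
  set (M := fun a => a ε sM L X).
  set (B := fun a y => M y /\ ~ op y a ε E2).
  set (R := fun a a' => M a /\ ext2 a' (fun y => y = a) (B a)).
  assert (HB : forall a, isset (B a))
    by (intros a; apply (isset_sep _ M); [unfold B, M; dfn|apply isset_in|unfold B; tauto]).
  (* {a} ⊆ B a can fail only by a =^- a, a glut of the T/F-model; B a ⊆ {a} can fail only by some y
     ≠ a without y =^- a, a gap. *)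
  assert (Hex : forall a, M a -> exists a', R a a').
  { intros a Ha. destruct (isset2_mk (fun y => y = a) (B a)) as [a' Ha'].
    - apply isset_sing.
    - apply HB.
    - destruct HG as [G|[G _]]; [left; exact G|right]. intros y ->. split; [exact Ha|].
      intros K. apply (G a a Ha Ha). split; [apply Id; auto|exact K].
    - destruct HP as [G|[G _]]; [left; exact G|right]. intros y [Hy K].
      destruct (G y a Hy Ha) as [J|J]; [apply Id in J; auto|destruct (K J)].
    - exists a'; split; [exact Ha|exact Ha']. }
  assert (Hfun : forall a a' b', R a a' -> R a b' -> a' = b').
  { intros a a' b' [_ Ka] [_ Kb]. exact (ext2_unique _ _ _ _ Ka Kb). }
  assert (Hinj : forall a b a', R a a' -> R b a' -> a = b).
  { intros a b a' [_ Ka] [_ Kb]. apply (Kb a), (Ka a). reflexivity. }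
  assert (DR : Def2 R) by (unfold R, ext2, B, M; dfn).
  assert (HM' : isset (fun a' => exists a, M a /\ R a a')).
  { apply (isset_bigunion M R); [apply isset_in| |exact DR].
    intros a. destruct (classic (M a)) as [Ha|Ha].
    - destruct (Hex a Ha) as [a' Ra]. apply (isset_iff _ (fun y => y = a')); [|apply isset_sing].
      intros y; split; [intros K; exact (Hfun a y a' K Ra)|intros ->; exact Ra].
    - apply (isset_iff _ (fun _ => False)); [|apply isset_empty].
      intros y; split; [intros [K _]; auto|tauto]. }
  set (M' := fun a' => exists a, M a /\ R a a') in *.
  assert (IM' : forall a', a' ε setof M' <-> M' a') by (intros; apply in_setof, HM').
  assert (HK : exists K', isfun K' (fun c => c ε vC L) M' /\
    forall c a', op c a' ε K' <-> c ε vC L /\ M' a' /\ exists a, op c a ε sK L X /\ R a a').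
  { apply isfun_graph; [apply isset_in|exact HM'|dfn| |].
    - intros c Hc. destruct (sK_fun L X) as (_ & _ & F3 & _). destruct (F3 c Hc) as [a Ha].
      assert (Ma : M a) by apply (isfun_dom _ _ _ _ _ (sK_fun L X) Ha).
      destruct (Hex a Ma) as [a' Ra]. exists a'. split; exists a; auto.
    - intros c a' b' _ _ _ (a & Ka & Ra) (b & Kb & Rb).
      destruct (sK_fun L X) as (_ & _ & _ & F4). rewrite (F4 _ _ _ Kb Ka) in Rb.
      exact (Hfun _ _ _ Ra Rb). }
  destruct HK as (K' & HK' & IK').
  assert (HKM : isfun K' (fun c => c ε vC L) (fun a => a ε setof M')).
  { replace (fun a => a ε setof M') with M'; [exact HK'|].
    apply functional_extensionality; intros a; apply propositional_extensionality.
    symmetry; apply IM'. }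
  assert (Hne : exists a', a' ε setof M').
  { destruct (sM_ne L X) as [a Ha]. destruct (Hex a Ha) as [a' Ra]. exists a'.
    apply IM'. exists a; auto. }
  set (X' := Str L (setof M') K' (cl_setof _ HM') Hne HKM).
  (* [Q Z] is the image under R of the tuples with Z. Taken for P and for the complement of N, it
     gives the two extensions of J. *)
  set (Q := fun (Z : D -> Prop) y => exists r n v v', (arr L r n /\ tup M n v /\
    tup (fun a => a ε sM L X') n v' /\ sim R v v') /\ y = op r v' /\ Z (op r v)).
  assert (HQ : forall Z, Def1 Z -> isset (Q Z)).
  { intros Z HZ. apply (isset_sep _ (RS L X')); [|apply isset_RS|].
    - unfold Q, sim, M. dfn.
    - intros y (r & n & v & v' & (Hr & _ & Hv' & _) & -> & _). exists r, n, v'; auto. }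
  assert (HJ : isset2 (Q (fun y => y ε P)) (Q (fun y => ~ y ε N))).
  { apply isset2_mk; [apply HQ; dfn|apply HQ; dfn| |].
    - destruct HG as [G|[_ G]]; [left; exact G|right].
      intros y (r & n & v & v' & K & -> & J). exists r, n, v, v'. split; [exact K|].
      split; [reflexivity|]. intros J'. destruct K as (Hr & Hv & _). apply (G r n v Hr Hv). split; assumption.
    - destruct HP as [G|[_ G]]; [left; exact G|right].
      intros y (r & n & v & v' & K & -> & J). exists r, n, v, v'. split; [exact K|].
      split; [reflexivity|]. destruct K as (Hr & Hv & _). destruct (G r n v Hr Hv) as [E|E]; [exact E|destruct (J E)]. }
  apply mk_spec in HJ. set (J := mk (Q (fun y => y ε P)) (Q (fun y => ~ y ε N))) in *.
  assert (QRS : forall Z y, Q Z y -> RS L X' y).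
  { intros Z y (r & n & v & v' & (Hr & _ & Hv' & _) & -> & _). exists r, n, v'; auto. }
  assert (RM : forall a a' y, R a a' -> (y ε a' <-> y = a) /\ (out y a' <-> ~ B a y))
    by (intros a a' y [_ K]; apply K).
  assert (Q1 : forall Z r n v v', arr L r n -> tup M n v ->
    tup (fun a => a ε sM L X') n v' -> sim R v v' -> (Q Z (op r v') <-> Z (op r v))).
  { intros Z r n v v' Hr Hv Hv' Sv. split.
    - intros (r1 & n1 & v1 & v1' & (Hr1 & Hv1 & Hv1' & Sv1) & E & K).
      apply op_inj in E. destruct E; subst r1 v1'.
      rewrite (arr_fun L r n1 n Hr1 Hr) in *.
      replace v with v1; [exact K|].
      apply (isfun_ext v1 v _ _ _ (proj2 Hv1) (proj2 Hv)). intros x a b Ka Kb.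
      destruct (isfun_dom _ _ _ _ _ (proj2 Hv1) Ka) as [_ Ha].
      destruct (Hex a Ha) as [a' Ra]. apply (Sv1 x a a' Ra), (Sv x a a' Ra) in Ka.
      destruct Hv as (_ & _ & _ & _ & F). eapply F; eassumption.
    - intros K. exists r, n, v, v'. auto. }
  assert (HII : iso L X X' (Itf P N E1 E2) (Itar J) R).
  { constructor; auto.
    - intros a a' Ra. split; [apply Ra|]. apply IM'. exists a. split; [apply Ra|exact Ra].
    - intros a' Ha'. apply IM' in Ha'. destruct Ha' as (a & _ & Ra). exists a; exact Ra.
    - intros c a a' Ra. simpl. rewrite IK'. split.
      + intros K. split; [apply (isfun_dom _ _ _ _ _ (sK_fun L X) K)|].
        split; exists a; [split; [apply Ra|exact Ra]|auto].
      + intros (_ & _ & b & K & Rb). rewrite (Hinj _ _ _ Ra Rb). exact K.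
    - intros a b a' b' Ra Rb. simpl. rewrite (Id a b (conj (proj1 Ra) (proj1 Rb))). split.
      + intros ->. exact (Hfun _ _ _ Ra Rb).
      + intros ->. exact (Hinj _ _ _ Ra Rb).
    (* The only member of a' is a, and the only member of b' is b. So a' = b' is false iff a is out
       of b' or b is out of a', that is, iff a =^- b or b =^- a. *)
    - intros a b a' b' Ra Rb. simpl. rewrite eq_negE.
      assert (Ma := proj1 Ra). assert (Mb := proj1 Rb). split.
      + intros K. exists a. left. rewrite (proj1 (RM a a' a Ra)), (proj2 (RM b b' a Rb)).
        split; [reflexivity|]. unfold B. tauto.
      + intros (z & [[K1 K2]|[K1 K2]]).
        * apply (RM a a' z Ra) in K1. apply (RM b b' z Rb) in K2. subst z. unfold B in K2. tauto.
        * apply (RM b b' z Rb) in K1. apply (RM a a' z Ra) in K2. subst z. unfold B in K2.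
          apply Sy. tauto.
    - intros r n v v' Hr Hv Hv' Sv. simpl. rewrite (proj1 (HJ (op r v'))).
      symmetry. apply (Q1 (fun y => y ε P) r n); assumption.
    - intros r n v v' Hr Hv Hv' Sv. simpl. rewrite (proj2 (HJ (op r v'))).
      rewrite (Q1 (fun y => ~ y ε N) r n v v'); auto. tauto. }
  exists X', J. split.
  - split; intros y Hy.
    + apply HJ in Hy. eapply QRS; exact Hy.
    + apply HJ. intros K. apply Hy. eapply QRS; exact K.
  - intros p. split; [apply (aholds_iso L X X' _ _ R HII)|].
    apply (aholds_iso L X' X _ _ _ (iso_sym L X X' _ _ R HII)).
Qed.

End Conversions.

(** * Consequence relations *)

Section Consequence.
Context {W : tfmodel} {HW : pzfc_model W}.
Local Notation D := (dom W).
Local Notation Glut := (Glut (W := W)).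
Local Notation Gap := (Gap (W := W)).

Definition tar_csq (L : voc W) (Sigma phi : D) : Prop :=
  forall X J, subc J (RS L X) ->
    (forall p, p ε Sigma -> holds_tar L X J p) -> holds_tar L X J phi.
Definition tf_csq (C : forall L, str L -> D -> D -> D -> D -> Prop)
    (L : voc W) (Sigma phi : D) : Prop :=
  forall X P N E1 E2, is_tfs L X P N E1 E2 /\ C L X P N E1 E2 ->
    (forall p, p ε Sigma -> holds_tf L X P N E1 E2 p) -> holds_tf L X P N E1 E2 phi.
Definition fol_csq (L : voc W) (Sigma phi : D) : Prop :=
  forall X J, cl J /\ subc J (RS L X) ->
    (forall p, p ε Sigma -> holds_fol L X J p) -> holds_fol L X J phi.

Definition tar_is (csq : voc W -> D -> D -> Prop) : Prop :=
  forall L Sigma, subc Sigma (fm L) -> forall phi, fm L phi ->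
    (tar_csq L Sigma phi <-> csq L Sigma phi).

Definition unrestricted (L : voc W) (X : str L) (P N E1 E2 : D) : Prop := True.
Definition consistent (L : voc W) (X : str L) (P N E1 E2 : D) : Prop :=
  iconsistent L X (Itf P N E1 E2).
Definition complete (L : voc W) (X : str L) (P N E1 E2 : D) : Prop :=
  icomplete L X (Itf P N E1 E2).

(** The first hypothesis makes every model in C representable by a Tarski model; the second puts the
    T/F-models that arise from Tarski models into C. *)
Lemma tar_is_tf (C : forall L, str L -> D -> D -> D -> D -> Prop) :
  (forall L X P N E1 E2, C L X P N E1 E2 ->
    (Glut \/ iconsistent L X (Itf P N E1 E2)) /\ (Gap \/ icomplete L X (Itf P N E1 E2))) ->
  (forall L X P N E1 E2, (~ Glut -> iconsistent L X (Itf P N E1 E2)) ->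
    (~ Gap -> icomplete L X (Itf P N E1 E2)) -> C L X P N E1 E2) ->
  tar_is (tf_csq C).
Proof.
  intros H1 H2 L Sigma HS phi Hphi. split.
  - intros HT X P N E1 E2 [HX HC] K. destruct (H1 _ _ _ _ _ _ HC) as [HG HP].
    destruct (tar_of_tf L X P N E1 E2 HX HG HP) as (X' & J & HJ & E).
    apply aholds_tf, E, aholds_tar, HT; try assumption.
    intros p Hp. assert (Fp : fm L p) by (apply HS, Hp).
    apply aholds_tar, E, aholds_tf, K; assumption.
  - intros HT X J HJ K.
    destruct (tf_of_tar L X J HJ) as (P & N & E1 & E2 & HX & HG & HP & E).
    apply aholds_tar, E, aholds_tf, HT; try assumption; [auto|].
    intros p Hp. assert (Fp : fm L p) by (apply HS, Hp).
    apply aholds_tf, E, aholds_tar, K; assumption.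
Qed.

Lemma noGlutGap_cl (x : D) : ~ Glut -> ~ Gap -> cl x.
Proof.
  intros G P y. split.
  - intros H K. apply G. exists x, y. auto.
  - intros H. apply NNPP. intros K. apply P. exists x, y. auto.
Qed.

(** All sets being classical, [Itar] and [Ifol] agree on atoms. *)
Lemma tar_is_fol : ~ Glut -> ~ Gap -> tar_is fol_csq.
Proof.
  intros HG HP.
  assert (HO : forall x y : D, out y x <-> ~ y ε x) by (intros x; apply noGlutGap_cl; assumption).
  assert (HN : forall a b : D, eq_neg W a b <-> a <> b).
  { intros a b. split.
    - intros K ->. apply HG, (eq_neg_glut b K).
    - intros K. apply NNPP. intros K'. apply K, noGap_eq; assumption. }
  assert (HH : forall (L : voc W) X J p, fm L p -> (holds_tar L X J p <-> holds_fol L X J p)).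
  { intros L X J p Hp. rewrite (aholds_tar L X J p Hp), (aholds_fol L X J p Hp).
    split; apply aholds_agree; simpl; intros;
      rewrite ?HN, ?HO; tauto. }
  intros L Sigma HS phi Hphi. split.
  - intros HT X J [_ HJ] K. apply HH; [exact Hphi|]. apply HT; [exact HJ|].
    intros p Hp. apply HH; [apply HS, Hp|auto].
  - intros HT X J HJ K. apply HH; [exact Hphi|]. apply HT.
    + split; [apply noGlutGap_cl; assumption|exact HJ].
    + intros p Hp. apply HH; [apply HS, Hp|auto].
Qed.

(** The formulas v_0 = v_1, ~(v_0 = v_1), bot and ~(v_0 = v_1) -> bot *)
Definition eqF : D := code 1 (op (num 0) (num 0)) (op (num 0) (num 1)).
Definition neqF : D := code 3 eqF empty.
Definition botF : D := code 0 empty empty.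
Definition nnegF : D := code 6 neqF botF.

Section Formulas.
Context (L : voc W).

Lemma term_var k : tm L (op (num 0) (num k)).
Proof. left. exists (num k). split; [apply inom_num|reflexivity]. Qed.

Lemma fm_eqF : fm L eqF.
Proof. destruct (fm_closed L) as (_ & C & _). apply C; apply term_var. Qed.
Lemma fm_neqF : fm L neqF.
Proof. destruct (fm_closed L) as (_ & _ & _ & C & _). apply C, fm_eqF. Qed.
Lemma fm_botF : fm L botF.
Proof. apply (proj1 (fm_closed L)). Qed.
Lemma fm_nnegF : fm L nnegF.
Proof.
  destruct (fm_closed L) as (_ & _ & _ & _ & _ & _ & C & _). apply C; [apply fm_neqF|apply fm_botF].
Qed.

Context (X : str L) (J : interp (W := W)) (T F : D -> D -> Prop) (HS : Sat L X J T F).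

Lemma asg_ex a b : a ε sM L X -> b ε sM L X ->
  exists s, asg L X s /\ op (num 0) a ε s /\ op (num 1) b ε s.
Proof.
  intros Ha Hb.
  destruct (isfun_graph inom (fun a => a ε sM L X) (fun _ x => x = b)) as (s & Hs & K).
  - apply isset_inom.
  - apply isset_in.
  - dfn.
  - intros x _. exists b; auto.
  - intros x y z _ _ _ -> ->. reflexivity.
  - exists (upd s (num 0) a). split; [apply asg_upd; auto using inom_num|].
    rewrite !in_upd, !K. split; [auto|]. right. split; [auto using inom_num|].
    intros E; apply num_inj in E; discriminate.
Qed.

Lemma eqF_fits s a b : op (num 0) a ε s -> op (num 1) b ε s -> fits L X s eqF (HEq a b).
Proof.
  intros Ha Hb. exists (op (num 0) (num 0)), (op (num 0) (num 1)).
  split; [apply term_var|]. split; [apply term_var|]. split; [reflexivity|].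
  split; left; [exists (num 0)|exists (num 1)]; auto using inom_num.
Qed.

Lemma eqF_ex s : asg L X s -> exists a b, a ε sM L X /\ b ε sM L X /\ fits L X s eqF (HEq a b).
Proof.
  intros Hs. destruct (asg_app L X s (num 0) Hs (inom_num 0)) as (a & Ha & Ka).
  destruct (asg_app L X s (num 1) Hs (inom_num 1)) as (b & Hb & Kb).
  exists a, b. split; [exact Ha|]. split; [exact Hb|]. apply eqF_fits; assumption.
Qed.

Lemma Sat_neqF s a b : asg L X s -> fits L X s eqF (HEq a b) ->
  (T eqF s <-> EP J a b) /\ (T neqF s <-> EN J a b) /\ ~ T botF s /\ (T nnegF s <-> ~ EN J a b).
Proof.
  intros Hs Hc.
  destruct (HS s eqF (HEq a b) Hs Hc) as [E1 E2].
  destruct (HS s neqF (HNeg eqF) Hs (conj fm_eqF eq_refl)) as [E3 _].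
  destruct (HS s botF HBot Hs eq_refl) as [E4 _].
  destruct (HS s nnegF (HImp neqF botF) Hs (conj fm_neqF (conj fm_botF eq_refl))) as [E5 _].
  simpl in *. tauto.
Qed.

(** Any two elements are the values of v_0 and v_1 under some assignment. *)
Lemma holds_eq_form p (Q : D -> D -> Prop) :
  (forall s a b, asg L X s -> fits L X s eqF (HEq a b) -> (T p s <-> Q a b)) ->
  (forall s, asg L X s -> T p s) <-> forall a b, a ε sM L X -> b ε sM L X -> Q a b.
Proof.
  intros E. split.
  - intros H a b Ha Hb. destruct (asg_ex a b Ha Hb) as (s & Hs & K1 & K2).
    apply (E s a b Hs (eqF_fits s a b K1 K2)), H, Hs.
  - intros H s Hs. destruct (eqF_ex s Hs) as (a & b & Ha & Hb & Hc).
    apply (E s a b Hs Hc), H; assumption.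
Qed.

Lemma holds_eqF :
  (forall s, asg L X s -> T eqF s) <-> forall a b, a ε sM L X -> b ε sM L X -> EP J a b.
Proof. apply holds_eq_form. intros s a b Hs Hc. apply (Sat_neqF s a b Hs Hc). Qed.

Lemma holds_neqF :
  (forall s, asg L X s -> T neqF s) <-> forall a b, a ε sM L X -> b ε sM L X -> EN J a b.
Proof. apply holds_eq_form. intros s a b Hs Hc. apply (Sat_neqF s a b Hs Hc). Qed.

Lemma holds_nnegF :
  (forall s, asg L X s -> T nnegF s) <-> forall a b, a ε sM L X -> b ε sM L X -> ~ EN J a b.
Proof.
  apply (holds_eq_form nnegF (fun a b => ~ EN J a b)).
  intros s a b Hs Hc. apply (Sat_neqF s a b Hs Hc).
Qed.

Lemma holds_botF : ~ forall s, asg L X s -> T botF s.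
Proof.
  intros H. destruct (sM_ne L X) as [a Ha]. destruct (asg_ex a a Ha Ha) as (s & Hs & K1 & K2).
  exfalso. destruct (eqF_ex s Hs) as (x & y & _ & _ & Hc).
  destruct (Sat_neqF s x y Hs Hc) as (_ & _ & N & _). apply N, H, Hs.
Qed.

End Formulas.

Lemma aholds_eqF (L : voc W) (X : str L) (J : interp) : aholds L X J eqF -> forall a b, a ε sM L X -> b ε sM L X -> EP J a b.
Proof. intros (T & F & _ & _ & HS & H). apply (holds_eqF L X J T F HS), H. Qed.

Lemma aholds_neqF (L : voc W) (X : str L) (J : interp) : aholds L X J neqF -> forall a b, a ε sM L X -> b ε sM L X -> EN J a b.
Proof. intros (T & F & _ & _ & HS & H). apply (holds_neqF L X J T F HS), H. Qed.

Lemma aholds_botF (L : voc W) (X : str L) (J : interp) : ~ aholds L X J botF.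
Proof. intros (T & F & _ & _ & HS & H). apply (holds_botF L X J T F HS), H. Qed.

(** [nnegF] leaves no pair with a =^- b, and the side condition then identifies all elements. It is
    available both when there are no gaps and in complete models. *)
Lemma aholds_nnegF_eqF (L : voc W) (X : str L) (J : interp) : aholds L X J nnegF ->
  (forall a b, a ε sM L X -> b ε sM L X -> ~ EN J a b -> EP J a b) -> aholds L X J eqF.
Proof.
  intros (T & F & HT & HF & HS & H) K. exists T, F. repeat (split; [assumption|]).
  apply (holds_eqF L X J T F HS). intros a b Ha Hb. apply K; try assumption.
  apply (holds_nnegF L X J T F HS); assumption.
Qed.

(** * Two-element models over the empty vocabulary *)

Lemma isfun_empty (Q : D -> Prop) : isfun empty (fun r => r ε empty) Q.
Proof.
  split; [apply cl_empty|]. split; [|split].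
  - intros z Hz. destruct (in_empty z Hz).
  - intros z Hz. destruct (in_empty z Hz).
  - intros x y z Hz. destruct (in_empty _ Hz).
Qed.

Definition voc0 : voc W :=
  Voc empty empty empty cl_empty (fun c H => False_ind _ (in_empty c H))
    cl_empty (fun c H => False_ind _ (in_empty c H)) (isfun_empty _).

Lemma cl_pr (u v : D) : cl (pr u v).
Proof. apply cl_setof, isset_pair. Qed.

(** Two distinct elements are there to refute v_0 = v_1. *)
Definition str2 : str voc0 :=
  Str voc0 (pr empty (sg empty)) empty (cl_pr _ _)
    (ex_intro _ empty (proj2 (in_pr empty (sg empty) empty) (or_introl eq_refl))) (isfun_empty _).

Lemma str2_two : exists a b, a ε sM voc0 str2 /\ b ε sM voc0 str2 /\ a <> b.
Proof.
  exists empty, (sg empty). split; [apply in_pr; auto|]. split; [apply in_pr; auto|].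
  intros E. apply (sg_neq_empty empty). auto.
Qed.

Lemma no_arr r n : ~ arr voc0 r n.
Proof. intros [H _]. exact (in_empty r H). Qed.

Lemma subc_empty (P : D -> Prop) : subc empty P.
Proof.
  split; intros y Hy; [destruct (in_empty y Hy)|].
  apply cl_empty, in_empty.
Qed.

Definition idE : D := setof (fun y => MM voc0 str2 y /\ exists a, y = op a a).
Definition allE : D := setof (MM voc0 str2).

Lemma isset_idE : isset (fun y => MM voc0 str2 y /\ exists a, y = op a a).
Proof. apply (isset_sep _ (MM voc0 str2)); [assert (H := isset_MM voc0 str2); dfn|apply isset_MM|tauto]. Qed.

Lemma in_idE a b : a ε sM voc0 str2 -> b ε sM voc0 str2 -> (op a b ε idE <-> a = b).
Proof.
  intros Ha Hb. unfold idE. rewrite (in_setof _ _ isset_idE), MM_op. split.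
  - intros [_ (c & E)]. apply op_inj in E. destruct E; congruence.
  - intros ->. split; [auto|]. exists b; reflexivity.
Qed.

Lemma in_allE a b : op a b ε allE <-> a ε sM voc0 str2 /\ b ε sM voc0 str2.
Proof. unfold allE. rewrite (in_setof _ _ (isset_MM voc0 str2)). apply MM_op. Qed.

Lemma is_tfs_str2 E : cl E -> subc E (MM voc0 str2) -> (forall a b, op a b ε E -> op b a ε E) ->
  is_tfs voc0 str2 empty empty idE E.
Proof.
  intros H1 H2 H3. split; [apply cl_empty|]. split; [apply subc_empty|].
  split; [apply cl_empty|]. split; [apply subc_empty|].
  split; [apply cl_setof, isset_idE|].
  split; [apply subc_setof; [apply isset_idE|intros y Hy; apply Hy]|].
  repeat (split; [assumption|]). intros a b [Ha Hb]. apply in_idE; assumption.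
Qed.

(** With =^- total there are no gaps, while a = a is both true and false. *)
Lemma is_tfs_glut : is_tfs voc0 str2 empty empty idE allE.
Proof.
  apply is_tfs_str2.
  - apply cl_setof, isset_MM.
  - apply subc_setof; [apply isset_MM|auto].
  - intros a b. rewrite !in_allE. tauto.
Qed.

(** With =^- empty there are no gluts, while the equality of the two elements is neither true nor
    false. *)
Lemma is_tfs_gap : is_tfs voc0 str2 empty empty idE empty.
Proof.
  apply is_tfs_str2; [apply cl_empty|apply subc_empty|].
  intros a b H. destruct (in_empty _ H).
Qed.

Lemma complete_glut : complete voc0 str2 empty empty idE allE.
Proof.
  split; simpl.
  - intros a b Ha Hb. right. apply in_allE; auto.
  - intros r n v Hr. destruct (no_arr r n Hr).
Qed.

Lemma consistent_gap : consistent voc0 str2 empty empty idE empty.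
Proof.
  split; simpl.
  - intros a b _ _ [_ H]. exact (in_empty _ H).
  - intros r n v Hr. destruct (no_arr r n Hr).
Qed.

Lemma Sat_str2 E : exists T F, Def2 T /\ Def2 F /\ Sat voc0 str2 (Itf empty empty idE E) T F.
Proof. apply Sat_ex; simpl; dfn. Qed.

Lemma aholds_neqF_glut : aholds voc0 str2 (Itf empty empty idE allE) neqF.
Proof.
  destruct (Sat_str2 allE) as (T & F & HT & HF & HS). exists T, F.
  repeat (split; [assumption|]). apply (holds_neqF voc0 str2 _ T F HS).
  intros a b Ha Hb. apply in_allE; auto.
Qed.

Lemma aholds_nnegF_gap : aholds voc0 str2 (Itf empty empty idE empty) nnegF.
Proof.
  destruct (Sat_str2 empty) as (T & F & HT & HF & HS). exists T, F.
  repeat (split; [assumption|]). apply (holds_nnegF voc0 str2 _ T F HS).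
  intros a b _ _. apply in_empty.
Qed.

Lemma aholds_eqF_gap E : ~ aholds voc0 str2 (Itf empty empty idE E) eqF.
Proof.
  intros H. destruct str2_two as (a & b & Ha & Hb & N).
  apply N, in_idE; try assumption. exact (aholds_eqF _ _ _ H a b Ha Hb).
Qed.

Lemma subc_sg p : fm voc0 p -> subc (sg p) (fm voc0).
Proof. intros Hp. apply subc_setof; [apply isset_sing|intros y ->; exact Hp]. Qed.

(** A glut turns the model with total =^-, which is complete, into a Tarski model of ~(v_0 = v_1).
    Conversely, in such a Tarski model a ≠ a is true, so some z is both in and out of a. *)
Lemma tar_csq_glut : tar_csq voc0 (sg neqF) botF <-> ~ Glut.
Proof.
  split.
  - intros H G.
    destruct (tar_of_tf voc0 str2 empty empty idE allE is_tfs_glut) as (X' & J & HJ & E).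
    + left; exact G.
    + right; apply complete_glut.
    + apply (aholds_botF voc0 X' (Itar J)). apply aholds_tar; [apply fm_botF|].
      apply H; [exact HJ|]. intros p Hp. apply in_sg in Hp. subst p.
      apply aholds_tar; [apply fm_neqF|]. apply E, aholds_neqF_glut.
  - intros G X J HJ H. exfalso. apply G. destruct (sM_ne voc0 X) as [a Ha].
    apply (eq_neg_glut a). apply (aholds_neqF voc0 X (Itar J)); try assumption.
    apply aholds_tar; [apply fm_neqF|]. apply H, in_sg. reflexivity.
Qed.

(** A gap turns the model with empty =^-, which is consistent, into a Tarski model of ~(v_0 = v_1)
    -> bot in which v_0 = v_1 does not hold. Without gaps, sets whose equality is not false are
    equal. *)
Lemma tar_csq_gap : tar_csq voc0 (sg nnegF) eqF <-> ~ Gap.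
Proof.
  split.
  - intros H G.
    destruct (tar_of_tf voc0 str2 empty empty idE empty is_tfs_gap) as (X' & J & HJ & E).
    + right; apply consistent_gap.
    + left; exact G.
    + apply (aholds_eqF_gap empty). apply E. apply aholds_tar; [apply fm_eqF|].
      apply H; [exact HJ|]. intros p Hp. apply in_sg in Hp. subst p.
      apply aholds_tar; [apply fm_nnegF|]. apply E, aholds_nnegF_gap.
  - intros G X J HJ H. apply aholds_tar; [apply fm_eqF|].
    apply aholds_nnegF_eqF.
    + apply aholds_tar; [apply fm_nnegF|]. apply H, in_sg. reflexivity.
    + intros a b _ _ K. apply noGap_eq; assumption.
Qed.

Lemma tf_csq_glut (C : forall L, str L -> D -> D -> D -> D -> Prop) :
  C voc0 str2 empty empty idE allE -> ~ tf_csq C voc0 (sg neqF) botF.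
Proof.
  intros HC H. apply (aholds_botF voc0 str2 (Itf empty empty idE allE)).
  apply aholds_tf; [apply fm_botF|]. apply H; [split; [apply is_tfs_glut|exact HC]|].
  intros p Hp. apply in_sg in Hp. subst p.
  apply aholds_tf; [apply fm_neqF|]. apply aholds_neqF_glut.
Qed.

Lemma tf_csq_gap (C : forall L, str L -> D -> D -> D -> D -> Prop) :
  C voc0 str2 empty empty idE empty -> ~ tf_csq C voc0 (sg nnegF) eqF.
Proof.
  intros HC H. apply (aholds_eqF_gap empty).
  apply aholds_tf; [apply fm_eqF|]. apply H; [split; [apply is_tfs_gap|exact HC]|].
  intros p Hp. apply in_sg in Hp. subst p.
  apply aholds_tf; [apply fm_nnegF|]. apply aholds_nnegF_gap.
Qed.

Lemma consistent_csq : tf_csq consistent voc0 (sg neqF) botF.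
Proof.
  intros X P N E1 E2 [HX HC] H. exfalso. destruct (sM_ne voc0 X) as [a Ha].
  apply (proj1 HC a a Ha Ha). split.
  - apply HX; auto.
  - apply (aholds_neqF voc0 X (Itf P N E1 E2)); try assumption.
    apply aholds_tf; [apply fm_neqF|]. apply H, in_sg. reflexivity.
Qed.

Lemma complete_csq : tf_csq complete voc0 (sg nnegF) eqF.
Proof.
  intros X P N E1 E2 [HX HC] H. apply aholds_tf; [apply fm_eqF|].
  apply aholds_nnegF_eqF.
  - apply aholds_tf; [apply fm_nnegF|]. apply H, in_sg. reflexivity.
  - intros a b Ha Hb K. destruct (proj1 HC a b Ha Hb); tauto.
Qed.

Lemma fol_csq_glut : fol_csq voc0 (sg neqF) botF.
Proof.
  intros X J HJ H. exfalso. destruct (sM_ne voc0 X) as [a Ha].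
  apply (aholds_neqF voc0 X (Ifol J)) with (a := a) (b := a); try assumption; [|reflexivity].
  apply aholds_fol; [apply fm_neqF|]. apply H, in_sg. reflexivity.
Qed.

Lemma fol_csq_gap : fol_csq voc0 (sg nnegF) eqF.
Proof.
  intros X J HJ H. apply aholds_fol; [apply fm_eqF|].
  apply aholds_nnegF_eqF.
  - apply aholds_fol; [apply fm_nnegF|]. apply H, in_sg. reflexivity.
  - intros a b _ _ K. apply NNPP, K.
Qed.

(** The presence of gluts and of gaps can be read off from two consequences, so each converse
    implication reduces to deciding these in the logic at hand. *)
Lemma tar_is_L0 csq : tar_is csq ->
  (csq voc0 (sg neqF) botF <-> ~ Glut) /\ (csq voc0 (sg nnegF) eqF <-> ~ Gap).
Proof.
  intros H. rewrite <- tar_csq_glut, <- tar_csq_gap.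
  rewrite (H voc0 (sg neqF) (subc_sg _ (fm_neqF voc0)) botF (fm_botF voc0)).
  rewrite (H voc0 (sg nnegF) (subc_sg _ (fm_nnegF voc0)) eqF (fm_eqF voc0)). tauto.
Qed.

Theorem tar_is_bs4 : tar_is (tf_csq unrestricted) <-> Glut /\ Gap.
Proof.
  split.
  - intros H. destruct (tar_is_L0 _ H) as [H1 H2].
    assert (K1 := tf_csq_glut unrestricted Logic.I). assert (K2 := tf_csq_gap unrestricted Logic.I).
    split; apply NNPP; tauto.
  - intros [HG HP]. apply tar_is_tf; unfold unrestricted; auto.
Qed.

Theorem tar_is_k3 : tar_is (tf_csq consistent) <-> ~ Glut /\ Gap.
Proof.
  split.
  - intros H. destruct (tar_is_L0 _ H) as [H1 H2].
    assert (K1 := consistent_csq). assert (K2 := tf_csq_gap consistent consistent_gap).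
    split; [tauto|apply NNPP; tauto].
  - intros [HG HP]. apply tar_is_tf; unfold consistent; auto.
Qed.

Theorem tar_is_lfi1 : tar_is (tf_csq complete) <-> Glut /\ ~ Gap.
Proof.
  split.
  - intros H. destruct (tar_is_L0 _ H) as [H1 H2].
    assert (K1 := tf_csq_glut complete complete_glut). assert (K2 := complete_csq).
    split; [apply NNPP; tauto|tauto].
  - intros [HG HP]. apply tar_is_tf; unfold complete; auto.
Qed.

Theorem tar_is_fol_iff : tar_is fol_csq <-> ~ Glut /\ ~ Gap.
Proof.
  split.
  - intros H. destruct (tar_is_L0 _ H) as [H1 H2].
    assert (K1 := fol_csq_glut). assert (K2 := fol_csq_gap). tauto.
  - intros [HG HP]. apply tar_is_fol; assumption.
Qed.

End Consequence.

(** * Translation of the internal definitions *)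

Local Notation crel w A P := (frel w A P (fun x => ~ P x)).

Section SetTranslation.
Context {W : tfmodel} {HW : pzfc_model W}.
Local Notation D := (dom W).
Implicit Type w : world W.

Lemma eq_setof (d : D) (P : D -> Prop) : isset P ->
  ((forall y, (y ε d <-> P y) /\ (out y d <-> ~ P y)) <-> d = setof P).
Proof.
  intros H. split; [intros K; symmetry; exact (mk_unique P P d K)|intros ->; exact (mk_spec _ _ H)].
Qed.

Lemma brel_the_set w A phi (Q P N : D -> Prop) : isset Q -> crel w A Q -> frel w phi P N ->
  brel w (the A phi) (P (setof Q)) (N (setof Q)).
Proof.
  intros HQ HA HP. eapply brel_the; [exact HA|exact HP|exact (mk_spec _ _ HQ)|].
  intros d; apply eq_setof, HQ.
Qed.

Lemma brel_sing w phi (P N : D -> Prop) u a : vrel w u a -> frel w phi P N ->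
  brel w (the (sing u) phi) (P (sg a)) (N (sg a)).
Proof.
  intros V H. apply brel_the_set; [apply isset_sing|apply frel_sing, V|exact H].
Qed.

Lemma brel_upair w phi (P N : D -> Prop) u v a b : vrel w u a -> vrel w v b -> frel w phi P N ->
  brel w (the (upair u v) phi) (P (pr a b)) (N (pr a b)).
Proof.
  intros V V' H. apply brel_the_set; [apply isset_pair|apply frel_upair; assumption|exact H].
Qed.

End SetTranslation.

Ltac brl_ext ::=
  match goal with
  | |- brel _ (the cempty _) _ _ => eapply brel_empty
  | |- brel _ (the (csucc _) _) _ _ => eapply brel_suc
  | |- brel _ (the (sing _) _) _ _ => eapply brel_sing
  | |- brel _ (the (upair _ _) _) _ _ => eapply brel_upair
  end.

Section KuratowskiTranslation.
Context {W : tfmodel} {HW : pzfc_model W}.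
Local Notation D := (dom W).
Implicit Type w : world W.

Lemma brel_is_kpair w z u v c a b : vrel w z c -> vrel w u a -> vrel w v b ->
  brel w (is_kpair z u v) (c = kp a b) (c <> kp a b).
Proof.
  intros V1 V2 V3. eapply brel_iff; [unfold is_kpair; brl| |]; cbv beta;
    rewrite (eq_setof _ _ (isset_pair (sg a) (pr a b))); reflexivity.
Qed.

End KuratowskiTranslation.

Ltac brl_ext1 :=
  match goal with
  | |- brel _ (the cempty _) _ _ => eapply brel_empty
  | |- brel _ (the (csucc _) _) _ _ => eapply brel_suc
  | |- brel _ (the (sing _) _) _ _ => eapply brel_sing
  | |- brel _ (the (upair _ _) _) _ _ => eapply brel_upair
  | |- brel _ (is_kpair _ _ _) _ _ => eapply brel_is_kpair
  end.
Ltac brl_ext ::= brl_ext1.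

Section PairTranslation.
Context {W : tfmodel} {HW : pzfc_model W}.
Local Notation D := (dom W).
Implicit Type w : world W.

Lemma frel_tagged w A B PA NA PB NB : frel w A PA NA -> frel w B PB NB ->
  frel w (tagged A B) (opP PA PB)
    (fun z => (forall x, NA x \/ z <> kp x empty) /\ (forall y, NB y \/ z <> kp y (sg empty))).
Proof. intros HA HB. eapply frel_iff; [unfold tagged; brl| |]; intros z; cbv beta; reflexivity. Qed.

Lemma opP_neg (PA NA PB NB : D -> Prop) z :
  (forall x, NA x <-> ~ PA x) -> (forall x, NB x <-> ~ PB x) ->
  ((forall x, NA x \/ z <> kp x empty) /\ (forall y, NB y \/ z <> kp y (sg empty)) <->
   ~ opP PA PB z).
Proof.
  intros HA HB. split.
  - intros [H K] [(x & Hx & E)|(x & Hx & E)].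
    + destruct (H x) as [J|J]; [apply HA in J|]; auto.
    + destruct (K x) as [J|J]; [apply HB in J|]; auto.
  - intros H. split; intros x.
    + rewrite HA. apply NNPP. intros K. apply H. left. exists x. tauto.
    + rewrite HB. apply NNPP. intros K. apply H. right. exists x. tauto.
Qed.

(** The leading ! takes care of falsity; the work lies in matching p^! and p^? with the two
    extensions of [op]. *)
Lemma brel_is_opair w p a b p' a' b' : vrel w p p' -> vrel w a a' -> vrel w b b' ->
  brel w (is_opair p a b) (p' = op a' b') (p' <> op a' b').
Proof.
  intros V1 V2 V3.
  assert (E : (forall z, (z ε p' <-> opP (fun x => x ε a') (fun x => x ε b') z) /\
      (~ z ε p' <-> (forall x, ~ x ε a' \/ z <> kp x empty) /\
        (forall y, ~ y ε b' \/ z <> kp y (sg empty)))) /\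
    (forall z, (~ out z p' <-> opP (fun x => ~ out x a') (fun x => ~ out x b') z) /\
      (out z p' <-> (forall x, out x a' \/ z <> kp x empty) /\
        (forall y, out y b' \/ z <> kp y (sg empty)))) <-> p' = op a' b').
  { split.
    - intros [H K]. symmetry. apply mk_unique. intros z. split; [apply H|].
      destruct (K z) as [K1 K2]. rewrite <- K1. tauto.
    - intros ->. split; intros z; destruct (op_spec a' b' z) as [K1 K2].
      + split; [exact K1|]. rewrite (opP_neg (fun x => x ε a') _ (fun x => x ε b')), K1; tauto.
      + rewrite K2. split; [split; [apply NNPP|tauto]|].
        rewrite (opP_neg (fun x => ~ out x a') _ (fun x => ~ out x b')); try tauto;
          intros x; (split; [tauto|apply NNPP]). }
  eapply brel_iff; [unfold is_opair; brl; eapply frel_tagged; brl|exact E|].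
  rewrite E. reflexivity.
Qed.

Lemma brel_pmem w a b (A : cls) a' b' P N : vrel w a a' -> vrel w b b' -> frel w A P N ->
  brel w (pmem a b A) (P (op a' b')) (N (op a' b')).
Proof.
  intros V1 V2 HA. eapply brel_iff.
  - unfold pmem. brl. eapply brel_is_opair; eassumption.
  - split; [intros (p & -> & H); exact H|intros H; exists (op a' b'); auto].
  - cbv beta. split.
    + intros H. destruct (H (op a' b')); tauto.
    + intros H p. destruct (classic (p = op a' b')) as [->|]; auto.
Qed.

End PairTranslation.

Ltac brl_ext2 :=
  match goal with
  | |- brel _ (is_opair _ _ _) _ _ => eapply brel_is_opair
  | |- brel _ (pmem _ _ _) _ _ => eapply brel_pmem
  | |- brelT _ (inductive _) _ => eapply brelT_inductive
  end.
Ltac brl_ext ::= first [brl_ext1 | brl_ext2].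

Section FunctionTranslation.
Context {W : tfmodel} {HW : pzfc_model W}.
Local Notation D := (dom W).
Implicit Type w : world W.

Lemma frel_cprod w A B PA NA PB NB : frel w A PA NA -> frel w B PB NB ->
  frel w (cprod A B) (fun z => exists a b, z = op a b /\ PA a /\ PB b)
    (fun z => forall a b, z <> op a b \/ NA a \/ NB b).
Proof. intros HA HB. eapply frel_iff; [unfold cprod; brl| |]; intros z; cbv beta; reflexivity. Qed.

Lemma frel_cprod_cl w A B PA PB : crel w A PA -> crel w B PB ->
  crel w (cprod A B) (fun z => exists a b, z = op a b /\ PA a /\ PB b).
Proof.
  intros HA HB. eapply frel_iff; [apply frel_cprod; eassumption|reflexivity|].
  intros z; split.
  - intros H (a & b & E & Ha & Hb). destruct (H a b); tauto.
  - intros H a b. apply NNPP. intros K. apply H. exists a, b. tauto.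
Qed.

(** That A is classical is a consequence: f is classical, hence so is its domain, which agrees with
    A in both extensions. *)
Lemma brelT_is_fun w f A B f' PA NA PB : vrel w f f' -> frel w A PA NA -> crel w B PB ->
  brelT w (is_fun f A B) (isfun f' PA PB /\ forall x, NA x <-> ~ PA x).
Proof.
  intros V HA HB. eapply brelT_iff.
  - unfold is_fun. apply brelT_and; [brl|intros _].
    apply brelT_and; [eapply brelT_brel, brel_csub; [apply frel_elem, V|apply frel_cprod; eassumption]|intros _].
    apply brelT_and; [|intros _; brl].
    eapply brelT_brel, brel_ceq; [|exact HA]. unfold cdom. brl.
  - cbv beta. split.
    + intros (H1 & H2 & H3 & H4).
      assert (N : forall x, NA x <-> ~ PA x).
      { intros x. destruct (H3 x) as [E1 E2]. rewrite <- E1, <- E2. split.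
        - intros K (y & J). apply (H1 (op x y)) in J; auto.
        - intros K y. apply H1. intros J. apply K. exists y; exact J. }
      split; [|exact N]. split; [exact H1|]. split; [|split].
      * intros z Hz. destruct (proj1 (H2 z) Hz) as (a & b & E & Ha & Hb). exists a, b; auto.
      * intros x Hx. apply H3, Hx.
      * intros x y z Hy Hz. exact (H4 x y z (conj Hy Hz)).
    + intros [(H1 & H2 & H3 & H4) N]. split; [exact H1|]. split; [|split].
      * intros z. split; [apply H2|]. intros K. apply H1. intros J.
        destruct (H2 z J) as (a & b & E & Ha & Hb). destruct (K a b) as [?|[L|L]]; [auto| |auto].
        apply N in L. auto.
      * intros x. assert (E : (exists y, op x y ε f') <-> PA x).
        { split; [intros (y & Hy)|apply H3]. destruct (H2 _ Hy) as (a & b & E & Ha & Hb).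
          apply op_inj in E. destruct E; subst; exact Ha. }
        split; [exact E|]. rewrite N, <- E. split.
        -- intros K (y & J). apply (H1 (op x y)) in J; auto.
        -- intros K y. apply H1. intros J. apply K. exists y; exact J.
      * intros x y z [Hy Hz]. eapply H4; eassumption.
Qed.

Lemma brelT_is_fun_cl w f A B f' PA PB : vrel w f f' -> crel w A PA -> crel w B PB ->
  brelT w (is_fun f A B) (isfun f' PA PB).
Proof. intros V HA HB. eapply brelT_iff; [eapply brelT_is_fun; eassumption|tauto]. Qed.

(** Only classical sets x are quantified over, and for these being out is the same as not being
    in. *)
Lemma frel_omega w : crel w omega inom.
Proof.
  eapply frel_iff.
  - unfold omega. brl.
  - intros n; cbv beta. unfold inom. split; intros H x; specialize (H x); tauto.
  - intros n; cbv beta. split.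
    + intros (x & [H1 H2] & K) J. apply H1 in K. apply K, J; assumption.
    + intros H. apply NNPP. intros K. apply H. intros x H1 H2. apply NNPP. intros J.
      apply K. exists x. split; [auto|]. apply H1, J.
Qed.

Lemma brel_is_num k w x a : vrel w x a -> brel w (is_num k x) (a = num k) (a <> num k).
Proof.
  revert w x a. induction k as [|k IH]; intros w x a V.
  - eapply brel_iff; [simpl; brl| |]; cbv beta.
    + split; [apply eq_empty|intros ->; apply empty_ext].
    + split; intros H; intros K; apply H; [subst; apply empty_ext|apply eq_empty, K].
  - assert (E : forall y, (forall z, (z ε a <-> z ε y \/ z = y) /\ (out z a <-> out z y /\ ~ z = y)) <->
      a = suc y).
    { intros y. split.
      - intros H. symmetry. apply mk_unique. intros z; specialize (H z). tauto.
      - intros -> z. destruct (suc_spec y z) as [K L]. split; [exact K|]. tauto. }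
    eapply brel_iff.
    + simpl. apply brel_ex. frel_var. apply brel_and; [apply IH; eassumption|unfold csucc; brl].
    + cbv beta. split.
      * intros (y & -> & H). apply E, H.
      * intros ->. exists (num k). split; [reflexivity|]. apply E. reflexivity.
    + cbv beta. split.
      * intros H K. destruct (H (num k)) as [J|J]; [auto|]. apply J, E, K.
      * intros H y. rewrite E. destruct (classic (y = num k)) as [->|]; auto.
Qed.

Lemma brel_the_num k w phi P N : frel w phi P N ->
  brel w (the_num k phi) (P (num k)) (N (num k)).
Proof.
  intros H. eapply brel_iff.
  - unfold the_num. apply brel_ex. frel_var. apply brel_and; [apply brel_is_num; eassumption|].
    eapply H; [eapply wle_refl|eassumption].
  - cbv beta. split; [intros (x & -> & K); exact K|intros K; exists (num k); auto].
  - cbv beta. split.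
    + intros K. destruct (K (num k)); tauto.
    + intros K x. destruct (classic (x = num k)) as [->|]; auto.
Qed.

Lemma brel_is_code k w z a b z' a' b' : vrel w z z' -> vrel w a a' -> vrel w b b' ->
  brel w (is_code k z a b) (z' = code k a' b') (z' <> code k a' b').
Proof.
  intros V1 V2 V3. eapply brel_iff.
  - unfold is_code. apply (brel_the_num k w _
      (fun n => exists q, q = op a' b' /\ z' = op n q) (fun n => forall q, q <> op a' b' \/ z' <> op n q)).
    eapply frel_iff; [brl| |]; reflexivity.
  - unfold code. split; [intros (q & -> & E); exact E|intros E; eexists; split; [reflexivity|exact E]].
  - unfold code. split.
    + intros H. destruct (H (op a' b')); tauto.
    + intros H q. destruct (classic (q = op a' b')) as [->|]; auto.
Qed.

Lemma frel_tuples w A n m P : crel w A P -> vrel w n m -> crel w (tuples A n) (tup P m).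
Proof.
  intros HA V. eapply frel_iff.
  - unfold tuples. frel_var.
    apply brel_bang. eapply brelT_is_fun; [eassumption|apply frel_elem; eassumption|eassumption].
  - intros t; cbv beta. unfold tup, cl. tauto.
  - intros t; cbv beta. unfold tup, cl. tauto.
Qed.

Lemma frel_assignments w M m : vrel w M m -> cl m ->
  crel w (assignments M) (fun s => isfun s inom (fun a => a ε m)).
Proof.
  intros V C. eapply frel_iff.
  - unfold assignments. frel_var.
    apply brel_bang. eapply brelT_is_fun_cl; [eassumption|apply frel_omega|].
    eapply frel_iff; [apply frel_elem; eassumption|reflexivity|exact C].
  - reflexivity.
  - reflexivity.
Qed.

Lemma frel_elem_cl w M m : vrel w M m -> cl m -> crel w (elem M) (fun a => a ε m).
Proof. intros V C. eapply frel_iff; [apply frel_elem; eassumption|reflexivity|exact C]. Qed.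

(** The falsity of [update] looks at what is out of s; for classical s this is what is not in s. *)
Lemma brel_update w s i a s' i' a' phi P N : vrel w s s' -> vrel w i i' -> vrel w a a' -> cl s' ->
  frel w phi P N -> brel w (the (update s i a) phi) (P (upd s' i' a')) (N (upd s' i' a')).
Proof.
  intros V1 V2 V3 C H. apply brel_the_set; [apply isset_upd| |exact H].
  eapply frel_iff; [unfold update; brl| |].
  - intros z; cbv beta. unfold updP. split; (intros [E|(j & b & E & K)]; [left; exact E|right; exists j, b; tauto]).
  - intros z; cbv beta. unfold updP. split.
    + intros [E K] [E'|(j & b & E' & K1 & K2)]; [auto|].
      destruct (K j b) as [J|[J|J]]; [auto| |].
      * apply C in J. auto.
      * tauto.
    + intros K. split; [tauto|]. intros j b. apply NNPP. intros J. apply K. right. exists j, b.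
      rewrite (C (op j b)) in J. tauto.
Qed.

Lemma brel_inst w S p s i a S' p' s' i' a' : vrel w S S' -> vrel w p p' -> vrel w s s' ->
  vrel w i i' -> vrel w a a' -> cl s' ->
  brel w (inst S p s i a) (op p' (upd s' i' a') ε S') (out (op p' (upd s' i' a')) S').
Proof.
  intros V1 V2 V3 V4 V5 C. unfold inst.
  eapply (brel_update w s i a s' i' a' _ (fun u => op p' u ε S') (fun u => out (op p' u) S'));
    try eassumption.
  eapply frel_iff; [brl| |]; reflexivity.
Qed.

End FunctionTranslation.

Ltac brl_ext3 :=
  match goal with
  | |- frel _ (cprod _ _) _ _ => eapply frel_cprod
  | |- frel _ omega _ _ => apply frel_omega
  | |- frel _ (tuples _ _) _ _ => eapply frel_tuples
  | |- brel _ (is_code _ _ _ _) _ _ => eapply brel_is_code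
  | |- brel _ (the_num _ _) _ _ => eapply brel_the_num
  | |- brel _ (bot_code _) _ _ => unfold bot_code
  | |- brel _ (eq_code _ _ _) _ _ => unfold eq_code
  | |- brel _ (rel_code _ _ _) _ _ => unfold rel_code
  | |- brel _ (neg_code _ _) _ _ => unfold neg_code
  | |- brel _ (and_code _ _ _) _ _ => unfold and_code
  | |- brel _ (or_code _ _ _) _ _ => unfold or_code
  | |- brel _ (imp_code _ _ _) _ _ => unfold imp_code
  | |- brel _ (all_code _ _ _) _ _ => unfold all_code
  | |- brel _ (ex_code _ _ _) _ _ => unfold ex_code
  end.
Ltac brl_ext ::= first [brl_ext1 | brl_ext2 | brl_ext3].

(** * Translation of vocabularies, formulas and structures *)

Section Vocabulary.
Context {W : tfmodel} {HW : pzfc_model W}.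
Local Notation D := (dom W).
Implicit Type w : world W.

Definition vocrel w (Lf : vocab) (L : voc W) : Prop :=
  vrel w (consts Lf) (vC L) /\ vrel w (rels Lf) (vR L) /\ vrel w (arity Lf) (vA L).

Lemma vocrel_le w w' Lf L : wle w w' -> vocrel w Lf L -> vocrel w' Lf L.
Proof.
  intros H (V1 & V2 & V3). split; [|split]; eapply vrel_le; eassumption.
Qed.

(** An internal formula sees only the data of a vocabulary, whereas the record also contains proofs;
    proof irrelevance closes the gap. The same is done for structures below. *)
Lemma voc_eq (L L' : voc W) : vC L = vC L' -> vR L = vR L' -> vA L = vA L' -> L = L'.
Proof.
  destruct L, L'; simpl; intros -> -> ->. f_equal; apply proof_irrelevance.
Qed.

(** The clauses are translated in order, each using the earlier ones: the last one gets its domain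
    as a classical class from the third. *)
Lemma brelT_is_vocab w Lf c r a : vrel w (consts Lf) c -> vrel w (rels Lf) r ->
  vrel w (arity Lf) a ->
  brelT w (is_vocab Lf) (exists L : voc W, vC L = c /\ vR L = r /\ vA L = a).
Proof.
  intros V1 V2 V3. eapply brelT_iff.
  - unfold is_vocab. apply brelT_and; [brl|intros H1]. apply brelT_and; [brl|intros H2].
    apply brelT_and; [brl|intros H3]. apply brelT_and; [brl|intros H4].
    apply brelT_is_fun_cl; [exact V3|apply frel_elem_cl; [exact V2|exact H3]|apply frel_omega].
  - cbv beta. split.
    + intros (H1 & H2 & H3 & H4 & H5). exists (Voc c r a H1 H2 H3 H4 H5). auto.
    + intros (L & <- & <- & <-). destruct L; simpl. auto.
Qed.

Section Fixed.
Context (Lf : vocab) (L : voc W).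

Lemma brel_has_arity w R n r m : vocrel w Lf L -> vrel w R r -> vrel w n m ->
  brel w (has_arity Lf R n) (arr L r m) (~ arr L r m).
Proof.
  intros (V1 & V2 & V3) VR Vn. eapply brel_iff; [unfold has_arity; brl| |]; cbv beta.
  - reflexivity.
  - unfold arr. rewrite (vR_cl L r), (proj1 (vA_fun L) (op r m)). tauto.
Qed.

Lemma brel_is_varterm w t i t' i' : vrel w t t' -> vrel w i i' ->
  brel w (is_varterm t i) (inom i' /\ t' = op (num 0) i') (~ (inom i' /\ t' = op (num 0) i')).
Proof.
  intros V1 V2. eapply brel_iff.
  - unfold is_varterm. apply brel_and; [brl|].
    apply (brel_the_num 0 w _ (fun k => t' = op k i') (fun k => t' <> op k i')).
    eapply frel_iff; [brl| |]; reflexivity.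
  - reflexivity.
  - cbv beta. tauto.
Qed.

Lemma brel_is_constterm w t c t' c' : vocrel w Lf L -> vrel w t t' -> vrel w c c' ->
  brel w (is_constterm Lf t c) (c' ε vC L /\ t' = op (num 1) c')
    (~ (c' ε vC L /\ t' = op (num 1) c')).
Proof.
  intros (V & _ & _) V1 V2. eapply brel_iff.
  - unfold is_constterm. apply brel_and; [brl|].
    apply (brel_the_num 1 w _ (fun k => t' = op k c') (fun k => t' <> op k c')).
    eapply frel_iff; [brl| |]; reflexivity.
  - reflexivity.
  - cbv beta. rewrite (vC_cl L c'). tauto.
Qed.

Lemma frel_term w : vocrel w Lf L -> crel w (term Lf) (tm L).
Proof.
  intros V. eapply frel_iff.
  - unfold term. apply frel_intro. intro_var. apply (vocrel_le _ _ _ _ L0) in V.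
    do 2 eexists. split; [|split; reflexivity].
    apply brel_or; apply brel_ex; frel_var; apply (vocrel_le _ _ _ _ L1) in V;
      [apply brel_is_varterm; eassumption|apply brel_is_constterm; eassumption].
  - intros t; cbv beta. reflexivity.
  - intros t; cbv beta. split.
    + intros [H1 H2] [(i & K)|(c & K)]; [exact (H1 i K)|exact (H2 c K)].
    + intros H. split; intros x K; apply H; [left|right]; exists x; exact K.
Qed.

End Fixed.
End Vocabulary.

Ltac lift L ::=
  repeat match goal with
  | H : vrel ?w _ _ |- _ => match type of L with wle w _ => apply (vrel_le _ _ _ _ L) in H end
  | H : base ?w _ |- _ => match type of L with wle w _ => apply (base_le _ _ _ L) in H end
  | H : frel ?w _ _ _ |- _ => match type of L with wle w _ => apply (frel_le _ _ _ _ _ L) in H end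
  | H : frelT ?w _ _ |- _ => match type of L with wle w _ => apply (frelT_le _ _ _ _ L) in H end
  | H : vocrel ?w _ _ |- _ => match type of L with wle w _ => apply (vocrel_le _ _ _ _ L) in H end
  end.

Ltac brl_ext4 :=
  match goal with
  | |- brel _ (has_arity _ _ _) _ _ => eapply brel_has_arity
  | |- brel _ (is_varterm _ _) _ _ => eapply brel_is_varterm
  | |- brel _ (is_constterm _ _ _) _ _ => eapply brel_is_constterm
  | |- frel _ (term _) _ _ => eapply frel_term
  end.
Ltac brl_ext ::= first [brl_ext1 | brl_ext2 | brl_ext3 | brl_ext4].

Lemma and_iff_both (A B A' B' : Prop) : (A <-> A') -> (B <-> B') -> (A /\ B <-> A' /\ B').
Proof. tauto. Qed.

Lemma iff_both (A B A' B' : Prop) : (A <-> A') -> (B <-> B') -> ((A <-> B) <-> (A' <-> B')).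
Proof. tauto. Qed.

Section FormulaTranslation.
Context {W : tfmodel} {HW : pzfc_model W}.
Local Notation D := (dom W).
Implicit Type w : world W.
Context (Lf : vocab) (L : voc W).

Lemma brelT_formula_closed w X P N : vocrel w Lf L -> frel w X P N ->
  brelT w (formula_closed Lf X) (fclosed L P).
Proof.
  intros V HX. eapply brelT_iff.
  - unfold formula_closed. brl.
  - cbv beta. unfold fclosed.
    apply and_iff_both; [|repeat apply and_iff_both].
    + split; [intros H; apply H; reflexivity|intros H z ->; exact H].
    + split; [intros H t u Ht Hu; apply (H _ t u); auto|intros H z t u (Ht & Hu & ->); auto].
    + split; [intros H r n t Hr Ht; apply (H _ r n t); auto|intros H z r n t (Hr & Ht & ->); eauto].
    + split; [intros H p Hp; apply (H _ p); auto|intros H z p (Hp & ->); auto].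
    + split; [intros H p q Hp Hq; apply (H _ p q); auto|intros H z p q (Hp & Hq & ->); auto].
    + split; [intros H p q Hp Hq; apply (H _ p q); auto|intros H z p q (Hp & Hq & ->); auto].
    + split; [intros H p q Hp Hq; apply (H _ p q); auto|intros H z p q (Hp & Hq & ->); auto].
    + split; [intros H p q Hp Hq; apply (H _ p q); auto|intros H z p q (Hp & Hq & ->); auto].
    + split; [intros H p q Hp Hq; apply (H _ p q); auto|intros H z p q (Hp & Hq & ->); auto].
Qed.

Lemma frel_formula w : vocrel w Lf L -> crel w (formula Lf) (fm L).
Proof.
  intros V. eapply frel_iff.
  - unfold formula. frel_var.
    apply brel_all. frel_var.
    apply brel_imp; [|brl]. apply brelT_and; [brl|intros _].
    eapply brelT_formula_closed; [eassumption|apply frel_elem; eassumption].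
  - intros z; cbv beta. unfold fm. split; intros H X; specialize (H X); tauto.
  - intros z; cbv beta. split.
    + intros (X & [H1 H2] & K) J. apply (H1 z) in K. apply K, J; assumption.
    + intros H. apply NNPP. intros K. apply H. intros X H1 H2. apply NNPP. intros J.
      apply K. exists X. split; [auto|]. apply H1, J.
Qed.

Lemma frel_rel_of w I R i r : vrel w I i -> vrel w R r ->
  frel w (rel_of I R) (fun t => op r t ε i) (fun t => out (op r t) i).
Proof. intros V1 V2. eapply frel_iff; [unfold rel_of; brl| |]; reflexivity. Qed.

Definition RSm (m y : D) : Prop :=
  exists r n v, y = op r v /\ arr L r n /\ tup (fun a => a ε m) n v.

Lemma frel_rel_space w M m : vocrel w Lf L -> vrel w M m -> cl m ->
  crel w (rel_space Lf M) (RSm m).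
Proof.
  intros V VM C.
  assert (HM : crel w (elem M) (fun a => a ε m)) by (apply frel_elem_cl; assumption).
  eapply frel_iff.
  - unfold rel_space. frel_var.
    do 3 (apply brel_ex; frel_var).
    apply brel_and; [brl|]. apply brel_and; [brl|].
    eapply brel_inc; [|eassumption]. eapply frel_tuples; [exact HM|eassumption].
  - intros z; cbv beta. reflexivity.
  - intros z; cbv beta. split.
    + intros H (r & n & v & E & Hr & Hv). destruct (H r n v); tauto.
    + intros H r n v. apply NNPP. intros K. apply H. exists r, n, v. tauto.
Qed.

End FormulaTranslation.

Lemma str_eq {W : tfmodel} (L : voc W) (X Y : str L) :
  sM L X = sM L Y -> sK L X = sK L Y -> X = Y.
Proof.
  destruct X, Y; simpl; intros -> ->. f_equal; apply proof_irrelevance.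
Qed.

Ltac wle_chain := first [eassumption | eapply wle_trans; [eassumption|wle_chain] | apply wle_refl].

Ltac brl_ext5 :=
  match goal with
  | |- frel _ (formula _) _ _ => eapply frel_formula
  | |- frel _ (rel_of _ _) _ _ => eapply frel_rel_of
  | |- frel _ (assignments _) _ _ => eapply frel_assignments; [eassumption|apply sM_cl]
  | |- frel _ (tuples (elem _) _) _ _ =>
      eapply frel_tuples; [apply frel_elem_cl; [eassumption|apply sM_cl]|eassumption]
  end.
Ltac brl_ext ::= first [brl_ext5 | brl_ext1 | brl_ext2 | brl_ext3 | brl_ext4].

Section StructureTranslation.
Context {W : tfmodel} {HW : pzfc_model W}.
Local Notation D := (dom W).
Implicit Type w : world W.
Context (Lf : vocab) (L : voc W) (M K : var) (X : str L).

Lemma brelT_value w s t a s' t' a' : vocrel w Lf L -> vrel w K (sK L X) ->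
  vrel w s s' -> vrel w t t' -> vrel w a a' ->
  brelT w (value Lf K s t a) (val L X s' t' a').
Proof.
  intros V VK Vs Vt Va. eapply brelT_iff; [unfold value; brl|reflexivity].
Qed.

Lemma brelT_values w s n t r s' n' t' r' : vocrel w Lf L -> vrel w K (sK L X) ->
  vrel w s s' -> vrel w n n' -> vrel w t t' -> vrel w r r' ->
  brelT w (values Lf K s n t r) (vals L X s' n' t' r').
Proof.
  intros V VK Vs Vn Vt Vr. eapply brelT_iff.
  - unfold values. do 3 (apply brelT_all; frelT_var).
    apply brelT_imp; [brl|intros _]. apply brelT_value; eassumption.
  - reflexivity.
Qed.

Inductive shrel w : shape -> dshape D -> Prop :=
| shrel_bot : shrel w SBot HBot
| shrel_eq a b a' b' : vrel w a a' -> vrel w b b' -> shrel w (SEq a b) (HEq a' b')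
| shrel_rel a b a' b' : vrel w a a' -> vrel w b b' -> shrel w (SRel a b) (HRel a' b')
| shrel_neg a a' : vrel w a a' -> shrel w (SNeg a) (HNeg a')
| shrel_and a b a' b' : vrel w a a' -> vrel w b b' -> shrel w (SAnd a b) (HAnd a' b')
| shrel_or a b a' b' : vrel w a a' -> vrel w b b' -> shrel w (SOr a b) (HOr a' b')
| shrel_imp a b a' b' : vrel w a a' -> vrel w b b' -> shrel w (SImp a b) (HImp a' b')
| shrel_all a b a' b' : vrel w a a' -> vrel w b b' -> shrel w (SAll a b) (HAll a' b')
| shrel_ex a b a' b' : vrel w a a' -> vrel w b b' -> shrel w (SEx a b) (HEx a' b').

(** Restricting to assignments makes s classical, as [inst] in the quantifier clauses requires. *)
Definition clrel w (clause : var -> var -> shape -> bform) (Q : D -> D -> dshape D -> Prop) : Prop :=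
  forall w' z s c z' s' c', wle w w' -> vrel w' z z' -> vrel w' s s' -> asg L X s' ->
    shrel w' c c' -> brelT w' (clause z s c) (Q z' s' c').

End StructureTranslation.

Ltac brl_ext6 :=
  match goal with
  | |- brelT _ (value _ _ _ _ _) _ => eapply brelT_value
  | |- brelT _ (values _ _ _ _ _ _) _ => eapply brelT_values
  | H : clrel _ _ _ ?clause _ |- brelT _ (?clause _ _ _) _ =>
      eapply H; [wle_chain|eassumption|eassumption|eassumption|econstructor; eassumption]
  | H : asg _ _ ?s |- cl ?s => exact (proj1 H)
  | |- brel _ (inst _ _ _ _ _) _ _ => eapply brel_inst
  end.
Ltac brl_ext ::= first [brl_ext6 | brl_ext5 | brl_ext1 | brl_ext2 | brl_ext3 | brl_ext4].

Section RecursionTranslation.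
Context {W : tfmodel} {HW : pzfc_model W}.
Local Notation D := (dom W).
Implicit Type w : world W.
Context (Lf : vocab) (L : voc W) (M K : var) (X : str L).

Lemma brelT_recursion w clause Q : vocrel w Lf L -> vrel w M (sM L X) -> vrel w K (sK L X) ->
  clrel L X w clause Q ->
  brelT w (recursion Lf M K clause)
    (forall s z c, asg L X s -> fits L X s z c -> Q z s c).
Proof.
  intros V VM VK HC. eapply brelT_iff.
  - unfold recursion. brl.
  - cbv beta. split.
    + intros H s z c Hs Hc. destruct (H s Hs) as (C0 & C1 & C2 & C3 & C4 & C5 & C6 & C7 & C8).
      destruct c; simpl in Hc.
      * apply C0, Hc.
      * destruct Hc as (t & u & Hc). apply (C1 z t u); tauto.
      * destruct Hc as (n & t & Hc). apply (C2 z r n t); tauto.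
      * apply C3, Hc.
      * apply C4, Hc.
      * apply C5, Hc.
      * apply C6, Hc.
      * apply C7, Hc.
      * apply C8, Hc.
    + intros H s Hs. repeat split.
      * intros z Hz. apply H; [exact Hs|exact Hz].
      * intros z t u a b Hz. apply H; [exact Hs|]. exists t, u; tauto.
      * intros z r n t v Hz. apply H; [exact Hs|]. exists n, t; tauto.
      * intros z p; apply (H s z (HNeg p) Hs).
      * intros z p q; apply (H s z (HAnd p q) Hs).
      * intros z p q; apply (H s z (HOr p q) Hs).
      * intros z p q; apply (H s z (HImp p q) Hs).
      * intros z i p; apply (H s z (HAll i p) Hs).
      * intros z i p; apply (H s z (HEx i p) Hs).
Qed.

End RecursionTranslation.

(** * Translation of satisfaction, models and consequence *)

Section SatisfactionTranslation.
Context {W : tfmodel} {HW : pzfc_model W}.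
Local Notation D := (dom W).
Implicit Type w : world W.
Context (Lf : vocab) (L : voc W) (M K : var) (X : str L).

(** Strong equivalence compares truth with truth and falsity with falsity; this is where Tarski
    satisfaction splits into the T/F clauses. *)
Lemma clrel_tarski w I S i S' : vrel w M (sM L X) -> vrel w I i -> vrel w S S' ->
  clrel L X w (tarski_clause M I S) (fun z s c =>
    (op z s ε S' <-> tval L X (Itar i) (fun z s => op z s ε S') (fun z s => out (op z s) S') s c) /\
    (out (op z s) S' <->
      fval L X (Itar i) (fun z s => op z s ε S') (fun z s => out (op z s) S') s c)).
Proof.
  intros VM VI VS w' z s c z' s' c' LE Vz Vs Hs Hc. lift LE.
  destruct Hc; (eapply brelT_iff; [unfold tarski_clause; brl|]); cbv beta; simpl; try reflexivity.
  (* Only ∃ is left: its falsity clause mentions being out of M, which is non-membership as M is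
     classical. *)
  apply and_iff_both; [reflexivity|]. apply iff_both; [reflexivity|].
  split; intros J x; specialize (J x); rewrite (sM_cl L X x) in *; tauto.
Qed.

Lemma clrel_tf w T F T' F' Y P N E1 E2 : vrel w (tM Y) (sM L X) -> vrel w (tP Y) P ->
  vrel w (tN Y) N -> vrel w (tEP Y) E1 -> vrel w (tEN Y) E2 -> vrel w T T' -> vrel w F F' ->
  clrel L X w (tf_clause Y T F) (fun z s c =>
    (op z s ε T' <-> tval L X (Itf P N E1 E2) (fun z s => op z s ε T') (fun z s => op z s ε F') s c) /\
    (op z s ε F' <->
      fval L X (Itf P N E1 E2) (fun z s => op z s ε T') (fun z s => op z s ε F') s c)).
Proof.
  intros VM VP VN VE1 VE2 VT VF w' z s c z' s' c' LE Vz Vs Hs Hc. lift LE.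
  destruct Hc; (eapply brelT_iff; [unfold tf_clause; brl|]); cbv beta; simpl; try reflexivity.
  tauto.
Qed.

Lemma clrel_fol w I S i S' : vrel w M (sM L X) -> vrel w I i -> vrel w S S' ->
  clrel L X w (fol_clause M I S) (fun z s c =>
    op z s ε S' <->
    tval L X (Ifol i) (fun z s => op z s ε S') (fun z s => ~ op z s ε S') s c).
Proof.
  intros VM VI VS w' z s c z' s' c' LE Vz Vs Hs Hc. lift LE.
  destruct Hc; (eapply brelT_iff; [unfold fol_clause; brl|]); cbv beta; simpl; reflexivity.
Qed.

Lemma brelT_sub_FA w S S' : vocrel w Lf L -> vrel w M (sM L X) -> vrel w S S' ->
  brelT w (S ⊆ cprod (formula Lf) (assignments M)) (subc S' (FA L X)).
Proof.
  intros V VM VS. eapply brelT_iff.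
  - eapply brelT_brel, brel_csub; [apply frel_elem, VS|].
    apply frel_cprod_cl; [apply frel_formula, V|].
    apply frel_assignments; [exact VM|apply sM_cl].
  - unfold subc, FA. cbv beta. split.
    + intros H. split; intros y; apply H.
    + intros [H1 H2] y. split; [apply H1|apply H2].
Qed.

Lemma brelT_holds w S p S' p' : vrel w M (sM L X) -> vrel w S S' -> vrel w p p' ->
  brelT w (holds S M p) (forall s, asg L X s -> op p' s ε S').
Proof. intros VM VS Vp. eapply brelT_iff; [unfold holds; brl|reflexivity]. Qed.

Lemma brelT_tarski_holds w I p i p' : vocrel w Lf L -> vrel w M (sM L X) ->
  vrel w K (sK L X) -> vrel w I i -> vrel w p p' ->
  brelT w (tarski_holds Lf M K I p) (holds_tar L X i p').
Proof.
  intros V VM VK VI Vp. unfold tarski_holds, holds_tar.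
  apply brelT_ex. frelT_var.
  apply brelT_and; [|intros _; apply brelT_holds; assumption].
  eapply brelT_brel, brel_bang. unfold tarski_sat. apply brelT_and.
  - apply brelT_sub_FA; assumption.
  - intros _. apply brelT_recursion; try assumption. apply clrel_tarski; assumption.
Qed.

End SatisfactionTranslation.

Section HoldsTranslation.
Context {W : tfmodel} {HW : pzfc_model W}.
Local Notation D := (dom W).
Implicit Type w : world W.
Context (Lf : vocab) (L : voc W) (X : str L).

Lemma brelT_tf_holds w Y p P N E1 E2 p' : vocrel w Lf L -> vrel w (tM Y) (sM L X) ->
  vrel w (tK Y) (sK L X) -> vrel w (tP Y) P -> vrel w (tN Y) N -> vrel w (tEP Y) E1 ->
  vrel w (tEN Y) E2 -> vrel w p p' ->
  brelT w (tf_holds Lf Y p) (holds_tf L X P N E1 E2 p').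
Proof.
  intros V VM VK VP VN VE1 VE2 Vp. unfold tf_holds, holds_tf.
  do 2 (apply brelT_ex; frelT_var).
  apply brelT_and; [|intros _; apply brelT_holds; assumption].
  eapply brelT_brel, brel_bang. unfold tf_sat.
  apply brelT_and; [brl|intros _]. apply brelT_and; [apply brelT_sub_FA; assumption|intros _].
  apply brelT_and; [brl|intros _]. apply brelT_and; [apply brelT_sub_FA; assumption|intros _].
  apply brelT_recursion; try assumption. apply clrel_tf; assumption.
Qed.

Lemma brelT_fol_holds w M K I p i p' : vocrel w Lf L -> vrel w M (sM L X) ->
  vrel w K (sK L X) -> vrel w I i -> vrel w p p' ->
  brelT w (fol_holds Lf M K I p) (holds_fol L X i p').
Proof.
  intros V VM VK VI Vp. unfold fol_holds, holds_fol.
  apply brelT_ex. frelT_var.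
  apply brelT_and; [|intros _; apply brelT_holds; assumption].
  eapply brelT_brel, brel_bang. unfold fol_sat.
  apply brelT_and; [brl|intros _]. apply brelT_and; [apply brelT_sub_FA; assumption|intros _].
  apply brelT_recursion; try assumption. apply clrel_fol; assumption.
Qed.

End HoldsTranslation.

Section ModelTranslation.
Context {W : tfmodel} {HW : pzfc_model W}.
Local Notation D := (dom W).
Implicit Type w : world W.
Context (Lf : vocab) (L : voc W).

Lemma brelT_sub w S A S' P : vrel w S S' -> crel w A P -> brelT w (S ⊆ A) (subc S' P).
Proof.
  intros V HA. eapply brelT_iff; [brl|]. unfold subc. cbv beta. split.
  - intros H. split; intros y; apply H.
  - intros [H1 H2] y. split; [apply H1|apply H2].
Qed.

(** The truth condition of a consequence relation may depend on the data of a
    structure but not on the proofs contained in it. *)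
Lemma str_forall (X0 : str L) (Q : str L -> Prop) :
  Q X0 <-> forall X, sM L X = sM L X0 -> sK L X = sK L X0 -> Q X.
Proof.
  split; [intros H X E1 E2; rewrite (str_eq L X X0 E1 E2); exact H|auto].
Qed.

(** A structure is available only once the first three clauses are true, so q is translated for
    every structure with the data m and k. *)
Lemma brelT_structure w M K q m k (Q : str L -> Prop) : vocrel w Lf L -> vrel w M m ->
  vrel w K k -> (forall X, sM L X = m -> sK L X = k -> brelT w q (Q X)) ->
  brelT w (classical M ∧ (∃ a, a ∈ M) ∧ is_fun K (consts Lf) M ∧ q)
    (exists X : str L, sM L X = m /\ sK L X = k /\ Q X).
Proof.
  intros V VM VK HQ.
  apply (brelT_iff _ _ (cl m /\ (exists a, a ε m) /\
    isfun k (fun c => c ε vC L) (fun a => a ε m) /\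
    forall X : str L, sM L X = m -> sK L X = k -> Q X)).
  - apply brelT_and; [eapply brelT_iff; [brl|reflexivity]|intros H1].
    apply brelT_and; [eapply brelT_iff; [brl|reflexivity]|intros H2].
    apply brelT_and; [|intros H3].
    + apply brelT_is_fun_cl; [exact VK| |apply frel_elem_cl; [exact VM|exact H1]].
      apply frel_elem_cl; [apply V|apply vC_cl].
    + eapply brelT_iff; [apply (HQ (Str L m k H1 H2 H3)); reflexivity|].
      apply (str_forall (Str L m k H1 H2 H3)).
  - split.
    + intros (H1 & H2 & H3 & H4). exists (Str L m k H1 H2 H3). auto.
    + intros (X & <- & <- & H). split; [apply sM_cl|]. split; [apply sM_ne|].
      split; [apply sK_fun|apply str_forall, H].
Qed.

Lemma brelT_is_tarski w M K I m k i : vocrel w Lf L -> vrel w M m -> vrel w K k ->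
  vrel w I i -> brelT w (is_tarski Lf M K I)
    (exists X : str L, sM L X = m /\ sK L X = k /\ subc i (RS L X)).
Proof.
  intros V VM VK VI. apply brelT_structure; try assumption. intros X <- <-.
  apply brelT_sub; [exact VI|apply frel_rel_space; [exact V|exact VM|apply sM_cl]].
Qed.

Lemma brelT_is_fol w M K I m k i : vocrel w Lf L -> vrel w M m -> vrel w K k ->
  vrel w I i -> brelT w (is_fol Lf M K I)
    (exists X : str L, sM L X = m /\ sK L X = k /\ cl i /\ subc i (RS L X)).
Proof.
  intros V VM VK VI. apply brelT_structure; try assumption. intros X <- <-.
  apply brelT_and; [eapply brelT_iff; [brl|reflexivity]|intros _].
  apply brelT_sub; [exact VI|apply frel_rel_space; [exact V|exact VM|apply sM_cl]].
Qed.

Lemma brelT_is_tf w Y m k P N E1 E2 : vocrel w Lf L -> vrel w (tM Y) m -> vrel w (tK Y) k ->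
  vrel w (tP Y) P -> vrel w (tN Y) N -> vrel w (tEP Y) E1 -> vrel w (tEN Y) E2 ->
  brelT w (is_tf Lf Y)
    (exists X : str L, sM L X = m /\ sK L X = k /\ is_tfs L X P N E1 E2).
Proof.
  intros V VM VK VP VN VE1 VE2. apply brelT_structure; try assumption. intros X <- <-.
  assert (HM : crel w (elem (tM Y)) (fun a => a ε sM L X))
    by (apply frel_elem_cl; [exact VM|apply sM_cl]).
  assert (HR : crel w (rel_space Lf (tM Y)) (RS L X))
    by (apply frel_rel_space; [exact V|exact VM|apply sM_cl]).
  assert (HE : crel w (cprod (tM Y) (tM Y)) (MM L X)) by (apply frel_cprod_cl; exact HM).
  eapply brelT_iff.
  - do 4 (apply brelT_and; [brl|intros _]; apply brelT_and; [apply brelT_sub; eassumption|intros _]).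
    clear HM HR HE. brl.
  - reflexivity.
Qed.

(** The formula quantifies over arbitrary sets, [consistent] only over tuples and pairs from the
    domain. [is_tfs] bridges this: the interpretations are classical and confined to the domain. *)
Lemma brelT_is_consistent w Y (X : str L) P N E1 E2 : vocrel w Lf L ->
  vrel w (tP Y) P -> vrel w (tN Y) N -> vrel w (tEP Y) E1 -> vrel w (tEN Y) E2 ->
  is_tfs L X P N E1 E2 ->
  brelT w (is_consistent Lf Y) (consistent L X P N E1 E2).
Proof.
  intros (_ & V & _) VP VN VE1 VE2 (P1 & P2 & N1 & N2 & C1 & S1 & C2 & S2 & _).
  eapply brelT_iff; [unfold is_consistent; brl|]. cbv beta. split.
  - intros [H1 H2]. split; simpl.
    + intros a b Ha Hb K. apply (H2 (op a b)), K.
    + intros r n v [Hr _] _ K. apply (H1 r Hr v), K.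
  - intros [H1 H2]. simpl in H1, H2. split.
    + intros r Hr v. rewrite (P1 (op r v)), (N1 (op r v)).
      assert (K : ~ (op r v ε P /\ op r v ε N)).
      { intros K. destruct (proj1 P2 _ (proj1 K)) as (r' & n & v' & E & Hrn & Hv).
        apply op_inj in E. destruct E; subst r' v'. exact (H2 r n v Hrn Hv K). }
      tauto.
    + intros y. rewrite (C1 y), (C2 y).
      assert (K : ~ (y ε E1 /\ y ε E2)).
      { intros K. destruct (proj1 S1 _ (proj1 K)) as (a & b & -> & Ha & Hb). exact (H1 a b Ha Hb K). }
      tauto.
Qed.

Lemma brelT_is_complete w Y (X : str L) P N E1 E2 : vocrel w Lf L -> vrel w (tM Y) (sM L X) ->
  vrel w (tP Y) P -> vrel w (tN Y) N -> vrel w (tEP Y) E1 -> vrel w (tEN Y) E2 ->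
  is_tfs L X P N E1 E2 ->
  brelT w (is_complete Lf Y) (complete L X P N E1 E2).
Proof.
  intros V VM VP VN VE1 VE2 (P1 & P2 & N1 & N2 & C1 & S1 & C2 & S2 & _).
  assert (HM : crel w (elem (tM Y)) (fun a => a ε sM L X)) by (apply frel_elem_cl; [exact VM|apply sM_cl]).
  assert (HE : crel w (cprod (tM Y) (tM Y)) (MM L X)) by (apply frel_cprod_cl; exact HM).
  eapply brelT_iff; [unfold is_complete; brl|]. cbv beta. split.
  - intros [H1 H2]. split; simpl.
    + intros a b Ha Hb. apply (H2 (op a b)), MM_op. auto.
    + intros r n v Hr Hv. apply (H1 r n Hr v), Hv.
  - intros [H1 H2]. simpl in H1, H2. split.
    + intros r n Hr v. rewrite (P1 (op r v)), (N1 (op r v)).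
      assert (K : op r v ε P \/ op r v ε N -> tup (fun a => a ε sM L X) n v).
      { intros K. assert (J : RS L X (op r v)) by (destruct K as [K|K]; [apply P2, K|apply N2, K]).
        destruct J as (r' & n' & v' & E & Hrn & Hv). apply op_inj in E. destruct E; subst r' v'.
        rewrite (arr_fun L r n n' Hr Hrn). exact Hv. }
      specialize (H2 r n v Hr). tauto.
    + intros y. rewrite (C1 y), (C2 y).
      assert (K : y ε E1 \/ y ε E2 -> MM L X y) by (intros [K|K]; [apply S1, K|apply S2, K]).
      assert (J : MM L X y -> y ε E1 \/ y ε E2) by (intros (a & b & -> & Ha & Hb); auto).
      tauto.
Qed.

Lemma brelT_conseq (md : var -> var -> var -> bform) (hd : var -> var -> var -> var -> bform)
    (R : str L -> D -> Prop) (h : str L -> D -> D -> Prop) w Sigma phi sigma f :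
  (forall w M K I m k i, vocrel w Lf L -> vrel w M m -> vrel w K k -> vrel w I i ->
    brelT w (md M K I) (exists X : str L, sM L X = m /\ sK L X = k /\ R X i)) ->
  (forall w M K I p (X : str L) i p', vocrel w Lf L -> vrel w M (sM L X) -> vrel w K (sK L X) ->
    vrel w I i -> vrel w p p' -> brelT w (hd M K I p) (h X i p')) ->
  vocrel w Lf L -> vrel w Sigma sigma -> vrel w phi f ->
  brelT w (∀ M K I, md M K I → ((∀ p, p ∈ Sigma → hd M K I p) → hd M K I phi))
    (forall X i, R X i -> (forall p, p ε sigma -> h X i p) -> h X i f).
Proof.
  intros Hm Hh V VS Vp. apply (brelT_iff _ _ (forall m k i,
    (exists X : str L, sM L X = m /\ sK L X = k /\ R X i) ->
    forall X : str L, sM L X = m -> sK L X = k ->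
      (forall p, p ε sigma -> h X i p) -> h X i f)).
  - do 3 (apply brelT_all; intro_var).
    apply brelT_imp; [apply Hm; assumption|].
    intros (X & <- & <- & _).
    eapply brelT_iff; [|apply (str_forall X (fun X =>
      (forall p, p ε sigma -> h X a1 p) -> h X a1 f))].
    apply brelT_imp; [|intros _; apply Hh; assumption].
    apply brelT_all; intro_var.
    apply brelT_imp; [eapply brelT_iff; [brl|reflexivity]|intros _; apply Hh; assumption].
  - split.
    + intros H X i HX. apply (H (sM L X) (sK L X) i); [exists X; auto|reflexivity|reflexivity].
    + intros H m k i (X0 & <- & <- & HX) X EM EK. rewrite (str_eq L X X0 EM EK).
      apply (H X0 i HX).
Qed.

Lemma brelT_tarski_conseq w Sigma phi sigma f : vocrel w Lf L -> vrel w Sigma sigma ->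
  vrel w phi f -> brelT w (tarski_conseq Lf Sigma phi) (tar_csq L sigma f).
Proof.
  apply (brelT_conseq (is_tarski Lf) (tarski_holds Lf) (fun X i => subc i (RS L X)) (holds_tar L));
    intros; [apply brelT_is_tarski|apply brelT_tarski_holds]; assumption.
Qed.

Lemma brelT_fol_conseq w Sigma phi sigma f : vocrel w Lf L -> vrel w Sigma sigma ->
  vrel w phi f -> brelT w (fol_conseq Lf Sigma phi) (fol_csq L sigma f).
Proof.
  apply (brelT_conseq (is_fol Lf) (fol_holds Lf) (fun X i => cl i /\ subc i (RS L X)) (holds_fol L));
    intros; [apply brelT_is_fol|apply brelT_fol_holds]; assumption.
Qed.

Lemma brelT_tf_conseq (pre : tfs -> bform)
    (C : forall L : voc W, str L -> D -> D -> D -> D -> Prop) w Sigma phi sigma f :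
  (forall w Y m k P N E1 E2, vocrel w Lf L -> vrel w (tM Y) m -> vrel w (tK Y) k ->
    vrel w (tP Y) P -> vrel w (tN Y) N -> vrel w (tEP Y) E1 -> vrel w (tEN Y) E2 ->
    brelT w (pre Y) (exists X : str L,
      (sM L X = m /\ sK L X = k) /\ is_tfs L X P N E1 E2 /\ C L X P N E1 E2)) ->
  vocrel w Lf L -> vrel w Sigma sigma -> vrel w phi f ->
  brelT w (∀ M K P N EP EN, pre (TFS M K P N EP EN) →
      (tf_holds_all Lf (TFS M K P N EP EN) Sigma → tf_holds Lf (TFS M K P N EP EN) phi))
    (tf_csq C L sigma f).
Proof.
  intros HC V VS Vp. apply (brelT_iff _ _ (forall m k P N E1 E2,
    (exists X : str L, (sM L X = m /\ sK L X = k) /\ is_tfs L X P N E1 E2 /\ C L X P N E1 E2) ->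
    forall X : str L, sM L X = m -> sK L X = k ->
      (forall p, p ε sigma -> holds_tf L X P N E1 E2 p) -> holds_tf L X P N E1 E2 f)).
  - do 6 (apply brelT_all; intro_var).
    apply brelT_imp; [apply HC; assumption|].
    intros (X & [<- <-] & _).
    eapply brelT_iff; [|apply (str_forall X (fun X =>
      (forall p, p ε sigma -> holds_tf L X a1 a2 a3 a4 p) -> holds_tf L X a1 a2 a3 a4 f))].
    apply brelT_imp; [|intros _; apply brelT_tf_holds; assumption].
    apply brelT_all; intro_var.
    apply brelT_imp; [eapply brelT_iff; [brl|reflexivity]|intros _; apply brelT_tf_holds; assumption].
  - unfold tf_csq. split.
    + intros H X P N E1 E2 HX. apply (H (sM L X) (sK L X)); [exists X; auto|reflexivity|reflexivity].
    + intros H m k P N E1 E2 (X0 & [<- <-] & HX) X EM EK. rewrite (str_eq L X X0 EM EK).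
      apply (H X0), HX.
Qed.

Lemma brelT_bs4_conseq w Sigma phi sigma f : vocrel w Lf L -> vrel w Sigma sigma ->
  vrel w phi f -> brelT w (bs4_conseq Lf Sigma phi) (tf_csq unrestricted L sigma f).
Proof.
  apply (brelT_tf_conseq (is_tf Lf)). intros.
  eapply brelT_iff; [apply brelT_is_tf; eassumption|].
  unfold unrestricted. split; intros (X & HX); exists X; tauto.
Qed.

Lemma brelT_conseq_in (Cf : vocab -> tfs -> bform)
    (C : forall L : voc W, str L -> D -> D -> D -> D -> Prop) w Sigma phi sigma f :
  (forall w' Y (X : str L) P N E1 E2, vocrel w' Lf L -> vrel w' (tM Y) (sM L X) ->
    vrel w' (tP Y) P -> vrel w' (tN Y) N -> vrel w' (tEP Y) E1 -> vrel w' (tEN Y) E2 ->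
    is_tfs L X P N E1 E2 -> brelT w' (Cf Lf Y) (C L X P N E1 E2)) ->
  vocrel w Lf L -> vrel w Sigma sigma ->
  vrel w phi f -> brelT w (tf_conseq_in Cf Lf Sigma phi) (tf_csq C L sigma f).
Proof.
  intros HC. apply (brelT_tf_conseq (fun Y => is_tf Lf Y ∧ Cf Lf Y)). intros.
  apply (brelT_iff _ _ ((exists X : str L, sM L X = m /\ sK L X = k /\ is_tfs L X P N E1 E2) /\
    forall X : str L, sM L X = m -> sK L X = k -> C L X P N E1 E2)).
  - apply brelT_and; [apply brelT_is_tf; assumption|].
    intros (X & <- & <- & HX).
    eapply brelT_iff; [|apply (str_forall X (fun X => C L X P N E1 E2))].
    apply HC; assumption.
  - split.
    + intros [(X & EM & EK & HX) H']. exists X. auto.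
    + intros (X0 & [EM EK] & HX & H'). split; [exists X0; auto|].
      intros X EM' EK'. rewrite (str_eq L X X0); congruence.
Qed.

Lemma brelT_k3_conseq w Sigma phi sigma f : vocrel w Lf L -> vrel w Sigma sigma ->
  vrel w phi f -> brelT w (k3_conseq Lf Sigma phi) (tf_csq consistent L sigma f).
Proof.
  apply brelT_conseq_in. intros. apply brelT_is_consistent; assumption.
Qed.

Lemma brelT_lfi1_conseq w Sigma phi sigma f : vocrel w Lf L -> vrel w Sigma sigma ->
  vrel w phi f -> brelT w (lfi1_conseq Lf Sigma phi) (tf_csq complete L sigma f).
Proof.
  apply brelT_conseq_in. intros. apply brelT_is_complete; assumption.
Qed.

End ModelTranslation.

(** * The anti-classicality axioms and the theorem *)

Section Main.
Context {W : tfmodel} {HW : pzfc_model W}.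
Local Notation D := (dom W).
Implicit Type w : world W.
Local Notation Glut := (Glut (W := W)).
Local Notation Gap := (Gap (W := W)).

(** As with structures, a vocabulary is available only after [is_vocab] is known to be true, so the
    quantifiers are first read as ranging over its three components. *)
Lemma brelT_tarski_is w conseq (csq : voc W -> D -> D -> Prop) :
  (forall w' Lf L Sigma phi sigma f, vocrel w' Lf L -> vrel w' Sigma sigma -> vrel w' phi f ->
    brelT w' (conseq Lf Sigma phi) (csq L sigma f)) ->
  brelT w (tarski_is conseq) (tar_is csq).
Proof.
  intros HC. apply (brelT_iff _ _ (forall c r a,
    (exists L : voc W, vC L = c /\ vR L = r /\ vA L = a) ->
    forall L : voc W, vC L = c -> vR L = r -> vA L = a ->
    forall sigma, subc sigma (fm L) -> forall f, fm L f ->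
      (tar_csq L sigma f <-> csq L sigma f))).
  - unfold tarski_is. do 3 (apply brelT_all; intro_var). cbv zeta.
    apply brelT_imp; [apply brelT_is_vocab; simpl; assumption|].
    intros (L' & <- & <- & <-).
    assert (VL : vocrel w2 (Vocab x x0 x1) L') by (split; [|split]; assumption).
    apply (brelT_iff _ _ (forall sigma, subc sigma (fm L') -> forall f, fm L' f ->
      (tar_csq L' sigma f <-> csq L' sigma f))).
    + apply brelT_all; intro_var.
      apply brelT_imp; [apply brelT_sub; [assumption|apply frel_formula; assumption]|intros _].
      apply brelT_all; intro_var. apply brelT_imp.
      * eapply brelT_brel, brel_inc; [apply frel_formula; eassumption|eassumption].
      * intros _. apply brelT_iff_form; [apply brelT_tarski_conseq; assumption|].
        apply HC; assumption.
    + split; [intros H L'' E1 E2 E3; rewrite (voc_eq L'' L' E1 E2 E3); exact H|auto].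
  - unfold tar_is. split.
    + intros H L. apply (H (vC L) (vR L) (vA L)); try reflexivity. exists L; auto.
    + intros H c r a _ L _ _ _. apply H.
Qed.

(** ∼ turns the inclusion into a witness z in x^! for which z ∈ x^? is false, and the latter says
    that z is out of x. *)
Lemma brelT_glut w : brelT w (∃ x, ∼ (cbang x ⊆ cquest x)) Glut.
Proof. eapply brelT_iff; [brl|]. reflexivity. Qed.

(** Here the witness z is in x^?, so it is not out of x, and z ∈ x^! is false, so it is not in x. *)
Lemma brelT_gap w : brelT w (∃ x, ∼ (cquest x ⊆ cbang x)) Gap.
Proof.
  eapply brelT_iff; [brl|]. cbv beta. unfold Gap.
  split; intros (x & z & H); exists x, z; tauto.
Qed.

Lemma brelT_noglut w : brelT w (∀ x, cbang x ⊆ cquest x) (~ Glut).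
Proof.
  eapply brelT_iff; [brl|]. cbv beta. unfold Glut. split.
  - intros H (x & z & K). destruct (H x z). tauto.
  - intros H x z. assert (K : ~ (z ε x /\ out z x)) by (intros K; apply H; exists x, z; exact K). tauto.
Qed.

Lemma brelT_nogap w : brelT w (∀ x, cquest x ⊆ cbang x) (~ Gap).
Proof.
  eapply brelT_iff; [brl|]. cbv beta. unfold Gap. split.
  - intros H (x & z & K). destruct (H x z). tauto.
  - intros H x z. assert (K : ~ (~ z ε x /\ ~ out z x)) by (intros K; apply H; exists x, z; exact K). tauto.
Qed.

Lemma brelT_ACLA w : brelT w ACLA (Glut /\ Gap).
Proof. apply brelT_and; [apply brelT_glut|intros _; apply brelT_gap]. Qed.

Lemma brelT_ACLA_cons w : brelT w ACLA_cons (~ Glut /\ Gap).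
Proof. apply brelT_and; [apply brelT_noglut|intros _; apply brelT_gap]. Qed.

Lemma brelT_ACLA_comp w : brelT w ACLA_comp (~ Gap /\ Glut).
Proof. apply brelT_and; [apply brelT_nogap|intros _; apply brelT_glut]. Qed.

Lemma brelT_all_classical w : brelT w all_classical (~ Glut /\ ~ Gap).
Proof.
  eapply brelT_iff; [unfold all_classical; brl|]. cbv beta. unfold Glut, Gap. split.
  - intros H. split; intros (x & z & K); destruct (H x z); tauto.
  - intros [H1 H2] x z.
    assert (K1 : ~ (z ε x /\ out z x)) by (intros K; apply H1; exists x, z; exact K).
    assert (K2 : ~ (~ z ε x /\ ~ out z x)) by (intros K; apply H2; exists x, z; exact K). tauto.
Qed.

Lemma brelT_exactly_one w p q r s (P Q R S : Prop) : brelT w p P -> brelT w q Q ->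
  brelT w r R -> brelT w s S ->
  brelT w (exactly_one p q r s)
    ((P \/ Q \/ R \/ S) /\ ~ (P /\ Q) /\ ~ (P /\ R) /\ ~ (P /\ S) /\ ~ (Q /\ R) /\ ~ (Q /\ S) /\ ~ (R /\ S)).
Proof.
  intros H1 H2 H3 H4 w' LE. specialize (H1 w' LE); specialize (H2 w' LE).
  specialize (H3 w' LE); specialize (H4 w' LE). unfold exactly_one. simpl. tauto.
Qed.

End Main.

Lemma bs4_provesI (b : bform) (P : forall W : tfmodel, Prop) :
  (forall (W : tfmodel) (HW : pzfc_model W), P W) ->
  (forall (W : tfmodel) (HW : pzfc_model W) (w : world W), brelT w b (P W)) ->
  bs4_proves PZFC (closed b).
Proof.
  intros H K W HW. apply (models_closed b (fun _ => P W)); [intros w rho _; exact (K W HW w)|].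
  intros _. exact (H W HW).
Qed.

Theorem theorem10p10 :
  bs4_proves PZFC (closed (ACLA ↔ tarski_is bs4_conseq)) /\
  bs4_proves PZFC (closed (ACLA_cons ↔ tarski_is k3_conseq)) /\
  bs4_proves PZFC (closed (ACLA_comp ↔ tarski_is lfi1_conseq)) /\
  bs4_proves PZFC (closed (all_classical ↔ tarski_is fol_conseq)) /\
  bs4_proves PZFC (closed (exactly_one ACLA ACLA_cons ACLA_comp all_classical)).
Proof.
  split; [|split; [|split; [|split]]].
  - apply (bs4_provesI _ (fun W => Glut (W := W) /\ Gap (W := W) <-> tar_is (W := W) (tf_csq unrestricted))).
    + intros W HW. symmetry. apply tar_is_bs4.
    + intros W HW w. apply brelT_iff_form; [apply brelT_ACLA|].
      apply brelT_tarski_is. intros; apply brelT_bs4_conseq; assumption.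
  - apply (bs4_provesI _ (fun W => ~ Glut (W := W) /\ Gap (W := W) <-> tar_is (W := W) (tf_csq consistent))).
    + intros W HW. symmetry. apply tar_is_k3.
    + intros W HW w. apply brelT_iff_form; [apply brelT_ACLA_cons|].
      apply brelT_tarski_is. intros; apply brelT_k3_conseq; assumption.
  - apply (bs4_provesI _ (fun W => ~ Gap (W := W) /\ Glut (W := W) <-> tar_is (W := W) (tf_csq complete))).
    + intros W HW. rewrite tar_is_lfi1. tauto.
    + intros W HW w. apply brelT_iff_form; [apply brelT_ACLA_comp|].
      apply brelT_tarski_is. intros; apply brelT_lfi1_conseq; assumption.
  - apply (bs4_provesI _ (fun W => ~ Glut (W := W) /\ ~ Gap (W := W) <-> tar_is (W := W) fol_csq)).
    + intros W HW. symmetry. apply tar_is_fol_iff.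
    + intros W HW w. apply brelT_iff_form; [apply brelT_all_classical|].
      apply brelT_tarski_is. intros; apply brelT_fol_conseq; assumption.
  - eapply bs4_provesI; [|intros W HW w; apply brelT_exactly_one;
      [apply brelT_ACLA|apply brelT_ACLA_cons|apply brelT_ACLA_comp|apply brelT_all_classical]].
    intros W HW. cbv beta. tauto.
Qed.
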